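(* A reduced affine hypersurface $X\subset\mathbb{C}^n$ is $A$-free if and only if all the hypersurface singularities $(X,p)$, for $p$ in the singular set $X_{sing}$ of $X$, are free. In particular, any smooth affine hypersurface $X\subset\mathbb{C}^n$ is $A$-free.
   Context: $R=\mathbb{C}[x_1,\ldots,x_n]$, $\partial_j=\partial/\partial x_j$, and $X:g=0$ with $g\in R$ nonconstant and reduced (square-free). $X$ is called $A$-free if the $R$-module $Der(X)=\{\partial=\sum_j\alpha_j\partial_j : \alpha_j\in R,\ \partial g\in (g)\}$ is free. Let $\mathcal{O}_n$ be the local ring of germs of analytic functions at the origin of $\mathbb{C}^n$. A hypersurface singularity $(X,0):h=0$ at the origin of $\mathbb{C}^n$, $h\in\mathcal{O}_n$, is called free (K. Saito) if the $\mathcal{O}_n$-module $Der(h)=\{\partial=\sum_j\alpha_j\partial_j : \alpha_j\in\mathcal{O}_n,\ \partial h\in (h)\}$ is free; this does not depend on the chosen equation $h$. The germ $(X,p)$ at a point $p$ is regarded as a germ at the origin via translation. *)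

(* Defs.v *)
From HB Require Import structures.
From mathcomp Require Import all_boot all_order all_algebra.
From mathcomp Require Import ring_quotient generic_quotient.
From mathcomp Require Import interval_inference complex.
From mathcomp Require Import ssrcomplements mpoly.
From mathcomp Require Import ring.
From mathcomp Require Import boolp classical_sets functions reals topology normedtype sequences derive.
Set Implicit Arguments.
Unset Strict Implicit.
Unset Printing Implicit Defensive.
Import Order.TTheory GRing.Theory Num.Theory.
Import numFieldNormedType.Exports.
Local Open Scope ring_scope.
Local Open Scope classical_set_scope.

(* Stated as a numClosedFieldType because the topology that
   numFieldNormedType puts on a numFieldType is not inferred on R[i] itself. *)
Definition Cplx (R : realType) : numClosedFieldType := R[i].

Section PowerSeries.
Variables (R : realType) (n : nat).
Local Notation C := (Cplx R).
Implicit Types (c : 'X_{1..n} -> C) (z : 'rV[C]_n) (d e : nat).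

(* Truncation, to total degree less than d, of the power series with
   coefficients c. *)
Definition psum c d z : C :=
  \sum_(m : 'X_{1..n < d}) c m * \prod_i z 0 i ^+ m i.

Lemma sum_half d :
  \sum_(m : 'X_{1..n < d}) (2^-1 : C) ^+ mdeg m <= 2 ^+ n.
Proof.
have half0 : (0 : C) <= 2^-1 by rewrite invr_ge0 ler0n.
case: d => [|d].
  rewrite big1 ?exprn_ge0// => -[m hm] _; by have := hm; rewrite ltn0.
pose F (f : {ffun 'I_n -> 'I_d.+1}) : C := \prod_i 2^-1 ^+ f i.
pose h (m : 'X_{1..n < d.+1}) : {ffun 'I_n -> 'I_d.+1} := [ffun i => inord (m i)].
have hE (m : 'X_{1..n < d.+1}) i : h m i = m i :> nat.
  rewrite ffunE inordK//; apply: leq_ltn_trans (bmdeg m).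
  by rewrite mdegE (bigD1 i)//= leq_addr.
have hinj : injective h.
  move=> m1 m2 /ffunP eqh; apply/val_inj/mnmP => i.
  by rewrite -!hE eqh.
have -> : \sum_(m : 'X_{1..n < d.+1}) (2^-1 : C) ^+ mdeg m
        = \sum_(f in codom h) F f.
  have uh : uniq (codom h) by rewrite map_inj_uniq ?enum_uniq.
  rewrite -(big_uniq _ uh)/= /codom /image_mem big_map big_enum/=.
  apply: eq_bigr => m _; rewrite /F mdegE.
  by rewrite expr_sum; apply: eq_bigr => i _; rewrite hE.
apply: (@le_trans _ _ (\sum_f F f)).
  rewrite big_mkcond/=; apply: ler_sum => f _; case: ifP => // _.
  by apply: prodr_ge0 => i _; rewrite exprn_ge0.
rewrite /F -(bigA_distr_bigA (fun (i : 'I_n) (k : 'I_d.+1) => 2^-1 ^+ k : C))/=.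
rewrite -[leRHS](_ : \prod_(i < n) 2 = _); last by rewrite prodr_const card_ord.
apply: ler_prod => i _; apply/andP; split.
  by apply: sumr_ge0 => k _; rewrite exprn_ge0.
have : (1 - 2^-1) * \sum_(k < d.+1) (2^-1 : C) ^+ k <= 1.
  rewrite -opprB mulNr -subrX1 opprB.
  by rewrite lerBlDr lerDl exprn_ge0.
have -> : (1 : C) - 2^-1 = 2^-1.
  by apply/eqP; rewrite subr_eq -mulr2n -[X in X *+ 2]mul1r -mulrnAl mulfV ?pnatr_eq0.
by rewrite mulrC ler_pdivrMr ?ltr0n// mul1r.
Qed.

Lemma sum_trunc (F : 'X_{1..n} -> C) d e : (d <= e)%N ->
  \sum_(m : 'X_{1..n < e}) F m =
  \sum_(m : 'X_{1..n < d}) F m + \sum_(m : 'X_{1..n < e} | (d <= mdeg m)%N) F m.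
Proof.
move=> de; rewrite (bigID (fun m : 'X_{1..n < e} => (mdeg m < d)%N))/=.
congr (_ + _); last by apply: eq_bigl => m; rewrite -leqNgt.
pose r := [seq val m | m : 'X_{1..n < d}].
have ur : uniq r by rewrite map_inj_uniq ?enum_uniq//; apply: val_inj.
have rP m : (m \in r) = (mdeg m < d)%N.
  apply/mapP/idP => [[m' _ ->]|hm]; first exact: bmdeg.
  by exists (BMultinom hm); rewrite ?mem_enum.
transitivity (\sum_(m <- r) F m).
  rewrite (big_mksub ('X_{1..n < e}))//=; last first.
    by move=> m; rewrite rP => hm; apply: leq_trans de.
  by apply: eq_bigl => m; rewrite rP.
by rewrite big_map big_enum.
Qed.

Lemma norm_monom z (s : C) (m : 'X_{1..n}) : (forall i, `|z 0 i| <= s) ->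
  `|\prod_i z 0 i ^+ m i| <= s ^+ mdeg m.
Proof.
move=> zs; rewrite normr_prod mdegE expr_sum; apply: ler_prod => i _.
by rewrite normr_ge0/= normrX lerXn2r ?nnegrE ?normr_ge0// (le_trans _ (zs i)).
Qed.

Lemma half_small (A e : C) : 0 < e -> 0 <= A ->
  \forall d \near \oo, A * 2^-1 ^+ d < e.
Proof.
move=> e0 A0.
have reA : (complex.Re A)%:C%C = A by apply: RRe_real; rewrite ger0_real.
have ree : (complex.Re e)%:C%C = e by apply: RRe_real; rewrite gtr0_real.
have e0' : 0 < complex.Re e by rewrite -ltcR ree.
have : geometric (complex.Re A) (2^-1 : R) @ \oo --> 0.
  by apply: cvg_geometric; rewrite ger0_norm ?invr_ge0// invf_lt1// ltr1n.
move=> /cvgrPdist_lt /(_ _ e0'); apply: filterS => d.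
rewrite sub0r normrN /= ger0_norm; last first.
  by rewrite mulr_ge0 ?exprn_ge0 ?invr_ge0// -lecR reA.
by rewrite -ltcR ree rmorphM rmorphXn/= fmorphV rmorph_nat/= reA.
Qed.

Lemma psum_tail c (rho A : C) d e z : 0 < rho ->
  (forall m, `|c m| * rho ^+ mdeg m <= A) ->
  (forall i, `|z 0 i| <= rho / 4) -> (d <= e)%N ->
  `|psum c e z - psum c d z| <= A * 2 ^+ n * 2^-1 ^+ d.
Proof.
move=> rho0 cA zrho de.
have half0 : (0 : C) <= 2^-1 by rewrite invr_ge0 ler0n.
have A0 : 0 <= A by apply: le_trans (cA 0%MM); rewrite mulr_ge0 ?normr_ge0// exprn_ge0// ltW.
rewrite /psum (sum_trunc (fun m => c m * \prod_i z 0 i ^+ m i) de) addrAC subrr add0r.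
apply: le_trans (ler_norm_sum _ _ _) _.
apply: (@le_trans _ _ (\sum_(m : 'X_{1..n < e} | (d <= mdeg m)%N)
   A * 2^-1 ^+ d * 2^-1 ^+ mdeg m)).
  apply: ler_sum => m dm; rewrite normrM.
  apply: le_trans (ler_wpM2l (normr_ge0 _) (norm_monom _ zrho)) _.
  have -> : (4 : C)^-1 = 2^-1 * 2^-1 by rewrite -invfM -natrM.
  rewrite !exprMn !mulrA ler_wpM2r ?exprn_ge0//.
  apply: ler_pM => //; rewrite ?mulr_ge0 ?exprn_ge0 ?(ltW rho0)//.
  by rewrite ler_wiXn2l// invf_le1 ?ler1n ?ltr0n.
rewrite -mulr_sumr [leRHS]mulrAC ler_wpM2l ?mulr_ge0 ?exprn_ge0//.
apply: le_trans (sum_half e).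
by rewrite [leRHS](bigID (fun m : 'X_{1..n < e} => (d <= mdeg m)%N))/= lerDl sumr_ge0// => m _; rewrite exprn_ge0.
Qed.

Lemma sum_coef_half c (rho A : C) d : 0 < rho ->
  (forall m, `|c m| * rho ^+ mdeg m <= A) ->
  \sum_(m : 'X_{1..n < d}) `|c m| * (rho / 2) ^+ mdeg m <= A * 2 ^+ n.
Proof.
move=> rho0 cA.
have A0 : 0 <= A by apply: le_trans (cA 0%MM); rewrite mulr_ge0 ?normr_ge0// exprn_ge0// ltW.
apply: (@le_trans _ _ (\sum_(m : 'X_{1..n < d}) A * 2^-1 ^+ mdeg m)).
  by apply: ler_sum => m _; rewrite exprMn mulrA ler_wpM2r.
by rewrite -mulr_sumr ler_wpM2l// sum_half.
Qed.

End PowerSeries.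

Section Analytic.
Variables (R : realType) (n : nat).
Local Notation C := (Cplx R).
Implicit Types (c : 'X_{1..n} -> C) (z : 'rV[C]_n) (f g : 'rV[C]_n -> C).

(* Since the norm on 'rV[C]_n is the sup norm, `|z| < r is a polydisc. The
   coefficient bound makes the series absolutely convergent on it, so the order
   of summation chosen in psum is immaterial. *)
Definition has_pseries c (r : C) f : Prop :=
  [/\ 0 < r, exists M, forall m, `|c m| * r ^+ mdeg m <= M
    & forall z, `|z| < r -> psum c d z @[d --> \oo] --> f z].

Definition analytic0 f : Prop := exists c r, has_pseries c r f.

Lemma norm_entry z i : `|z 0 i| <= `|z|.
Proof.
rewrite [leRHS]/Num.norm/= mx_normE [leLHS]nngE num_le.
exact: (le_bigmax _ (fun ij => `|z ij.1 ij.2|%:nng) (0, i)).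
Qed.

Lemma has_pseriesW c (r s : C) f : has_pseries c r f -> 0 < s -> s <= r ->
  has_pseries c s f.
Proof.
move=> [r0 [M cM] cf] s0 sr; split => //; last first.
  by move=> z zs; apply: cf; apply: lt_le_trans sr.
exists M => m; apply: le_trans (cM m); rewrite ler_wpM2l// lerXn2r ?nnegrE//.
- exact: ltW.
- exact: ltW.
Qed.

Lemma common_radius f g : analytic0 f -> analytic0 g ->
  exists c c' r, has_pseries c r f /\ has_pseries c' r g.
Proof.
move=> [c [r fr]] [c' [s gs]]; have [r0 _ _] := fr; have [s0 _ _] := gs.
have /orP[rs|sr] := real_leVge (gtr0_real r0) (gtr0_real s0).
- exists c, c', r; split; [exact: fr | exact: has_pseriesW gs r0 rs].
- exists c, c', s; split; [exact: has_pseriesW fr s0 sr | exact: gs].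
Qed.

Lemma psum_poly (p : {mpoly C[n]}) d z : (msize p <= d)%N ->
  psum (fun m => p@_m) d z = p.@[z 0].
Proof.
move=> pd; rewrite [in RHS](mpolywE pd) raddf_sum; apply: eq_bigr => m _.
by rewrite /= mevalZ mevalX.
Qed.

Lemma analytic_poly (p : {mpoly C[n]}) : analytic0 (fun z => p.@[z 0]).
Proof.
exists (fun m => p@_m), 1; split => [||z _]; first exact: ltr01.
- exists (\sum_(m <- msupp p) `|p@_m|) => m; rewrite expr1n mulr1.
  have [mp|/memN_msupp_eq0->] := boolP (m \in msupp p); last first.
    by rewrite normr0 sumr_ge0.
  by rewrite (big_rem _ mp)/= lerDl sumr_ge0.
- apply: (@cvg_near_cst _ _ _ _ _ _) => /=.
  by exists (msize p) => // d /= pd; rewrite psum_poly.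
Qed.

Lemma analytic_opp f : analytic0 f -> analytic0 (- f).
Proof.
move=> [c [r [r0 [M cM] cf]]]; exists (fun m => - c m), r; split; [exact: r0| |].
  by exists M => m; rewrite normrN.
move=> z zr; rewrite (_ : (fun d => _) = (fun d => - psum c d z)); last first.
  apply/funext => d; rewrite /psum -sumrN; apply: eq_bigr => m _.
  by rewrite mulNr.
exact: cvgN (cf _ zr).
Qed.

Lemma analytic_add f g : analytic0 f -> analytic0 g -> analytic0 (f + g).
Proof.
move=> /common_radius/[apply] -[c [c' [r [[r0 [M cM] cf] [_ [N cN] cg]]]]].
exists (fun m => c m + c' m), r; split; [exact: r0| |].
  exists (M + N) => m; apply: le_trans (lerD (cM m) (cN m)).
  by rewrite -mulrDl ler_wpM2r ?ler_normD// exprn_ge0// ltW.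
move=> z zr; rewrite (_ : (fun d => _) = (fun d => psum c d z + psum c' d z)).
  exact: cvgD (cf _ zr) (cg _ zr).
apply/funext => d; rewrite /psum -big_split; apply: eq_bigr => m _ /=.
by rewrite mulrDl.
Qed.

Definition ptrunc c d : {mpoly C[n]} := \sum_(m : 'X_{1..n < d}) c m *: 'X_[m].

Lemma meval_ptrunc c d z : (ptrunc c d).@[z 0] = psum c d z.
Proof. by rewrite raddf_sum; apply: eq_bigr => m _; rewrite /= mevalZ mevalX. Qed.

Lemma mcoeff_ptrunc c d m :
  (ptrunc c d)@_m = if (mdeg m < d)%N then c m else 0.
Proof.
case: ifP => [|/negbT md]; first exact: mcoeff_mpoly.
rewrite raddf_sum big1// => m' _ /=; rewrite mcoeffZ mcoeffX.
case: eqP => [mm|_]; last by rewrite mulr0.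
by rewrite -mm bmdeg in md.
Qed.

Definition pmul c c' m : C :=
  (ptrunc c (mdeg m).+1 * ptrunc c' (mdeg m).+1)@_m.

Lemma pmulE c c' d m : (mdeg m < d)%N ->
  pmul c c' m = (ptrunc c d * ptrunc c' d)@_m.
Proof.
move=> md; rewrite /pmul !mcoeffM; apply: eq_bigr => -[k1 k2] /= _.
by rewrite !mcoeff_ptrunc !bmdeg !(leq_trans (bmdeg _)).
Qed.

Lemma coef_mul_bound c c' (rho A B : C) d m : 0 < rho ->
  (forall m, `|c m| * rho ^+ mdeg m <= A) ->
  (forall m, `|c' m| * rho ^+ mdeg m <= B) ->
  `|(ptrunc c d * ptrunc c' d)@_m| * (rho / 2) ^+ mdeg m
     <= (A * 2 ^+ n) * (B * 2 ^+ n).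
Proof.
move=> rho0 cA cB; have rho20 : 0 <= rho / 2 by rewrite divr_ge0 ?ltW ?ltr0n.
have trle c0 k : `|(ptrunc c0 d)@_k| <= `|c0 k|.
  by rewrite mcoeff_ptrunc; case: ifP; rewrite ?normr0.
apply: (@le_trans _ _ ((\sum_(k : 'X_{1..n < (mdeg m).+1}) `|c k| * (rho / 2) ^+ mdeg k)
   * (\sum_(k : 'X_{1..n < (mdeg m).+1}) `|c' k| * (rho / 2) ^+ mdeg k))); last first.
  apply: ler_pM; rewrite ?sum_coef_half//; apply: sumr_ge0 => k _;
  by rewrite mulr_ge0 ?exprn_ge0.
rewrite mcoeffM big_distrlr/= pair_big/=.
apply: le_trans (ler_wpM2r (exprn_ge0 _ rho20) (ler_norm_sum _ _ _)) _.
rewrite mulr_suml big_mkcond/=; apply: ler_sum => -[k1 k2] _ /=.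
case: eqP => [mE|_]; last by rewrite !mulr_ge0 ?exprn_ge0.
have -> : (rho / 2) ^+ mdeg m = (rho / 2) ^+ mdeg k1 * (rho / 2) ^+ mdeg k2.
  by rewrite -exprD -mdegD; congr (_ ^+ mdeg _).
rewrite normrM mulrACA.
by apply: ler_pM; rewrite ?mulr_ge0 ?exprn_ge0// ler_wpM2r ?exprn_ge0.
Qed.

Lemma analytic_mul f g : analytic0 f -> analytic0 g -> analytic0 (f * g).
Proof.
move=> /common_radius/[apply] -[c [c' [r [[r0 [M cM] cf] [_ [N cN] cg]]]]].
have r20 : 0 < r / 2 by rewrite divr_gt0 ?ltr0n.
have r80 : 0 < r / 2 / 4 by rewrite divr_gt0 ?ltr0n.
have r82 : r / 2 / 4 <= r / 2.
  by rewrite ler_pdivrMr ?ltr0n// ler_peMr ?(ltW r20)// ler1n.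
have r8r : r / 2 / 4 <= r.
  by apply: le_trans r82 _; rewrite ler_pdivrMr ?ltr0n// ler_peMr ?(ltW r0)// ler1n.
set B := (M * 2 ^+ n) * (N * 2 ^+ n).
exists (pmul c c'), (r / 2 / 4); split; [exact: r80| |].
  exists B => m; apply: le_trans (coef_mul_bound (mdeg m).+1 m r0 cM cN).
  by rewrite ler_wpM2l// lerXn2r ?nnegrE ?(ltW r80) ?(ltW r20).
move=> z zr; have zr' : `|z| < r by exact: lt_le_trans zr r8r.
have zi i : `|z 0 i| <= r / 2 / 4 by exact: le_trans (norm_entry z i) (ltW zr).
have B0 : 0 <= B * 2 ^+ n.
  have M0 : 0 <= M by apply: le_trans (cM 0%MM); rewrite mulr_ge0 ?exprn_ge0 ?(ltW r0).
  have N0 : 0 <= N by apply: le_trans (cN 0%MM); rewrite mulr_ge0 ?exprn_ge0 ?(ltW r0).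
  by rewrite !mulr_ge0 ?exprn_ge0.
have key d : `|psum c d z * psum c' d z - psum (pmul c c') d z|
    <= B * 2 ^+ n * 2^-1 ^+ d.
  set P := ptrunc c d * ptrunc c' d.
  have -> : psum (pmul c c') d z = psum (fun m => P@_m) d z.
    by apply: eq_bigr => m _; rewrite (pmulE c c' (bmdeg m)).
  rewrite -(meval_ptrunc c) -(meval_ptrunc c') -mevalM -/P -(@psum_poly P (maxn d (msize P))) ?leq_maxr//.
  have PB m : `|P@_m| * (r / 2) ^+ mdeg m <= B by exact: coef_mul_bound.
  exact: (@psum_tail _ _ (fun m => P@_m) _ _ _ _ _ r20 PB zi (leq_maxl d (msize P))).
apply/cvgrPdist_lt => e e0; have e20 : 0 < e / 2 by rewrite divr_gt0 ?ltr0n.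
have cfg : psum c d z * psum c' d z @[d --> \oo] --> f z * g z.
  exact: cvgM (cf _ zr') (cg _ zr').
move/cvgrPdist_lt: cfg => /(_ _ e20) H1.
have H2 := half_small e20 B0.
near=> d.
have -> : (f * g) z - psum (pmul c c') d z
  = (f z * g z - psum c d z * psum c' d z) +
    (psum c d z * psum c' d z - psum (pmul c c') d z) by rewrite addrA subrK.
apply: le_lt_trans (ler_normD _ _) _; rewrite [ltRHS](splitr e); apply: ltrD.
  by near: d.
by apply: le_lt_trans (key d) _; near: d.
Unshelve. all: by end_near. Qed.

End Analytic.

Section Derivative.
Variables (R : realType) (n : nat).
Local Notation C := (Cplx R).
Implicit Types (c : 'X_{1..n} -> C) (z : 'rV[C]_n) (f g : 'rV[C]_n -> C).

Lemma cvg_norm_le (u : nat -> C) (l K : C) : 0 <= K ->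
  u @ \oo --> l -> (forall d, `|u d| <= K) -> `|l| <= K.
Proof.
move=> K0 ul uK; rewrite real_leNgt ?ger0_real//; apply/negP => Kl.
have e0 : 0 < `|l| - K by rewrite subr_gt0.
move/cvgrPdist_lt: ul => /(_ _ e0) [d _ /(_ d (leqnn d))/= ld].
have := le_lt_trans (ler_normD _ _) (ltr_leD ld (uK d)).
by rewrite !subrK ltxx.
Qed.

Lemma norm_le_ReIm (x : C) :
  `|x| <= (`|complex.Re x| + `|complex.Im x|)%:C%C :> C.
Proof.
have -> : x = (complex.Re x)%:C%C + 'i%C * (complex.Im x)%:C%C :> C.
  exact: (complexE x).
rewrite /= rmorphD; apply: le_trans (ler_normD _ _) _.
have normCR (y : R) : `|(y%:C)%C : C| = (`|y|)%:C%C.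
  by rewrite normc_def /= expr0n addr0 sqrtr_sqr.
rewrite normrM !normCR (_ : `|'i%C| = 1); last first.
  by rewrite normc_def /= expr0n add0r expr1n sqrtr1.
by rewrite mul1r /= !(mul0r, mul1r, subr0, addr0, add0r).
Qed.

Lemma cauchy_half (u : nat -> C) (B : C) : 0 <= B ->
  (forall d e, (d <= e)%N -> `|u e - u d| <= B * 2^-1 ^+ d) ->
  cvg (u @ \oo).
Proof.
move=> B0 uB.
have cvgpart (h : C -> R) : (forall x y, h (x - y) = h x - h y) ->
    (forall x, (`|h x|)%:C%C <= `|x| :> C) -> cvg ((h \o u) @ \oo).
  move=> hB hle; apply: cauchy_cvg; apply: cauchy_exP => e e0.
  have e0' : (0 : C) < e%:C%C by rewrite ltcR.
  have [N _ HN] := half_small e0' B0.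
  exists (h (u N)); exists N => // d /= Nd.
  rewrite /ball/= distrC -hB -ltcR; apply: le_lt_trans (hle _) _.
  exact: le_lt_trans (uB _ _ Nd) (HN _ (leqnn N)).
have cRe := cvgpart (@complex.Re R) _ _.
have cIm := cvgpart (@complex.Im R) _ _.
have {}cRe : cvg (((@complex.Re R) \o u) @ \oo).
  by apply: cRe => [x y|x]; [rewrite raddfB | exact: normc_ge_Re].
have {}cIm : cvg (((@complex.Im R) \o u) @ \oo).
  apply: cIm => [x y|x]; first by rewrite raddfB.
  rewrite -[leRHS](_ : `|x * 'i%C| = _); last first.
    by rewrite normrM (_ : `|'i%C| = 1) ?mulr1// normc_def /= expr0n add0r expr1n sqrtr1.
  by rewrite -normrN -[X in `|X|]ReiNIm; exact: normc_ge_Re.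
apply/cvg_ex; exists ((lim (((@complex.Re R) \o u) @ \oo)) +i* (lim (((@complex.Im R) \o u) @ \oo)))%C.
apply/cvgrPdist_lt => e e0.
have ree : (complex.Re e)%:C%C = e :> C by apply: RRe_real; rewrite gtr0_real.
have e20 : 0 < complex.Re e / 2 by rewrite divr_gt0// -ltcR ree.
move/cvgrPdist_lt: cRe => /(_ _ e20) H1.
move/cvgrPdist_lt: cIm => /(_ _ e20) H2.
near=> d.
apply: le_lt_trans (norm_le_ReIm _) _; rewrite -[ltRHS]ree ltcR.
rewrite [ltRHS](splitr (complex.Re e)); apply: ltrD; rewrite raddfB/=.
  by near: d.
by near: d.
Unshelve. all: by end_near. Qed.

End Derivative.

Section DerivEstimate.
Variables (R : realType) (n : nat).
Local Notation C := (Cplx R).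
Implicit Types (c : 'X_{1..n} -> C) (z : 'rV[C]_n) (f g : 'rV[C]_n -> C).

Lemma taylor_step (K : comNzRingType) (a t : K) k :
  (a + t) ^+ k.+1 - a ^+ k.+1 - t * (k.+1%:R * a ^+ k)
  = (a + t) * ((a + t) ^+ k - a ^+ k - t * (k%:R * a ^+ k.-1))
    + t ^+ 2 * (k%:R * a ^+ k.-1).
Proof.
case: k => [|k] /=; first by ring.
rewrite -[k.+2%:R]natr1 !exprS; set x := k.+1%:R; set u := (a + t) ^+ k.
by set v := a ^+ k; ring.
Qed.

Lemma expr_taylor (a t s : C) k : `|a| <= s -> `|a + t| <= s ->
  `|(a + t) ^+ k - a ^+ k - t * (k%:R * a ^+ k.-1)| * s ^+ 2
    <= `|t| ^+ 2 * (2 * s) ^+ k.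
Proof.
move=> as_ ats; have s0 : 0 <= s by apply: le_trans as_.
elim: k => [|k IH].
  by rewrite !expr0 mul0r mulr0 subr0 subrr normr0 mul0r mulr1 exprn_ge0.
set E := _ - _ - _ in IH.
have -> : (a + t) ^+ k.+1 - a ^+ k.+1 - t * (k.+1%:R * a ^+ k.+1.-1)
   = (a + t) * E + t ^+ 2 * (k%:R * a ^+ k.-1).
  exact: taylor_step.
apply: (@le_trans _ _ (s * (`|t| ^+ 2 * (2 * s) ^+ k) + `|t| ^+ 2 * (k%:R * s ^+ k.+1))).
  apply: le_trans (ler_wpM2r (exprn_ge0 _ s0) (ler_normD _ _)) _.
  rewrite mulrDl; apply: lerD.
    by rewrite normrM -mulrA; apply: ler_pM; rewrite ?mulr_ge0 ?exprn_ge0.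
  rewrite normrM normrX -mulrA ler_wpM2l ?exprn_ge0// normrM normr_nat -mulrA.
  case: k {IH E} => [|k]; first by rewrite !mul0r.
  rewrite ler_wpM2l// -[in leRHS](addn2 k) exprD ler_wpM2r ?exprn_ge0//.
  by rewrite normrX lerXn2r ?nnegrE.
rewrite mulrCA -mulrDr ler_wpM2l ?exprn_ge0//.
rewrite !exprMn mulrCA -exprS -mulrDl ler_wpM2r ?exprn_ge0//.
by rewrite exprS mulr_natl [2 ^+ k *+ 2]mulr2n lerD2l -natrX ler_nat ltnW// ltn_expl.
Qed.

Lemma monom_taylor z (t s : C) j (m : 'X_{1..n}) :
  (forall i, `|z 0 i| <= s) -> `|z 0 j + t| <= s ->
  `|('X_[m]).@[(z + t *: delta_mx 0 j) 0] - ('X_[m]).@[z 0]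
     - t * (('X_[m] : {mpoly C[n]})^`M(j)).@[z 0]| * s ^+ 2
   <= `|t| ^+ 2 * (2 * s) ^+ mdeg m.
Proof.
move=> zs zts; have s0 : 0 <= s by apply: le_trans zts.
rewrite mderivX mevalZ !mevalX !(bigD1 j (erefl true))/=.
set Q := \prod_(i < n | i != j) z 0 i ^+ m i.
have -> : \prod_(i < n | i != j) (z + t *: delta_mx 0 j) 0 i ^+ m i = Q.
  by apply: eq_bigr => i ij; rewrite !mxE eqxx (negbTE ij) mulr0 addr0.
have -> : \prod_(i < n | i != j) z 0 i ^+ (m - U_(j))%MM i = Q.
  by apply: eq_bigr => i ij; rewrite mnmBE mnm1E eq_sym (negbTE ij) subn0.
rewrite !mxE !eqxx mulr1 mnmBE mnm1E eqxx subn1 [_%:R * (_ * Q)]mulrA [t * (_ * Q)]mulrA.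
rewrite -!mulrBl normrM mulrAC mdegE (bigD1 j (erefl true))/= exprD [leRHS]mulrA.
apply: ler_pM; rewrite ?mulr_ge0 ?exprn_ge0//.
  exact: expr_taylor.
rewrite normr_prod expr_sum; apply: ler_prod => i _; rewrite normr_ge0 normrX/=.
rewrite lerXn2r ?nnegrE ?mulr_ge0//; apply: le_trans (zs i) _.
by rewrite ler_peMl// ler1n.
Qed.

Definition dcoef c j m : C := c (m + U_(j))%MM *+ (m j).+1.

Lemma ptrunc_dcoef c j d : ptrunc (dcoef c j) d = (ptrunc c d.+1)^`M(j).
Proof.
apply/mpolyP => m; rewrite mcoeff_deriv !mcoeff_ptrunc mdegD mdeg1 addn1 ltnS.
by case: ifP => // _; rewrite mul0rn.
Qed.

Lemma dcoef_bound c j (r M : C) m : 0 < r ->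
  (forall m, `|c m| * r ^+ mdeg m <= M) ->
  `|dcoef c j m| * (r / 2) ^+ mdeg m <= M / r.
Proof.
move=> r0 cM; rewrite ler_pdivlMr// (le_trans _ (cM (m + U_(j))%MM))//.
rewrite mdegD mdeg1 addn1 exprSr mulrA ler_wpM2r ?(ltW r0)//.
rewrite /dcoef normrMn -[_ *+ (m j).+1]mulr_natr -mulrA ler_wpM2l//.
rewrite expr_div_n mulrCA ler_piMr ?exprn_ge0 ?(ltW r0)//.
rewrite ler_pdivrMr ?exprn_gt0// mul1r -natrX ler_nat.
apply: leq_ltn_trans (ltn_expl _ (ltnSn 1)).
by rewrite mdegE (bigD1 j)//= leq_addr.
Qed.

Lemma psum_taylor c j (r M t : C) z d : 0 < r ->
  (forall m, `|c m| * r ^+ mdeg m <= M) ->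
  (forall i, `|z 0 i| <= r / 4) -> `|z 0 j + t| <= r / 4 ->
  `|psum c d.+1 (z + t *: delta_mx 0 j) - psum c d.+1 z
    - t * psum (dcoef c j) d z|
   <= `|t| ^+ 2 * (M * 2 ^+ n / (r / 4) ^+ 2).
Proof.
move=> r0 cM zr ztr; have r4 : 0 < r / 4 by rewrite divr_gt0.
rewrite mulrA ler_pdivlMr ?exprn_gt0//.
have E1 v : (ptrunc c d.+1).@[v] = \sum_(m : 'X_{1..n < d.+1}) c m * ('X_[m]).@[v].
  by rewrite /ptrunc raddf_sum; apply: eq_bigr => m _; apply: mevalZ.
have E2 v : ((ptrunc c d.+1)^`M(j)).@[v]
    = \sum_(m : 'X_{1..n < d.+1}) c m * (('X_[m] : {mpoly C[n]})^`M(j)).@[v].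
  rewrite /ptrunc [X in X.@[v]](raddf_sum (mderiv j)) raddf_sum.
  by apply: eq_bigr => m _; rewrite /= mderivZ mevalZ.
rewrite -!meval_ptrunc ptrunc_dcoef !E1 E2 mulr_sumr -!sumrB.
apply: le_trans (ler_wpM2r (exprn_ge0 _ (ltW r4)) (ler_norm_sum _ _ _)) _.
rewrite mulr_suml; apply: (@le_trans _ _ (\sum_(m : 'X_{1..n < d.+1})
   `|t| ^+ 2 * (`|c m| * (r / 2) ^+ mdeg m))); last first.
  by rewrite -mulr_sumr ler_wpM2l ?exprn_ge0// sum_coef_half.
apply: ler_sum => m _; rewrite [t * _]mulrCA -!mulrBr normrM -mulrA.
rewrite [leRHS]mulrCA ler_wpM2l// -[r / 2](_ : 2 * (r / 4) = _).
  exact: monom_taylor.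
by rewrite (natrM _ 2 2) invfM mulrCA mulVKf ?pnatr_eq0.
Qed.

Lemma norm_le_entries z (s : C) : 0 <= s -> (forall i, `|z 0 i| <= s) -> `|z| <= s.
Proof.
move=> /nonnegP[{}s] zs; rewrite [leLHS]/Num.norm/= mx_normE num_le.
apply/bigmax_leP; split => [|[i j] _]; rewrite -num_le/=; first exact: ge0.
by rewrite ord1; exact: zs.
Qed.

Lemma deriv_pseries c (r : C) f j z : has_pseries c r f -> `|z| < r / 2 / 4 ->
  psum (dcoef c j) d z @[d --> \oo] --> 'D_(delta_mx 0 j) f z.
Proof.
move=> [r0 [M cM] cf] zr.
have M0 : 0 <= M by apply: le_trans (cM 0%MM); rewrite mulr_ge0 ?exprn_ge0 ?(ltW r0).
have r20 : 0 < r / 2 by rewrite divr_gt0.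
have r80 : 0 < r / 2 / 4 by rewrite divr_gt0.
have r84 : r / 2 / 4 < r / 4.
  by rewrite ltr_pM2r ?invr_gt0// ltr_pdivrMr// ltr_pMr// ltr1n.
have r4r : r / 4 < r by rewrite ltr_pdivrMr// ltr_pMr// ltr1n.
have zi i : `|z 0 i| <= r / 2 / 4 by exact: le_trans (norm_entry z i) (ltW zr).
have cvgL : cvg (psum (dcoef c j) d z @[d --> \oo]).
  apply: (@cauchy_half _ _ (M / r * 2 ^+ n)) => [|d e de].
    by rewrite mulr_ge0 ?exprn_ge0// divr_ge0 ?(ltW r0).
  exact: (psum_tail r20 (fun m => dcoef_bound j m r0 cM) zi de).
set L := lim (psum (dcoef c j) d z @[d --> \oo]) in cvgL.
have {}cvgL : psum (dcoef c j) d z @[d --> \oo] --> L by [].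
suff -> : 'D_(delta_mx 0 j) f z = L by [].
apply: cvg_lim; first exact: norm_hausdorff.
set K := M * 2 ^+ n / (r / 4) ^+ 2.
have K0 : 0 <= K by rewrite divr_ge0 ?mulr_ge0 ?exprn_ge0// ltW// divr_gt0.
have key h : `|h| <= r / 2 / 4 ->
    `|f (z + h *: delta_mx 0 j) - f z - h * L| <= `|h| ^+ 2 * K.
  move=> hr; have zhr : `|z 0 j + h| <= r / 4.
    apply: le_trans (ler_normD _ _) _; apply: le_trans (lerD (zi j) hr) _.
    by rewrite -mulrDl -splitr.
  have zhi i : `|(z + h *: delta_mx 0 j) 0 i| <= r / 4.
    rewrite !mxE eqxx/=; case: eqP => [->|_]; first by rewrite mulr1.
    by rewrite mulr0 addr0; exact: le_trans (zi i) (ltW r84).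
  have zhr' : `|z + h *: delta_mx 0 j| < r.
    apply: le_lt_trans r4r; apply: norm_le_entries zhi.
    by rewrite divr_ge0// ltW.
  have zr' : `|z| < r by exact: lt_trans zr (lt_trans r84 r4r).
  apply: (@cvg_norm_le _ (fun d => psum c d.+1 (z + h *: delta_mx 0 j)
      - psum c d.+1 z - h * psum (dcoef c j) d z)).
  - by rewrite mulr_ge0// exprn_ge0.
  - apply: cvgB; last by apply: cvgM cvgL; exact: cvg_cst.
    apply: cvgB.
    + by move: (cf _ zhr'); rewrite -cvg_shiftS.
    + by move: (cf _ zr'); rewrite -cvg_shiftS.
  - move=> d; apply: psum_taylor => // i.
    exact: le_trans (zi i) (ltW r84).
apply/cvgrPdist_lt => e e0.
have eK : 0 < e / (K + 1) by rewrite divr_gt0// ltr_wpDl.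
have H1 := dnbhs0_lt (V := C) eK; have H2 := dnbhs0_le (V := C) r80.
near=> h.
have h0 : h != 0 by near: h; exact: nbhs_dnbhs_neq.
have hr : `|h| <= r / 2 / 4 by near: h.
have he : `|h| < e / (K + 1) by near: h.
have -> : L - h^-1 *: ((f \o shift z) (h *: delta_mx 0 j) - f z)
   = - (h^-1 * (f (z + h *: delta_mx 0 j) - f z - h * L)).
  by rewrite mulrBr mulKf// opprB /= [_ + z]addrC.
rewrite normrN normrM normfV ltr_pdivrMl ?normr_gt0//.
apply: le_lt_trans (key h hr) _; rewrite expr2 -mulrA ltr_pM2l ?normr_gt0//.
move: he; rewrite ltr_pdivlMr ?ltr_wpDl// mulrDr mulr1; apply: le_lt_trans.
by rewrite lerDl.
Unshelve. all: by end_near. Qed.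

Lemma analytic_deriv f j :
  analytic0 f -> analytic0 (fun z => 'D_(delta_mx 0 j) f z).
Proof.
move=> [c [r cf]]; have [r0 [M cM] _] := cf.
have r20 : 0 < r / 2 by rewrite divr_gt0.
have r80 : 0 < r / 2 / 4 by rewrite divr_gt0.
exists (dcoef c j), (r / 2 / 4); split; first exact: r80.
- exists (M / r) => m; apply: le_trans (dcoef_bound j m r0 cM).
  rewrite ler_wpM2l// lerXn2r ?nnegrE ?(ltW r80) ?(ltW r20)//.
  by rewrite ler_pdivrMr// ler_peMr ?(ltW r20)// ler1n.
- by move=> z zr; exact: deriv_pseries cf zr.
Qed.
End DerivEstimate.

Section Germs.
Variables (R : realType) (n : nat).
Local Notation C := (Cplx R).
Local Notation F := ('rV[C]_n -> C).

Definition analytic_pred : {pred F} := fun f => `[< analytic0 f >].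

Fact analytic_subring : subring_closed analytic_pred.
Proof.
split=> [|f g /asboolP fa /asboolP ga|f g /asboolP fa /asboolP ga]; apply/asboolP.
- rewrite (_ : 1 = (fun z : 'rV[C]_n => (1 : {mpoly C[n]}).@[z 0])); first exact: analytic_poly.
  by apply/funext => z; rewrite meval1.
- exact: analytic_add fa (analytic_opp ga).
- exact: analytic_mul.
Qed.
HB.instance Definition _ := GRing.isSubringClosed.Build F analytic_pred analytic_subring.

(* Representatives of germs: total functions analytic near the origin, with
   arbitrary values away from it. *)
Record afun := AFun { afun_val :> F; _ : afun_val \in analytic_pred }.
HB.instance Definition _ := [isSub for afun_val].
HB.instance Definition _ := [Choice of afun by <:].
HB.instance Definition _ := [SubChoice_isSubComNzRing of afun by <:].

Lemma afunP (f : afun) : analytic0 f.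
Proof. by case: f => f fP; exact/asboolP. Qed.

Definition germ0 : {pred afun} :=
  fun f => `[< \forall z \near (0 : 'rV[C]_n), f z = 0 >].

Fact germ0_ideal : idealr_closed germ0.
Proof.
split=> [||a u v /asboolP u0 /asboolP v0].
- by apply/asboolP; near=> z.
- by apply/asboolP => /nbhs_singleton/eqP; rewrite oner_eq0.
- apply/asboolP; near=> z.
  rewrite (_ : (a * u + v) z = a z * u z + v z)//.
  rewrite (_ : u z = 0); last by near: z.
  by rewrite mulr0 add0r; near: z.
Unshelve. all: by end_near. Qed.
HB.instance Definition _ := isIdealr.Build afun germ0 germ0_ideal.

(* The local ring O_n: analytic functions modulo equality near the origin. *)
Definition germ := {ideal_quot germ0}.
HB.instance Definition _ := GRing.ComNzRing.on germ.

Definition to_germ (f : afun) : germ := \pi_germ%qT f.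

Lemma eq_to_germ (f g : afun) :
  to_germ f = to_germ g <-> \forall z \near (0 : 'rV[C]_n), f z = g z.
Proof.
have -> : (to_germ f = to_germ g) <-> (f - g \in germ0).
  by rewrite Quotient.idealrBE; split => /eqP.
split=> [/asboolP|fg]; first by apply: filterS => z /eqP; rewrite subr_eq0 => /eqP.
by apply/asboolP; apply: filterS fg => z fgz; rewrite [LHS](_ : _ = f z - g z)// fgz subrr.
Qed.

Definition afun_deriv (j : 'I_n) (f : afun) : afun :=
  AFun (introT (asboolP _) (analytic_deriv j (afunP f))).

(* Does not depend on the representative, see germ_derivE. *)
Definition germ_deriv (j : 'I_n) (x : germ) : germ :=
  to_germ (afun_deriv j (repr x)).

Lemma germ_derivE j f : germ_deriv j (to_germ f) = to_germ (afun_deriv j f).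
Proof.
apply/eq_to_germ; have /eq_to_germ : to_germ (repr (to_germ f)) = to_germ f.
  exact: reprK.
move=> /near_join; apply: filterS => z fg /=.
exact: (@near_eq_derive _ _ _ _ _ z _ fg).
Qed.

Fact translate_analytic (g : {mpoly C[n]}) (p : 'rV[C]_n) :
  (fun z => g.@[(p + z) 0]) \in analytic_pred.
Proof.
apply/asboolP.
pose h : {mpoly C[n]} := g \mPo [tuple ((p 0 i)%:MP + 'X_i)%R | i < n].
rewrite (_ : (fun z => _) = (fun z : 'rV[C]_n => h.@[z 0])); first exact: analytic_poly.
apply/funext => z; rewrite comp_mpoly_meval; apply: meval_eq => i.
by rewrite tnth_map tnth_ord_tuple mevalD mevalC mevalXU mxE.
Qed.

(* The equation of the germ at p, moved to the origin by z |-> p + z. *)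
Definition germ_at (g : {mpoly C[n]}) (p : 'rV[C]_n) : germ :=
  to_germ (AFun (translate_analytic g p)).

End Germs.

Section FreeModule.

(* A basis is allowed to be infinite; finite combinations are indexed by
   sequences. *)
Definition free_module (A : nzRingType) (M : lmodType A) : Prop :=
  exists B : set M,
    (forall x : M, exists2 s : seq (A * M),
       (forall t, t \in s -> B t.2) & x = \sum_(t <- s) t.1 *: t.2) /\
    (forall (s : seq M) (a : M -> A), uniq s -> (forall b, b \in s -> B b) ->
       \sum_(b <- s) a b *: b = 0 -> forall b, b \in s -> a b = 0).

Variables (A : comNzRingType) (n : nat) (D : 'I_n -> A -> A) (h : A).

(* The module of the derivations a = \sum_j a_j D_j with a(h) in the ideal (h),
   encoded by their coefficient vectors. *)
Definition logder_pred : {pred 'rV[A]_n} :=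
  fun a => `[< exists b, \sum_j a 0 j * D j h = b * h >].

Fact logder_submod : submod_closed logder_pred.
Proof.
split=> [|k u v /asboolP[a ua] /asboolP[b vb]]; apply/asboolP.
  by exists 0; rewrite mul0r big1// => j _; rewrite mxE mul0r.
exists (k * a + b); rewrite mulrDl -mulrA -ua -vb mulr_sumr -big_split.
by apply: eq_bigr => j _; rewrite !mxE mulrDl mulrA.
Qed.
HB.instance Definition _ :=
  GRing.isSubmodClosed.Build A 'rV[A]_n logder_pred logder_submod.

Record logder := LogDer {
  logder_val :> 'rV[A]_n;
  _ : logder_val \in logder_pred
}.
HB.instance Definition _ := [isSub for logder_val].
HB.instance Definition _ := [Choice of logder by <:].
HB.instance Definition _ := [SubChoice_isSubLmodule of logder by <:].

End FreeModule.

Section Hypersurface.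
Variables (R : realType) (n : nat).
Local Notation C := (Cplx R).
Implicit Types (g : {mpoly C[n]}).

Definition squarefree g : Prop :=
  forall q r, g = q ^+ 2 * r -> q \is a GRing.unit.

(* The Jacobian criterion; it describes the singular points of g = 0 only when
   g is squarefree. *)
Definition sing g : set 'rV[C]_n :=
  [set p | g.@[p 0] = 0 /\ forall j, (g^`M(j)).@[p 0] = 0].

Definition A_free g : Prop := free_module (logder (@mderiv n C) g).

Definition saito_free (h : germ R n) : Prop :=
  free_module (logder (@germ_deriv R n) h).

End Hypersurface.

(* Main.v *)
(* By Saito's argument, [n] logarithmic derivations of the squarefree [g] have a
   determinant divisible by [g].  Where [d_j g <> 0], the logarithmic derivations
   contain the rows of a matrix of determinant [(d_j g)^(n-1) g].

   If they form a free module with basis [De], then [det De = c g] where [c] divides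
   [g^(n-1)] and all the [(d_j g)^(n-1)], hence is a nonzero constant.  The entries
   of a logarithmic germ are approximated to any order by polynomial logarithmic
   derivations (Artin-Rees), and a germ which is a multiple of [g] to any order is
   a multiple of [g]; by Cramer's rule, [De] is a basis for the germs as well.

   Conversely, a basis of germs at a point is approximated by polynomial logarithmic
   derivations, of determinant [c g]; is [c] a unit at that point, say 0?  To a high
   order, [c] divides [g^(n-1)] and [b^(n-1)], where [b] is the derivative of [g]
   in a generic direction [l], hence it divides some nonzero eliminant [D] constant
   along [l].  On [X_j = (nu_j + l_j xi) t], the lowest coefficient in [t] of [D]
   does not depend on [xi], thus neither does that of [c]; as the one of [g^(n-1)]
   has degree in [xi] equal to its order in [t], the order of [c] must be 0.
   The local bases so obtained are glued, by the Nullstellensatz, to an idempotent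
   matrix whose image is the module of logarithmic derivations, which is free by
   the theorem of Quillen and Suslin. *)

Require Import Defs.
From HB Require Import structures.
From mathcomp Require Import all_boot all_order all_algebra.
From mathcomp Require Import perm generic_quotient fraction complex mpoly ring.
From mathcomp Require Import boolp classical_sets functions reals topology normedtype sequences derive.
Set Implicit Arguments.
Unset Strict Implicit.
Unset Printing Implicit Defensive.
Import Order.TTheory GRing.Theory Num.Theory.
Import numFieldNormedType.Exports.
Local Open Scope ring_scope.

(** * Linear changes of variables *)

(** Square-freeness of [g] among polynomials does not pass at once to the ring of germs, where
    Saito's criterion would give the determinant of a basis directly. So all divisibility arguments
    take place among polynomials, where factorization into primes is at hand, and germs enter
    through their truncations. The price is that a relation such as [Y * c = g ^+ n] holds only up
    to terms of high order at the point, so that [c] cannot be factored against it; what it still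
    controls is lowest homogeneous parts along lines. The one number to be shown zero is the order
    of [c] there, and two multiples of [c] of opposite behaviour force this: one constant along a
    generic direction, the other of the largest possible degree in it. Germs matter only at the
    singular points: off the hypersurface the matrix [g%:M], and at its smooth points the matrix
    built from a partial derivative, already have a determinant of the form [c * g] with [c] nonzero
    at the point. *)

Lemma mpoly_gen_ind (n : nat) (A : nzRingType) (P : {mpoly A[n]} -> Prop) :
  (forall c, P c%:MP) -> (forall i, P 'X_i) ->
  (forall p q, P p -> P q -> P (p + q)) ->
  (forall p q, P p -> P q -> P (p * q)) -> forall p, P p.
Proof.
move=> PC PX PD PM p; rewrite [p]mpolyE.
elim: (msupp p) => [|m s IH]; first by rewrite big_nil -mpolyC0.
rewrite big_cons; apply: (PD) => //; rewrite -mul_mpolyC; apply: (PM) => //.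
rewrite mpolyXE_id; apply: (big_rec P) => [|i q _ Pq]; first by rewrite -mpolyC1.
apply: (PM) => //; elim: (m i) => [|k IHk]; first by rewrite expr0 -mpolyC1.
by rewrite exprS; apply: PM.
Qed.

Lemma mpoly_morph_ext (n : nat) (A S : nzRingType)
    (f g : {rmorphism {mpoly A[n]} -> S}) :
  (forall c, f c%:MP = g c%:MP) -> (forall i, f 'X_i = g 'X_i) -> f =1 g.
Proof.
move=> eqC eqX; apply: mpoly_gen_ind => // p q Hp Hq.
- by rewrite !rmorphD Hp Hq.
- by rewrite !rmorphM Hp Hq.
Qed.

Lemma poly_gen_ind (A : nzRingType) (P : {poly A} -> Prop) :
  (forall c, P c%:P) -> P 'X -> (forall p q, P p -> P q -> P (p + q)) ->
  (forall p q, P p -> P q -> P (p * q)) -> forall p, P p.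
Proof.
move=> PC PX PD PM; elim/poly_ind => [|p c Pp]; first by rewrite -polyC0.
by apply: PD => //; apply: PM.
Qed.

Lemma coefM_top (S : nzRingType) (p q : {poly S}) d e :
  (size p <= d.+1)%N -> (size q <= e.+1)%N ->
  (p * q)`_(d + e) = p`_d * q`_e.
Proof.
move=> pd qe; rewrite coefM.
have dP : (d < (d + e).+1)%N by rewrite ltnS leq_addr.
rewrite (bigD1 (Ordinal dP)) //= addKn big1 ?addr0 // => -[i /= iP] /eqP/val_eqP /= nid.
have [id|di] := ltnP i d.
- rewrite [q`__]nth_default ?mulr0 // (leq_trans qe) // ltn_subRL.
  by rewrite ltn_add2r.
- by rewrite nth_default ?mul0r // (leq_trans pd) // ltn_neqAle eq_sym nid.
Qed.

(* The change of variables of Noether normalization: [X_i] goes to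
   [X_i + l_i x], the last variable to [x]. *)
Section Shear.
Variables (A : comNzRingType) (n : nat) (l : 'I_n -> A).

Definition shear_var (i : 'I_n.+1) : {poly {mpoly A[n]}} :=
  if unlift ord_max i is Some j then ('X_j)%:P + (l j)%:MP%:P * 'X else 'X.

Definition shear : {mpoly A[n.+1]} -> {poly {mpoly A[n]}} := mmap (polyC \o @mpolyC n A) shear_var.
HB.instance Definition _ := GRing.RMorphism.copy shear shear.
Arguments shear : simpl never.

Definition unshear_coef :=
  mmap (@mpolyC n.+1 A) (fun j : 'I_n => 'X_(lift ord_max j) - (l j)%:MP * 'X_ord_max).
HB.instance Definition _ := GRing.RMorphism.copy unshear_coef unshear_coef.
Arguments unshear_coef : simpl never.

Definition unshear := horner_eval ('X_ord_max : {mpoly A[n.+1]}) \o map_poly unshear_coef.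
HB.instance Definition _ := GRing.RMorphism.copy unshear unshear.
Arguments unshear : simpl never.

Lemma shearD p q : shear (p + q) = shear p + shear q.
Proof. exact: rmorphD. Qed.

Lemma shearM p q : shear (p * q) = shear p * shear q.
Proof. exact: rmorphM. Qed.

Lemma shearC c : shear c%:MP = c%:MP%:P.
Proof. by rewrite /shear mmapC. Qed.

Lemma shearX i : shear 'X_i = shear_var i.
Proof. by rewrite /shear mmapX mmap1U. Qed.

Lemma shearX_max : shear 'X_ord_max = 'X.
Proof. by rewrite shearX /shear_var unlift_none. Qed.

Lemma shearX_lift (j : 'I_n) :
  shear 'X_(lift ord_max j) = ('X_j)%:P + (l j)%:MP%:P * 'X.
Proof. by rewrite shearX /shear_var liftK. Qed.

Lemma unshearX : unshear 'X = 'X_ord_max.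
Proof. by rewrite /unshear /= map_polyX /horner_eval hornerX. Qed.

Lemma unshearC p : unshear p%:P = unshear_coef p.
Proof. by rewrite /unshear /= map_polyC /horner_eval hornerC. Qed.

Lemma unshear_coefC c : unshear_coef c%:MP = c%:MP.
Proof. by rewrite /unshear_coef mmapC. Qed.

Lemma unshear_coefX (j : 'I_n) :
  unshear_coef 'X_j = 'X_(lift ord_max j) - (l j)%:MP * 'X_ord_max.
Proof. by rewrite /unshear_coef mmapX mmap1U. Qed.

Lemma shearK : cancel shear unshear.
Proof.
apply: (@mpoly_morph_ext _ _ _ (unshear \o shear) idfun) => [c|i] /=.
  by rewrite shearC unshearC unshear_coefC.
case: (unliftP ord_max i) => [/= j ->|->]; last by rewrite shearX_max unshearX.
by rewrite shearX_lift rmorphD rmorphM /= !unshearC unshearX unshear_coefX unshear_coefC subrK.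
Qed.

Lemma unshearK : cancel unshear shear.
Proof.
apply: poly_gen_ind => [c||p q Hp Hq|p q Hp Hq].
- rewrite unshearC.
  apply: (@mpoly_morph_ext _ _ _ (shear \o unshear_coef) polyC) => [a|j] /=.
    by rewrite unshear_coefC shearC.
  by rewrite unshear_coefX rmorphB rmorphM /= shearC shearX_lift shearX_max addrK.
- by rewrite unshearX shearX_max.
- by rewrite !rmorphD /= Hp Hq.
- by rewrite !rmorphM /= Hp Hq.
Qed.

Definition shear_pt (a : 'I_n -> A) (x : A) (i : 'I_n.+1) : A :=
  if unlift ord_max i is Some j then a j + l j * x else x.

Lemma shear_eval a x f : (map_poly (meval a) (shear f)).[x] = f.@[shear_pt a x].
Proof.
apply: (@mpoly_morph_ext _ _ _
  (horner_eval x \o (map_poly (meval a) \o shear)) (meval (shear_pt a x))) => [c|i] /=.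
  by rewrite shearC map_polyC /= /horner_eval hornerC !mevalC.
rewrite shearX mevalXU /shear_var /shear_pt /horner_eval.
case: (unlift _ _) => [j|]; last by rewrite map_polyX hornerX.
rewrite rmorphD rmorphM /= !map_polyC map_polyX /= !hornerE.
by rewrite mevalXU mevalC.
Qed.

Definition shear_dir (i : 'I_n.+1) : A :=
  if unlift ord_max i is Some j then l j else 1.

Lemma shear_monom m : (size (shear 'X_[m]) <= (mdeg m).+1)%N /\
  (shear 'X_[m])`_(mdeg m) = ('X_[m].@[shear_dir])%:MP.
Proof.
pose Q d (p : {poly {mpoly A[n]}}) c := (size p <= d.+1)%N /\ p`_d = c%:MP.
have QM d e p q c c' : Q d p c -> Q e q c' -> Q (d + e)%N (p * q) (c * c').
  move=> [dp pc] [eq qc]; split; last by rewrite coefM_top // pc qc mpolyCM.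
  apply: leq_trans (size_polyMleq _ _) _.
  by rewrite -subn1 leq_subLR (leq_trans (leq_add dp eq)) // addSn addnS.
have Q1 : Q 0%N 1 1 by split; rewrite ?size_poly1 // coefC mpolyC1.
rewrite mevalX [in shear _]mpolyXE_id rmorph_prod mdegE.
apply: (big_ind3 (fun d p c => Q d p c)) => [//|*|i _]; first exact: QM.
rewrite rmorphXn /= shearX; have Qi : Q 1%N (shear_var i) (shear_dir i).
  rewrite /shear_var /shear_dir; case: (unlift _ _) => [j|].
    split; last by rewrite coefD coefCM coefX !coefC /= mulr1 add0r.
    rewrite (leq_trans (size_polyD _ _)) // geq_max (leq_trans (size_polyC_leq1 _)) //=.
    by rewrite (leq_trans (size_polyMleq _ _)) // size_polyX addn2 /= ltnS size_polyC_leq1.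
  by split; rewrite ?size_polyX // coefX mpolyC1.
elim: (m i) => [|k IH]; first by rewrite !expr0.
by rewrite !exprS -[k.+1]add1n; apply: QM.
Qed.

Lemma shear_expand f :
  shear f = \sum_(m <- msupp f) (f@_m)%:MP%:P * shear 'X_[m].
Proof.
rewrite [in LHS](mpolyE f) rmorph_sum; apply: eq_bigr => m _.
by rewrite /= -mul_mpolyC rmorphM /= shearC.
Qed.

Lemma size_shear f : (size (shear f) <= msize f)%N.
Proof.
rewrite shear_expand big_seq (leq_trans (size_sum _ _ _)) //.
apply/bigmax_leqP_seq => m _ mf; rewrite mul_polyC.
rewrite (leq_trans (size_scale_leq _ _)) // (leq_trans (shear_monom m).1) //.
exact: msize_mdeg_lt.
Qed.

(** A monomial of degree [d] contributes to degree at most [d] in the new variable, with a constant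
    as coefficient there. Hence the leading coefficient is a constant as soon as the top form of [f]
    does not vanish at [shear_dir]. *)
Lemma shear_top f d : (msize f <= d.+1)%N ->
  (shear f)`_d = ((pihomog mdeg d f).@[shear_dir])%:MP.
Proof.
move=> fd; have -> : (pihomog mdeg d f).@[shear_dir]
    = \sum_(m <- msupp f | mdeg m == d) f@_m * 'X_[m].@[shear_dir].
  by rewrite pihomogE raddf_sum; apply: eq_bigr => m _; rewrite /= mevalZ.
rewrite shear_expand coef_sum -[mpolyC _]/(mpolyC n) rmorph_sum /=.
rewrite [RHS]big_mkcond /= !big_seq; apply: eq_bigr => m mf.
rewrite coefCM; case: eqP => [<-|/eqP md].
  by rewrite (shear_monom m).2 mpolyCM.
rewrite nth_default ?mulr0 // (leq_trans (shear_monom m).1) //.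
rewrite -ltnS in md *; have := leq_trans (msize_mdeg_lt mf) fd.
by rewrite ltnS leq_eqVlt (negbTE md).
Qed.

(** Differentiating in the new variable is differentiating along the direction [(l, 1)], so the
    derivative still comes from a polynomial in the original variables. *)
Lemma deriv_shear f :
  (shear f)^`() = shear (\sum_i (shear_dir i)%:MP * f^`M(i)).
Proof.
move: f; apply: mpoly_gen_ind => [c|j|p q Hp Hq|p q Hp Hq].
- by rewrite shearC derivC big1 ?rmorph0 // => i _; rewrite mderivC mulr0.
- rewrite (bigD1 j) //= big1 => [|i ij]; last first.
    by rewrite mderivX mnm1E eq_sym (negbTE ij) scale0r mulr0.
  rewrite addr0 mderivX mnm1E eqxx scale1r -{2}[U_(j)%MM]add0m addmK mpolyX0 mulr1.
  rewrite shearX shearC /shear_var /shear_dir; case: (unlift _ _) => [k|].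
    by rewrite derivD derivM !derivC derivX mulr1 mul0r !add0r.
  by rewrite derivX mpolyC1.
- under eq_bigr => i _ do rewrite mderivD mulrDr.
  by rewrite big_split /= (shearD p) (shearD (\sum_i _)) -Hp -Hq; exact: derivD.
- under eq_bigr => i _ do rewrite mderivM mulrDr [_ * (_ * q)]mulrA (mulrCA _ p).
  rewrite big_split /= -mulr_suml -mulr_sumr (shearM p) shearD !shearM -Hp -Hq.
  exact: derivM.
Qed.

End Shear.
Global Opaque shear unshear unshear_coef.

Lemma poly_natr_nonroot (F : numDomainType) (p : {poly F}) :
  p != 0 -> exists k : nat, ~~ root p k%:R.
Proof.
move=> p0; apply: contrapT => noroot.
pose rs := [seq k%:R : F | k <- iota 0 (size p)].
have /(max_poly_roots p0) : all (root p) rs.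
  apply/allP => _ /mapP[k _ ->]; apply: contrapT => /negP rk.
  by apply: noroot; exists k.
rewrite map_inj_uniq ?iota_uniq; last exact: mulrIn (oner_neq0 _).
by move=> /(_ isT); rewrite size_map size_iota ltnn.
Qed.

Lemma mpoly_nonzero_pt (F : numDomainType) n (f : {mpoly F[n]}) :
  f != 0 -> exists a : 'I_n -> F, f.@[a] != 0.
Proof.
elim: n f => [|n IH] f f0.
  exists (fun=> 0); move: f0; rewrite (nvar0_mpolyC f) mevalC.
  by rewrite mpolyC_eq0.
(* The shear by zero merely singles out the last variable. *)
pose l (i : 'I_n) : F := 0.
have sf0 : shear l f != 0.
  apply: contraNneq f0 => f0; apply/eqP/(can_inj (shearK l)).
  by rewrite f0 rmorph0.
have [a fa] := IH (lead_coef (shear l f)) (etrans (congr1 negb (lead_coef_eq0 _)) sf0).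
have [|k fk] := @poly_natr_nonroot _ (map_poly (meval a) (shear l f)).
  by apply: contraNneq fa => fa; rewrite -coef_map fa coef0.
exists (shear_pt l a k%:R); by rewrite -shear_eval.
Qed.

Lemma dhomog_meval_scale (A : comNzRingType) n d (h : {mpoly A[n]}) (c : A)
    (v : 'I_n -> A) :
  h \is d.-homog -> h.@[fun i => c * v i] = c ^+ d * h.@[v].
Proof.
move=> /dhomogP hd; rewrite !mevalE mulr_sumr big_seq [RHS]big_seq.
apply: eq_bigr => m mh; rewrite mulrCA; congr (_ * _).
under eq_bigr => i _ do rewrite exprMn.
by rewrite big_split /= -expr_sum -mdegE hd.
Qed.

(** The factor ['X_ord_max] provides a point with nonzero last coordinate, which homogeneity
    rescales to 1. *)
Lemma dhomog_nonzero_dir (F : numFieldType) n d (h : {mpoly F[n.+1]}) :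
  h \is d.-homog -> h != 0 -> exists l : 'I_n -> F, h.@[shear_dir l] != 0.
Proof.
move=> hd h0.
have X0 : 'X_ord_max != 0 :> {mpoly F[n.+1]} by rewrite -msize_poly_eq0 msizeX.
have [z] := mpoly_nonzero_pt (mulf_neq0 h0 X0).
rewrite mevalM mevalXU mulf_eq0 negb_or => /andP[hz z0].
exists (fun j => z (lift ord_max j) / z ord_max).
apply: contraNneq hz => hz; apply/eqP.
rewrite -[RHS](mulr0 (z ord_max ^+ d)) -hz -(dhomog_meval_scale _ _ hd).
apply: meval_eq => i; rewrite /shear_dir.
by case: unliftP => [j ->|->]; rewrite ?mulr1 // mulrC divfK.
Qed.

Lemma mcoeff_pihomog (A : nzRingType) n d (f : {mpoly A[n]}) m :
  (pihomog mdeg d f)@_m = if mdeg m == d then f@_m else 0.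
Proof.
rewrite pihomogE raddf_sum /=; case: ifPn => [md|md].
- have [mf|/[dup] mf /memN_msupp_eq0 ->] := boolP (m \in msupp f).
    rewrite (big_rem _ mf) /= md mcoeffZ mcoeffX eqxx mulr1.
    rewrite big_seq_cond big1 ?addr0 // => k /andP[kf _].
    rewrite mcoeffZ mcoeffX; case: eqP kf => [->|]; last by rewrite mulr0.
    by rewrite mem_rem_uniqF ?msupp_uniq.
  rewrite big_seq_cond big1 // => k /andP[kf _].
  by rewrite mcoeffZ mcoeffX; case: eqP kf mf => [->->|]; rewrite ?mulr0.
- rewrite big1 // => k kd; rewrite mcoeffZ mcoeffX; case: eqP => [km|]; last by rewrite mulr0.
  by rewrite -km kd in md.
Qed.

Lemma pihomog_top_neq0 (A : nzRingType) n (f : {mpoly A[n]}) :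
  f != 0 -> pihomog mdeg (msize f).-1 f != 0.
Proof.
move=> f0; apply/eqP => /mpolyP /(_ (mlead f)); rewrite mcoeff0 mcoeff_pihomog.
by rewrite -(mlead_deg f0) eqxx => /eqP; rewrite mleadc_eq0 (negbTE f0).
Qed.

Lemma lead_coef_shear (A : comNzRingType) n (l : 'I_n -> A) (f : {mpoly A[n.+1]}) :
  (pihomog mdeg (msize f).-1 f).@[shear_dir l] != 0 ->
  lead_coef (shear l f) = ((pihomog mdeg (msize f).-1 f).@[shear_dir l])%:MP.
Proof.
set c := (X in X != 0) => c0.
have f0 : f != 0 by apply: contraNneq c0 => f0; rewrite /c f0 raddf0 meval0.
have fS : (msize f).-1.+1 = msize f by rewrite prednK // lt0n msize_poly_eq0.
have cE : (shear l f)`_(msize f).-1 = c%:MP by rewrite shear_top // fS.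
rewrite lead_coefE (_ : size (shear l f) = msize f) //.
apply/eqP; rewrite eqn_leq size_shear /= -fS; apply: contraNltn c0 => sf.
by rewrite -(mpolyC_eq0 n) -cE nth_default.
Qed.

Lemma exists_shear_lead (F : numFieldType) n (f : {mpoly F[n.+1]}) : f != 0 ->
  exists (l : 'I_n -> F) c, c != 0 /\ lead_coef (shear l f) = c%:MP.
Proof.
move=> f0; have [l lf] := dhomog_nonzero_dir (pihomogP mdeg _ f) (pihomog_top_neq0 f0).
by exists l, (pihomog mdeg (msize f).-1 f).@[shear_dir l]; rewrite lead_coef_shear.
Qed.

(** * Factoriality *)

Definition divides (A : comNzRingType) (a b : A) := exists c, b = c * a.

Definition prime_elt (A : idomainType) (p : A) :=
  [/\ p != 0, p \isn't a GRing.unit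
    & forall a b, divides p (a * b) -> divides p a \/ divides p b].

Definition factorial_ring (A : idomainType) := forall a : A, a != 0 ->
  exists (u : A) (s : seq A), [/\ u \is a GRing.unit, forall p, p \in s -> prime_elt p
                & a = u * \prod_(p <- s) p].

Section Divides.
Variable A : comNzRingType.
Implicit Types a b c : A.

Lemma divides_refl a : divides a a.
Proof. by exists 1; rewrite mul1r. Qed.

Lemma divides_trans b a c : divides a b -> divides b c -> divides a c.
Proof. by move=> [x ->] [y ->]; exists (y * x); rewrite mulrA. Qed.

Lemma divides_mull a b c : divides a b -> divides a (c * b).
Proof. by move=> [x ->]; exists (c * x); rewrite mulrA. Qed.

Lemma divides_mulr a b c : divides a b -> divides a (b * c).
Proof. by rewrite mulrC; apply: divides_mull. Qed.

Lemma divides_add a b c : divides a b -> divides a c -> divides a (b + c).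
Proof. by move=> [x ->] [y ->]; exists (x + y); rewrite mulrDl. Qed.

Lemma divides_sub a b c : divides a b -> divides a c -> divides a (b - c).
Proof. by move=> [x ->] [y ->]; exists (x - y); rewrite mulrBl. Qed.

End Divides.

Section Primes.
Variable A : idomainType.
Implicit Types (a b c p : A) (s : seq A).

Lemma divides_unit a u : u \is a GRing.unit -> divides a u -> a \is a GRing.unit.
Proof. by move=> uu [x ux]; move: uu; rewrite ux unitrM => /andP[]. Qed.

Lemma divides_prod_prime p s : prime_elt p -> divides p (\prod_(q <- s) q) ->
  exists2 q, q \in s & divides p q.
Proof.
move=> [p0 pu pP]; elim: s => [|q s IH]; rewrite ?big_nil ?big_cons.
  by move=> /(divides_unit (unitr1 _)); rewrite (negbTE pu).
move=> /pP[pq|/IH[r rs pr]]; first by exists q; rewrite ?mem_head.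
by exists r; rewrite // inE rs orbT.
Qed.

Lemma prime_divides_prime p q : prime_elt p -> prime_elt q -> divides p q ->
  exists2 u, u \is a GRing.unit & q = u * p.
Proof.
move=> [p0 pu _] [q0 qu qP] [x qx]; exists x => //.
have [] := qP x p; first by rewrite -qx; apply: divides_refl.
- move=> [y xy]; move: qx; rewrite xy mulrAC -[in LHS](mul1r q).
  move=> /(mulIf q0) /esym yp1; case/negP: pu; apply: (divides_unit (unitr1 _)).
  by exists y.
- move=> [y py]; move: qx; rewrite py mulrA -[in LHS](mul1r q).
  by move=> /(mulIf q0) /esym yp1; apply: (divides_unit (unitr1 _)); exists y; rewrite mulrC.
Qed.

Lemma factorial_prime_divisor a : factorial_ring A -> a != 0 ->
  a \isn't a GRing.unit -> exists2 p, prime_elt p & divides p a.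
Proof.
move=> fA a0; have [u [[|p s] [uu sp ->]]] := fA a a0.
  by rewrite big_nil mulr1 uu.
move=> _; exists p; first by apply: sp; rewrite mem_head.
by rewrite big_cons mulrCA; exists (u * \prod_(q <- s) q); rewrite mulrC.
Qed.

End Primes.

Section PolyFactorial.
Variable A : idomainType.
Implicit Types (f g h : {poly A}) (c p : A).

(** Instead of passing to polynomials over [A/p], a leading term divisible by [p] is removed from
    one of the factors, by induction on the sum of the sizes. *)
Lemma prime_polyC p : prime_elt p -> prime_elt p%:P.
Proof.
move=> [p0 pu pP]; split; rewrite ?polyC_eq0 //.
  by rewrite poly_unitE size_polyC p0 coefC eqxx.
suff H k f g : (size f + size g <= k)%N -> divides p%:P (f * g) ->
    divides p%:P f \/ divides p%:P g by move=> f g; apply: (H _ f g (leqnn _)).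
elim: k f g => [|k IH] f g.
  rewrite leqn0 addn_eq0 size_poly_eq0 => /andP[/eqP -> _] _.
  by left; exists 0; rewrite mul0r.
move=> fgk pfg.
have [->|f0] := eqVneq f 0; first by left; exists 0; rewrite mul0r.
have [->|g0] := eqVneq g 0; first by right; exists 0; rewrite mul0r.
have lowlead h : h != 0 -> divides p (lead_coef h) -> exists h1,
    (size h1 < size h)%N /\ exists r, h = h1 + r * p%:P.
  move=> h0 [c hc]; exists (h - (lead_coef h) *: 'X^((size h).-1)); split.
    rewrite -(prednK (n := size h)) ?lt0n ?size_poly_eq0 // ltnS.
    apply/leq_sizeP => j hj; rewrite coefB coefZ coefXn.
    case: eqP => [->|/eqP jh]; first by rewrite mulr1 lead_coefE subrr.
    rewrite mulr0 subr0 nth_default // -(prednK (n := size h)) ?lt0n ?size_poly_eq0 //.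
    by rewrite ltn_neqAle eq_sym jh.
  exists (c *: 'X^((size h).-1)).
  by rewrite [_ * p%:P]mulrC mul_polyC scalerA [p * c]mulrC -hc subrK.
have [r fgr] := pfg.
have : divides p (lead_coef f * lead_coef g).
  by rewrite -lead_coefM fgr lead_coefM lead_coefC; exists (lead_coef r).
case/pP => [/(lowlead _ f0)|/(lowlead _ g0)] [h1 [h1s [t ht]]].
- have [||ph1|pg] := IH h1 g; last by right.
  + by rewrite -ltnS; apply: leq_trans fgk; rewrite ltn_add2r.
  + have -> : h1 = f - t * p%:P by rewrite ht addrK.
    rewrite mulrBl; apply: divides_sub => //.
    by rewrite mulrAC; exists (t * g).
  + by left; rewrite ht; apply: divides_add => //; exists t.
- have [||pf|ph1] := IH f h1; first 2 last.
  + by left.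
  + by right; rewrite ht; apply: divides_add => //; exists t.
  + by rewrite -ltnS; apply: leq_trans fgk; rewrite ltn_add2l.
  + have -> : h1 = g - t * p%:P by rewrite ht addrK.
    rewrite mulrBr; apply: divides_sub => //.
    by rewrite mulrA; exists (f * t).
Qed.

Definition primitive_poly f := forall p, prime_elt p -> ~ divides p%:P f.

Hypothesis facA : factorial_ring A.

(** The primes of [c] are cancelled one at a time: each divides [g] or [h], and [e] collects those
    taken from [h]. *)
Lemma gauss_split c f g h : c != 0 -> c%:P * f = g * h ->
  exists g1 h1 e, [/\ f = g1 * h1, h = e%:P * h1 & e != 0].
Proof.
move=> /facA[u [s [uu sp ->]]]; elim: s sp g h => [|p s IH] sp g h.
  rewrite big_nil mulr1 => E; exists (u^-1%:P * g), h, 1.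
  split; rewrite ?mul1r ?oner_eq0 // -mulrA -E mulrA -polyCM mulVr ?polyC1 ?mul1r //.
have pp : prime_elt p by apply: sp; rewrite mem_head.
have p0 : p%:P != 0 by rewrite polyC_eq0; case: pp.
have [_ _ pP] := prime_polyC pp.
rewrite big_cons mulrCA polyCM => E.
have {}sp : forall q, q \in s -> prime_elt q by move=> q qs; apply: sp; rewrite inE qs orbT.
have : divides p%:P (g * h).
  by rewrite -E -mulrA; exists ((u * \prod_(q <- s) q)%:P * f); rewrite mulrC.
case/pP => [[g' gE]|[h' hE]].
- apply: (IH sp g' h); apply: (mulfI p0).
  by rewrite mulrA E gE mulrAC mulrC.
- have [|g1 [h1 [e [fE h'E e0]]]] := IH sp g h'.
    by apply: (mulfI p0); rewrite mulrA E hE mulrA mulrC.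
  exists g1, h1, (p * e); split=> //; last by rewrite mulf_neq0 //; case: pp.
  by rewrite hE h'E polyCM mulrC mulrA.
Qed.

Lemma gauss_cancel c f g : c != 0 -> primitive_poly f -> divides f (c%:P * g) ->
  divides f g.
Proof.
move=> /facA[u [s [uu sp ->]]] fprim; elim: s sp g => [|p s IH] sp g.
  rewrite big_nil mulr1 => -[h E]; exists (u^-1%:P * h).
  by rewrite -mulrA -E mulrA -polyCM mulVr ?polyC1 ?mul1r.
have pp : prime_elt p by apply: sp; rewrite mem_head.
have p0 : p%:P != 0 by rewrite polyC_eq0; case: pp.
have [_ _ pP] := prime_polyC pp.
rewrite big_cons mulrCA polyCM => -[h E]; apply: IH => [q qs|].
  by apply: sp; rewrite inE qs orbT.
have /pP[[h' hE]|/(fprim _ pp)//] : divides p%:P (h * f).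
  by rewrite -E -mulrA; exists ((u * \prod_(q <- s) q)%:P * g); rewrite mulrC.
exists h'; apply: (mulfI p0).
by rewrite mulrA E hE mulrAC mulrC.
Qed.

(** Bezout without fractions: by pseudo-division, an element [d] of least size in the ideal of [f]
    and [a] divides both up to constants. Splitting [f] along [d], irreducibility leaves two cases:
    [f] divides [d], hence a constant multiple of [a]; or [d] is a constant, and [f] divides
    [d * b]. The constants are then cancelled because [f] is primitive. *)
Lemma irreducible_prime f : (1 < size f)%N -> primitive_poly f ->
  (forall g h, f = g * h -> g \is a GRing.unit \/ h \is a GRing.unit) ->
  prime_elt f.
Proof.
move=> fs fprim firr.
have f0 : f != 0 by rewrite -size_poly_gt0 (ltn_trans _ fs).
split=> //; first by rewrite poly_unitE gtn_eqF.
move=> a b fab.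
pose P k := `[< exists2 d : {poly A}, d != 0 & size d = k /\ exists s t, d = s * f + t * a >].
have exP : exists k, P k.
  exists (size f); apply/asboolP; exists f => //; split => //; exists 1, 0.
  by rewrite mul1r mul0r addr0.
case: (ex_minnP exP) => _ /asboolP[d d0 [<- [s [t dE]]]] dmin.
have ddiv q : (exists s' t', q = s' * f + t' * a) -> exists2 c, c != 0 & divides d (c%:P * q).
  move=> [s' [t' qE]]; exists (lead_coef d ^+ Pdiv.CommonRing.rscalp q d).
    by rewrite expf_neq0 // lead_coef_eq0.
  have Pd := Pdiv.ComRing.rdivp_eq d q.
  rewrite -mul_polyC in Pd; exists (Pdiv.CommonRing.rdivp q d); rewrite Pd.
  have [->|r0] := eqVneq (Pdiv.CommonRing.rmodp q d) 0; first by rewrite addr0.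
  suff /dmin : P (size (Pdiv.CommonRing.rmodp q d)).
    by rewrite leqNgt Pdiv.CommonRing.ltn_rmodp d0.
  apply/asboolP; exists (Pdiv.CommonRing.rmodp q d) => //; split => //.
  move: Pd; set c := _%:P; set k := Pdiv.CommonRing.rdivp q d => /eqP; rewrite addrC -subr_eq => /eqP <-.
  exists (c * s' - k * s), (c * t' - k * t); rewrite qE dE; ring.
have [c c0 [q fd]] : exists2 c, c != 0 & divides d (c%:P * f).
  by apply: ddiv; exists 1, 0; rewrite mul1r mul0r addr0.
have [g1 [h1 [e [fE hE e0]]]] := gauss_split c0 fd.
have [g1u|h1u] := firr _ _ fE.
- left; have [c' c'0 da] : exists2 c, c != 0 & divides d (c%:P * a).
    by apply: ddiv; exists 0, 1; rewrite mul1r mul0r add0r.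
  apply: (gauss_cancel c'0 fprim); apply: divides_trans da.
  by exists (e%:P * g1^-1); rewrite hE fE mulrA mulrVK.
- right; move: (h1u); rewrite poly_unitE => /andP[/size_poly1P[w w0 wE] wu].
  have ew0 : e * w != 0 by rewrite mulf_neq0.
  apply: (gauss_cancel ew0 fprim); rewrite polyCM -wE -hE dE mulrDl.
  apply: divides_add; first by rewrite mulrAC; exists (s * b).
  by rewrite -mulrA; apply: divides_mull.
Qed.

(** A prime constant dividing [f] divides its leading coefficient, so the number of prime factors of
    the latter bounds the extraction. *)
Lemma content_split f : f != 0 -> exists c f1, [/\ c != 0, f = c%:P * f1 & primitive_poly f1].
Proof.
rewrite -lead_coef_eq0 => /facA[u [s [uu sp]]].
move: {2}(size s) (erefl (size s)) => k; elim: k s sp u uu f => [|k IH] s sp u uu f ks fE.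
  exists 1, f; split; rewrite ?oner_eq0 ?mul1r // => p [_ pu _] [h hE].
  move: fE; rewrite hE lead_coefM lead_coefC (size0nil ks) big_nil mulr1 => E.
  by case/negP: pu; apply: (divides_unit uu); exists (lead_coef h).
have [fprim|] := pselect (primitive_poly f).
  by exists 1, f; rewrite oner_eq0 mul1r.
move=> /existsNP[p /not_implyP[pp /contrapT[h hE]]].
have [p0 pu pP] := pp.
have : divides p (u * \prod_(q <- s) q).
  by rewrite -fE hE lead_coefM lead_coefC; exists (lead_coef h).
case/pP => [/(divides_unit uu)|]; first by rewrite (negbTE pu).
move=> /(divides_prod_prime pp)[q qs pq].
have [v vu qE] := prime_divides_prime pp (sp _ qs) pq.
have [|||//|c [f1 [c0 hE1 f1prim]]] := IH (rem q s) _ (u * v) _ h.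
- by move=> r /mem_rem; apply: sp.
- by rewrite unitrM uu vu.
- by rewrite size_rem // ks.
- move: fE; rewrite hE lead_coefM lead_coefC (big_rem q) //= {1}qE => E.
  by apply: (mulIf p0); rewrite E; ring.
exists (c * p), f1; split=> //; first by rewrite mulf_neq0.
by rewrite hE hE1 polyCM mulrAC.
Qed.

(** A constant dividing the primitive part is a unit, so any proper factorization of a divisor of
    that part lowers the degree. *)
Theorem factorial_poly : factorial_ring {poly A}.
Proof.
move=> f f0; have [c [f1 [c0 fE f1prim]]] := content_split f0.
have f10 : f1 != 0 by apply: contraNneq f0 => f10; rewrite fE f10 mulr0.
rewrite {f0}fE.
have [u [s [uu sp cE]]] := facA c0.
suff [v [t [vu tp f1E]]] : exists (v : {poly A}) (t : seq {poly A}), [/\ v \is a GRing.unit,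
    forall p : {poly A}, p \in t -> prime_elt p & f1 = v * \prod_(p <- t) p].
  exists (u%:P * v), ([seq p%:P | p <- s] ++ t); split.
  - by rewrite unitrM vu andbT poly_unitE size_polyC coefC /= uu andbT (_ : u != 0) //; apply: contraTneq uu => ->; rewrite unitr0.
  - move=> p; rewrite mem_cat => /orP[/mapP[q qs ->]|]; last exact: tp.
    exact/prime_polyC/sp.
  - rewrite cE f1E polyCM rmorph_prod big_cat big_map /=; ring.
have constu g : g != 0 -> divides g f1 -> (size g <= 1)%N -> g \is a GRing.unit.
  move=> + gf1 /size1_polyC gE; rewrite gE polyC_eq0 => g0; apply: contrapT => gu.
  have [|p pp [x gx]] := factorial_prime_divisor facA g0.
    apply: contra_notN gu => gu.
    by rewrite poly_unitE size_polyC coefC /= g0 gu.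
  case: (f1prim p pp); apply: divides_trans gf1.
  by rewrite gE gx; exists x%:P; rewrite polyCM.
suff H k g : (size g < k)%N -> divides g f1 -> g != 0 -> exists (v : {poly A}) (t : seq {poly A}),
    [/\ v \is a GRing.unit, forall p : {poly A}, p \in t -> prime_elt p
      & g = v * \prod_(p <- t) p] by apply: (H _ f1 (ltnSn _) (divides_refl _) f10).
elim: k g => // k IH g; rewrite ltnS => gk gf1 g0.
have gprim : primitive_poly g.
  by move=> p pp pg; case: (f1prim p pp); apply: divides_trans gf1.
have [gs|gs] := leqP (size g) 1.
  exists g, [::]; split=> [|p|]; [exact: constu | by rewrite in_nil | by rewrite big_nil mulr1].
have [girr|] := pselect (forall a b, g = a * b ->
    a \is a GRing.unit \/ b \is a GRing.unit).
  exists 1, [:: g]; split; rewrite ?unitr1 ?big_seq1 ?mul1r // => p.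
  by rewrite inE => /eqP ->; apply: irreducible_prime girr.
move=> /existsNP[a /existsNP[b /not_implyP[gE /not_orP[/negP au /negP bu]]]].
move: (g0); rewrite gE mulf_eq0 negb_or => /andP[a0 b0].
have af1 : divides a f1 by apply: divides_trans gf1; exists b; rewrite mulrC.
have bf1 : divides b f1 by apply: divides_trans gf1; exists a.
have as1 : (1 < size a)%N by rewrite ltnNge; apply: contra au; apply: constu.
have bs1 : (1 < size b)%N by rewrite ltnNge; apply: contra bu; apply: constu.
have sE : (size g).+1 = (size a + size b)%N.
  by rewrite gE size_mul // prednK // addn_gt0 size_poly_gt0 a0.
have [|//|//|va [ta [vau tap aE]]] := IH a.
  by apply: leq_trans gk; rewrite -ltnS sE -(addn1 (size a)) ltn_add2l.
have [|//|//|vb [tb [vbu tbp bE]]] := IH b.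
  by apply: leq_trans gk; rewrite -ltnS sE -(add1n (size b)) ltn_add2r.
exists (va * vb), (ta ++ tb); split; first by rewrite unitrM vau.
- by move=> p; rewrite mem_cat => /orP[/tap|/tbp].
- by rewrite aE bE big_cat /=; ring.
Qed.

End PolyFactorial.

Lemma divides_morph (A B : comNzRingType) (f : {rmorphism A -> B}) a b :
  divides a b -> divides (f a) (f b).
Proof. by move=> [c ->]; exists (f c); rewrite rmorphM. Qed.

Lemma unit_iso (A B : unitRingType) (f : {rmorphism A -> B}) (g : {rmorphism B -> A}) a :
  cancel f g -> (f a \is a GRing.unit) = (a \is a GRing.unit).
Proof.
move=> fK; apply/idP/idP => [fu|]; last exact: rmorph_unit.
by rewrite -(fK a) rmorph_unit.
Qed.

Lemma prime_iso (A B : idomainType) (f : {rmorphism A -> B}) (g : {rmorphism B -> A}) p :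
  cancel f g -> cancel g f -> prime_elt p -> prime_elt (f p).
Proof.
move=> fK gK [p0 pu pP]; split.
- by rewrite -(rmorph0 f) (can_eq fK).
- by rewrite (unit_iso _ fK).
- move=> a b /(divides_morph g); rewrite fK rmorphM => /pP[]/(divides_morph f); rewrite gK.
    by left.
  by right.
Qed.

Lemma factorial_iso (A B : idomainType) (f : {rmorphism A -> B}) (g : {rmorphism B -> A}) :
  cancel f g -> cancel g f -> factorial_ring A -> factorial_ring B.
Proof.
move=> fK gK facA b b0.
have [|u [s [uu sp gbE]]] := facA (g b).
  by rewrite -(rmorph0 g) (can_eq gK).
exists (f u), [seq f p | p <- s]; split.
- by rewrite (unit_iso _ fK).
- by move=> _ /mapP[p ps ->]; apply: (prime_iso fK gK); apply: sp.
- by rewrite -[b]gK gbE rmorphM rmorph_prod big_map.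
Qed.

Theorem factorial_mpoly (F : fieldType) n : factorial_ring {mpoly F[n]}.
Proof.
elim: n => [|n IH].
  move=> p; rewrite (nvar0_mpolyC p) mpolyC_eq0 => c0.
  exists (p@_0)%:MP, [::]; rewrite big_nil mulr1; split=> //.
  by rewrite rmorph_unit // unitfE.
pose l (i : 'I_n) : F := 0.
exact: (factorial_iso (unshearK l) (shearK l) (factorial_poly IH)).
Qed.

(** * Elimination and the Nullstellensatz *)

Definition is_ideal (A : comNzRingType) (I : A -> Prop) :=
  [/\ I 0, forall a b, I a -> I b -> I (a + b) & forall a b, I b -> I (a * b)].

Section Ideals.
Variables (A : comNzRingType) (I : A -> Prop).
Hypothesis idI : is_ideal I.

Lemma idealN a : I a -> I (- a).
Proof. by case: idI => _ _ IM; rewrite -mulN1r; apply: IM. Qed.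

Lemma idealB a b : I a -> I b -> I (a - b).
Proof. by case: (idI) => _ ID _ Ia /idealN; apply: ID. Qed.

Lemma ideal_sum (J : Type) (s : seq J) (P : pred J) (G : J -> A) :
  (forall i, P i -> I (G i)) -> I (\sum_(i <- s | P i) G i).
Proof. by case: idI => I0 ID _ IG; apply: (big_ind I). Qed.

Lemma det_trick d (N : 'M[A]_d) (X : 'cV[A]_d) :
  (forall i, I ((N *m X) i 0)) -> forall i, I (\det N * X i 0).
Proof.
move=> NX i; have -> : \det N * X i 0 = (\adj N *m (N *m X)) i 0.
  by rewrite mulmxA mul_adj_mx mul_scalar_mx mxE.
by rewrite mxE; apply: ideal_sum => j _; case: idI => _ _; apply.
Qed.

End Ideals.

Section Elimination.
Variable A : comNzRingType.
Implicit Types (f q : {poly A}).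

Lemma rmodp_expand f q : f \is monic -> Pdiv.CommonRing.rmodp q f =
  \sum_(j < (size f).-1) (Pdiv.CommonRing.rmodp q f)`_j *: 'X^j.
Proof.
move=> fm; have f0 := monic_neq0 fm.
have sr : (size (Pdiv.CommonRing.rmodp q f) <= (size f).-1)%N.
  by rewrite -ltnS prednK ?size_poly_gt0 // Pdiv.CommonRing.ltn_rmodp.
rewrite -(poly_def _ (fun j => (Pdiv.CommonRing.rmodp q f)`_j)).
apply/polyP => i; rewrite coef_poly; case: ltnP => // /(leq_trans sr) ri.
by rewrite nth_default.
Qed.

Lemma map_rmodp_eq0 (B : nzRingType) (ev : {rmorphism A -> B}) f q : f \is monic ->
  map_poly ev q = 0 -> map_poly ev (Pdiv.CommonRing.rmodp q f) = 0.
Proof.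
move=> fm; have fm' := monic_map ev fm.
rewrite {1}(Pdiv.RingMonic.rdivp_eq fm q) rmorphD rmorphM /= => E.
have := Pdiv.RingMonic.rmodp_addl_mul_small fm' (map_poly ev (Pdiv.CommonRing.rdivp q f))
  (r := map_poly ev (Pdiv.CommonRing.rmodp q f)).
rewrite E Pdiv.CommonRing.rmod0p => <- //.
rewrite (leq_ltn_trans (size_poly _ _)) // size_map_poly_id0; last first.
  by rewrite (eqP fm) rmorph1 oner_eq0.
by rewrite Pdiv.CommonRing.ltn_rmodp monic_neq0.
Qed.

(** The witness is the norm of [q] from [A[X]/(f)] to [A]: by the determinant trick it lies in the
    ideal of [f] and [q], and it specializes to the norm of 1. *)
Lemma elim_unit (B : comNzRingType) (ev : {rmorphism A -> B}) (I : {poly A} -> Prop) f q :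
  is_ideal I -> f \is monic -> I f -> I q -> map_poly ev q = 1 ->
  exists2 c, I c%:P & ev c = 1.
Proof.
move=> idI fm If Iq q1; have [I0 ID IM] := idI.
case dE : (size f).-1 => [|d].
  have f1 : f = 1.
    have := monicP fm; rewrite lead_coefE dE => f01.
    by rewrite (size1_polyC (_ : size f <= 1)%N) ?f01 // -(prednK (n := size f)) ?dE // size_poly_gt0 monic_neq0.
  by exists 1; rewrite ?rmorph1 // -f1.
pose r (i : 'I_d.+1) := Pdiv.CommonRing.rmodp ('X^i * (1 - q)) f.
(* The matrix of multiplication by [q] modulo [f], written as 1 minus that of [1 - q], which
   vanishes under [ev]. *)
pose N : 'M[A]_d.+1 := 1%:M - \matrix_(i, j) (r i)`_j.
exists (\det N).
  have := @det_trick _ _ idI _ (map_mx polyC N) (\col_i 'X^i) _ 0.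
  rewrite mxE mulr1 det_map_mx; apply => i.
  have -> : (map_mx polyC N *m \col_j 'X^j) i 0 = 'X^i - r i.
    rewrite /r rmodp_expand // dE /N map_mxB map_mx1 mulmxBl mul1mx !mxE.
    by congr (_ - _); apply: eq_bigr => j _; rewrite !mxE mul_polyC.
  have -> : 'X^i - r i = 'X^i * q + Pdiv.CommonRing.rdivp ('X^i * (1 - q)) f * f.
    rewrite /r; have E := Pdiv.RingMonic.rdivp_eq fm ('X^i * (1 - q)).
    by apply/eqP; rewrite subr_eq -addrA -E mulrBr mulr1 addrC subrK.
  by apply: ID; apply: IM.
rewrite -det_map_mx /N map_mxB map_mx1 (_ : map_mx _ _ = 0) ?subr0 ?det1 //.
apply/matrixP => i j; rewrite !mxE -coef_map /r map_rmodp_eq0 ?coef0 //.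
by rewrite rmorphM rmorphB rmorph1 /= q1 subrr mulr0.
Qed.

End Elimination.

(** Again [c] is a norm, that of [b] modulo [f]. It is nonzero because multiplication by [b] is
    injective modulo [f]: a kernel vector would be a nonzero multiple of [f] of smaller degree than
    [f]. *)
Lemma elim_coprime (A : idomainType) (f b : {poly A}) : f \is monic ->
  (forall q, divides f (b * q) -> divides f q) ->
  exists c u w, c != 0 /\ c%:P = u * f + w * b.
Proof.
move=> fm fb; case dE : (size f).-1 => [|d].
  have f1 : f = 1.
    have := monicP fm; rewrite lead_coefE dE => f01.
    by rewrite (size1_polyC (_ : size f <= 1)%N) ?f01 // -(prednK (n := size f)) ?dE // size_poly_gt0 monic_neq0.
  by exists 1, 1, 0; rewrite oner_eq0 f1 mul0r addr0 mulr1 polyC1.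
pose r (i : 'I_d.+1) := Pdiv.CommonRing.rmodp ('X^i * b) f.
pose N : 'M[A]_d.+1 := \matrix_(i, j) (r i)`_j.
pose I p := exists u w, p = u * f + w * b.
have idI : is_ideal I.
  split; first by exists 0, 0; rewrite !mul0r addr0.
  - move=> _ _ [u [w ->]] [u' [w' ->]]; exists (u + u'), (w + w'); ring.
  - move=> a _ [u [w ->]]; exists (a * u), (a * w); ring.
have rE i : r i = 'X^i * b - Pdiv.CommonRing.rdivp ('X^i * b) f * f.
  by rewrite {1}(Pdiv.RingMonic.rdivp_eq fm ('X^i * b)) addrC addKr.
have Ic : I (\det N)%:P.
  have := @det_trick _ _ idI _ (map_mx polyC N) (\col_i 'X^i) _ 0.
  rewrite mxE mulr1 det_map_mx; apply => i.
  have -> : (map_mx polyC N *m \col_j 'X^j) i 0 = r i.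
    rewrite /r rmodp_expand // dE !mxE; apply: eq_bigr => j _.
    by rewrite /N !mxE mul_polyC.
  by rewrite rE; exists (- Pdiv.CommonRing.rdivp ('X^i * b) f), 'X^i; ring.
have [u [w cE]] := Ic; exists (\det N), u, w; split=> //.
apply/det0P => -[v v0 vN].
have : divides f (b * rVpoly v).
  exists (\sum_i (v 0 i)%:P * Pdiv.CommonRing.rdivp ('X^i * b) f).
  rewrite mulr_suml /rVpoly poly_def mulr_sumr.
  have /(congr1 (fun M : 'rV_ _ => rVpoly M)) := vN; rewrite linear0 => E.
  apply/eqP; rewrite -subr_eq0 -sumrB -[X in _ == X]E; apply/eqP.
  rewrite [RHS]/rVpoly poly_def.
  transitivity (\sum_i (v 0 i)%:P * r i).
    by apply: eq_bigr => i _; rewrite valK rE -mul_polyC; ring.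
  under [RHS]eq_bigr => j _ do rewrite valK mxE scaler_suml.
  rewrite exchange_big /=; apply: eq_bigr => i _.
  rewrite /r rmodp_expand // dE mulr_sumr; apply: eq_bigr => j _.
  by rewrite mxE mul_polyC scalerA.
move=> /fb[k vE]; case/eqP: v0; apply: (can_inj rVpolyK); rewrite linear0 vE.
have [->|k0] := eqVneq k 0; first by rewrite mul0r.
have := size_poly d.+1 (fun k => if insub k is Some i then v 0 i else 0).
rewrite -/(rVpoly v) vE size_Mmonic // -ltnS prednK; last first.
  by rewrite addn_gt0 size_poly_gt0 k0.
rewrite -dE; have := size_poly_gt0 k; rewrite k0 => k1.
by rewrite -(prednK (n := size f)) ?size_poly_gt0 ?monic_neq0 // dE /= addnS ltnS -[X in (_ <= X)%N]add0n leq_add2r leqNgt k1.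
Qed.

(** After a shear the ideal contains a monic polynomial, and the induction applies to its constants
    [J0]. At a point [a], the image of [J] in one variable is generated by the image of some [d]; a
    root of it would be a common zero of [I], so this image is a nonzero constant, and [elim_unit]
    gives an element of [J0] with value 1 at [a]. *)
Theorem weak_nullstellensatz (F : numClosedFieldType) n (I : {mpoly F[n]} -> Prop) :
  is_ideal I -> (forall a : 'I_n -> F, exists2 f, I f & f.@[a] != 0) -> I 1.
Proof.
elim: n I => [|n IH] I idI Inz.
  have [f If] := Inz (fun=> 0); have [_ _ IM] := idI.
  rewrite (nvar0_mpolyC f) mevalC => f0.
  have -> : 1 = (f@_0)^-1%:MP * f by rewrite {2}(nvar0_mpolyC f) -mpolyCM mulVf.
  exact: IM.
have [I0 ID IM] := idI; have [f If] := Inz (fun=> 0).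
have [->|f0 _] := eqVneq f 0; first by rewrite meval0 eqxx.
have [l [c [c0 lc]]] := exists_shear_lead f0.
pose J p := I (unshear l p).
have idJ : is_ideal J.
  split; rewrite /J; first by rewrite rmorph0.
  - by move=> p q Jp Jq; rewrite rmorphD; apply: ID.
  - by move=> p q Jq; rewrite rmorphM; apply: IM.
pose f1 := shear l (c^-1%:MP * f).
have f1m : f1 \is monic.
  rewrite monicE /f1 rmorphM /= shearC lead_coefM lead_coefC lc -mpolyCM mulVf //.
have Jf1 : J f1 by rewrite /J shearK; apply: IM.
pose J0 a := J a%:P.
suff : J0 1 by rewrite /J0 /J polyC1 rmorph1.
apply: IH.
  have [K0 KD KM] := idJ; split; rewrite /J0 => *; rewrite ?polyC0 ?polyCD ?polyCM //.
  - exact: KD.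
  - exact: KM.
move=> a; pose P k := `[< exists2 q, J q & map_poly (meval a) q != 0 /\ size (map_poly (meval a) q) = k >].
have exP : exists k, P k.
  exists (size (map_poly (meval a) f1)); apply/asboolP; exists f1 => //; split=> //.
  exact/monic_neq0/monic_map.
case: (ex_minnP exP) => _ /asboolP[d Jd [d0 <-]] dmin.
have ddvd q : J q -> map_poly (meval a) d %| map_poly (meval a) q.
  move=> Jq; apply: contraT => /[dup] nd; rewrite /dvdp => r0.
  pose liftC (p : {poly F}) : {poly {mpoly F[n]}} := map_poly (@mpolyC n F) p.
  have liftK p : map_poly (meval a) (liftC p) = p.
    by rewrite /liftC -map_poly_comp map_poly_id // => x _ /=; rewrite mevalC.
  have E : map_poly (meval a) (q - liftC (map_poly (meval a) q %/ map_poly (meval a) d) * d) =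
      map_poly (meval a) q %% map_poly (meval a) d.
    by rewrite rmorphB rmorphM /= liftK {1}(divp_eq (map_poly (meval a) q) (map_poly (meval a) d)) addrC addKr.
  suff /dmin : P (size (map_poly (meval a) q %% map_poly (meval a) d)).
    by rewrite leqNgt ltn_modp d0.
  apply/asboolP; exists (q - liftC (map_poly (meval a) q %/ map_poly (meval a) d) * d).
    by apply: idealB => //; case: idJ => _ _; apply.
  by rewrite E.
have [d1|] := eqVneq (size (map_poly (meval a) d)) 1%N; last first.
  move=> /closed_rootP[x dx].
  have [q Iq qx] := Inz (shear_pt l a x).
  have : map_poly (meval a) d %| map_poly (meval a) (shear l q).
    by apply: ddvd; rewrite /J shearK.
  by move=> /dvdpP[k E]; move: qx; rewrite -shear_eval E hornerM (rootP dx) mulr0 eqxx.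
have /eqP/size_poly1P[e e0 dE] := d1.
have [|||//||del Jdel del1] := @elim_unit _ _ (meval a) J f1 ((e^-1%:MP)%:P * d) => //.
- by case: idJ => _ _; apply.
- by rewrite rmorphM /= dE map_polyC /= mevalC -polyCM mulVf ?polyC1.
by exists del => //; rewrite del1 oner_eq0.
Qed.

Definition unimodular_completion (A : comUnitRingType) := forall m (v : 'rV[A]_m.+1)
  (w : 'cV[A]_m.+1), v *m w = 1%:M -> exists2 G, G \in unitmx & v *m G = delta_mx 0 0.

Lemma comp_poly_addr (A : comNzRingType) (p a h : {poly A}) :
  exists s, p \Po (a + h) = p \Po a + h * s.
Proof.
elim/poly_ind: p => [|p c [s IH]]; first by exists 0; rewrite !comp_poly0 mulr0 addr0.
exists (p \Po a + s * (a + h)); rewrite !comp_poly_MXaddC IH; ring.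
Qed.

(** * Completion of unimodular rows *)

(* [G = M(a)^-1 M(a + c y)]; it has polynomial entries because [M(a + c y)] is
   congruent to [M(a)] modulo [c = det M(a)]. *)
Lemma orbit_comp_poly (A : idomainType) k (M : 'M[{poly A}]_k) (c : A) (a y : {poly A}) :
  c != 0 -> \det M = c%:P -> exists2 G, G \in unitmx &
    map_mx (comp_poly (a + c%:P * y)) M = map_mx (comp_poly a) M *m G.
Proof.
move=> c0 Mc.
have /choice[S SP] (ij : 'I_k * 'I_k) :
  exists s, M ij.1 ij.2 \Po (a + c%:P * y) = M ij.1 ij.2 \Po a + c%:P * y * s.
  exact: comp_poly_addr.
set Ma := map_mx (comp_poly a) M; set Mb := map_mx _ M.
pose G := 1%:M + y *: (\adj Ma *m \matrix_(i, j) S (i, j)).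
have detMa : \det Ma = c%:P by rewrite det_map_mx Mc /= comp_polyC.
have detMb : \det Mb = c%:P by rewrite det_map_mx Mc /= comp_polyC.
have MG : Mb = Ma *m G.
  rewrite mulmxDr mulmx1 -scalemxAr mulmxA mul_mx_adj detMa mul_scalar_mx scalerA.
  by apply/matrixP => i j; rewrite !mxE (SP (i, j)) [y * _]mulrC.
exists G => //; rewrite unitmxE (_ : \det G = 1) ?unitr1 //.
have cP0 : c%:P != 0 by rewrite polyC_eq0.
by apply: (mulfI cP0); rewrite mulr1 -[in LHS]detMa -det_mulmx -MG detMb.
Qed.

Section SuslinMatrix.
Variables (B : comNzRingType) (m : nat).

(* First row [f]; eliminating the last [m] columns leaves the determinant
   [f_0 g1 + (f_1 + sum_i lam_i f_(i+2)) g2]. *)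
Definition suslin_mx (f0 f1 g1 g2 : B) (fr : 'rV[B]_m) (lam : 'cV[B]_m) : 'M[B]_(2 + m) :=
  block_mx (\matrix_(i < 2, j < 2) if i == 0 then (if j == 0 then f0 else f1)
                                   else if j == 0 then - g2 else g1)
           (col_mx fr 0 : 'M_(1 + 1, m)) (row_mx 0 (- lam) : 'M_(m, 1 + 1)) 1%:M.

Lemma det_suslin_mx f0 f1 g1 g2 fr lam :
  \det (suslin_mx f0 f1 g1 g2 fr lam) = f0 * g1 + (f1 + (fr *m lam) 0 0) * g2.
Proof.
set D := (row_mx 0 (- lam) : 'M[B]_(m, 1 + 1)).
have E : suslin_mx f0 f1 g1 g2 fr lam *m block_mx 1%:M 0 (- D) 1%:M =
    block_mx (\matrix_(i < 2, j < 2) if i == 0 then (if j == 0 then f0 else f1 + (fr *m lam) 0 0)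
                                   else if j == 0 then - g2 else g1)
             (col_mx fr 0 : 'M_(1 + 1, m)) 0 1%:M.
  rewrite mulmx_block !mulmx1 !mul1mx !mulmx0 !add0r subrr; congr block_mx.
  rewrite mulmxN; have -> : col_mx fr 0 *m D = col_mx (row_mx 0 (- (fr *m lam))) 0 :> 'M_(1 + 1, 1 + 1).
    by rewrite mul_col_mx mul0mx mul_mx_row mulmx0 mulmxN.
  apply/matrixP => i j; rewrite !mxE.
  case: splitP => i' iE; rewrite ord1 in iE.
    have -> : i = 0 by apply/val_inj.
    rewrite !mxE; case: splitP => j' jE; rewrite ord1 in jE.
      by have -> : j = 0 by [apply/val_inj]; rewrite mxE oppr0 addr0.
    have -> : j = 1 by apply/val_inj.
    by rewrite /= !mxE opprK !ord1.
  have -> : i = 1 by apply/val_inj.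
  by rewrite !mxE oppr0 addr0.
have := congr1 determinant E; rewrite det_mulmx det_lblock !det1 !mulr1 => ->.
rewrite det_ublock det1 mulr1 (expand_det_row _ 0) !big_ord_recl big_ord0 /cofactor.
move: ((fr *m lam) 0 0) => t; rewrite !det_mx11 !mxE /= ?mxE /=; ring.
Qed.

Lemma suslin_mx_row f0 f1 g1 g2 fr lam :
  row 0 (suslin_mx f0 f1 g1 g2 fr lam) = row_mx (\row_(j < 2) if j == 0 then f0 else f1) fr.
Proof.
apply/rowP => j; rewrite !mxE.
case: splitP => i' /= iE; last by [].
have -> : i' = 0 by apply/val_inj.
rewrite !mxE; case: splitP => j' _; first by rewrite !mxE.
rewrite !mxE; case: splitP => k kE; first by rewrite ord1.
by move: kE; rewrite /= .
Qed.

End SuslinMatrix.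

Section Suslin.
Variables (F : numClosedFieldType) (n m : nat).
Local Notation A := {mpoly F[n]}.

(** At each root [z] of [f0] the polynomial [P z], in a new variable, is nonzero. An integer [k]
    avoiding the roots of these finitely many polynomials gives [lam i = k ^+ i.+1]. *)
Lemma closed_coprime_combination (f0 f1 : {poly F}) (fr : 'rV[{poly F}]_m) :
  f0 != 0 -> (forall z, root f0 z -> root f1 z -> exists i, ~~ root (fr 0 i) z) ->
  exists lam : 'I_m -> F, coprimep f0 (f1 + \sum_i (lam i)%:P * fr 0 i).
Proof.
move=> f00 fz.
pose P z := f1.[z]%:P + \sum_(i < m) (fr 0 i).[z] *: 'X^(i.+1).
have P0 z : root f0 z -> P z != 0.
  move=> rz; apply/eqP => Pz.
  have Pc k : (P z)`_k = 0 by rewrite Pz coef0.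
  have [|i] := fz z rz.
    move: (Pc 0%N); rewrite coefD coefC coef_sum big1 ?addr0 => [/eqP//|i _].
    by rewrite coefZ coefXn mulr0.
  case/eqP; move: (Pc i.+1); rewrite coefD coefC coef_sum (bigD1 i) //= coefZ coefXn eqxx mulr1.
  rewrite big1 ?addr0 ?add0r // => j ji.
  by rewrite coefZ coefXn eqSS val_eqE eq_sym (negbTE ji) mulr0.
have [rs f0E] := closed_field_poly_normal f0.
have rsP z : root f0 z = (z \in rs).
  by rewrite f0E rootZ ?lead_coef_eq0 // root_prod_XsubC.
have [|k kP] := @poly_natr_nonroot _ (\prod_(z <- rs) P z).
  by rewrite prodf_seq_neq0; apply/allP => z zrs /=; rewrite P0 // rsP.
exists (fun i => k%:R ^+ i.+1).
apply/Pdiv.ClosedField.coprimepP => z rz; apply: contra kP => /eqP fz0.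
rewrite rsP in rz; rewrite (big_rem z) //= rootM; apply/orP; left.
apply/rootP; rewrite -fz0 /P !hornerE !horner_sum; congr (_ + _).
by apply: eq_bigr => i _; rewrite !hornerE mulrC.
Qed.

(** The [c] for which adding multiples of [c] to the argument of [f] stays in one orbit of
    invertible matrices form an ideal [I], since orbit relations compose. No point [p] is a zero of
    [I]: at [p] a combination of the other entries is made coprime to [f 0 0], and eliminating the
    variable between the two gives [c] as the determinant of a matrix with first row [f]. So 1 is in
    [I], which links [f] to its value at 0. *)
Lemma suslin_monic (f : 'rV[{poly A}]_(2 + m)) (w : 'cV[{poly A}]_(2 + m)) :
  f *m w = 1%:M -> f 0 0 \is monic ->
  exists2 G, G \in unitmx & f = map_mx (comp_poly 0) f *m G.
Proof.
move=> fw fm.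
pose I (c : A) := forall a y : {poly A}, exists2 G, G \in unitmx &
  map_mx (comp_poly (a + c%:P * y)) f = map_mx (comp_poly a) f *m G.
have idI : is_ideal I.
  split=> [a y|c c' Ic Ic' a y|b c Ic a y].
  - by exists 1%:M; rewrite ?unitmx1 // polyC0 mul0r addr0 mulmx1.
  - have [G Gu GE] := Ic a y; have [G' Gu' GE'] := Ic' (a + c%:P * y) y.
    exists (G *m G'); first by rewrite unitmx_mul Gu.
    by rewrite polyCD mulrDl addrA GE' GE mulmxA.
  - have -> : (b * c)%:P * y = c%:P * (b%:P * y) by rewrite polyCM; ring.
    exact: Ic.
suff /(weak_nullstellensatz idI)/(_ 0 'X)[G Gu GE] : forall p : 'I_n -> F, exists2 c, I c & c.@[p] != 0.
  exists G => //; rewrite -GE add0r polyC1 mul1r.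
  by apply/matrixP => i j; rewrite mxE comp_polyXr.
move=> p; pose ev : {rmorphism {poly A} -> {poly F}} := map_poly (meval p).
pose f0 := f 0 0; pose f1 := f 0 1; pose fr : 'rV_m := @rsubmx _ _ 2 m f.
have fE : f = row_mx (\row_(j < 2) if j == 0 then f0 else f1) fr.
  rewrite -[LHS](@hsubmxK _ _ 2 m); congr row_mx.
  apply/rowP => j; rewrite !mxE; case: eqP => [->|/eqP j0].
    by congr (f _ _); apply/val_inj.
  congr (f _ _); apply/val_inj => /=; case: j j0 => -[|[|]] //.
have [|z rz0 rz1|lam cop] := @closed_coprime_combination (ev f0) (ev f1) (map_mx ev fr).
- exact/monic_neq0/monic_map.
- apply: contrapT => /forallNP fz.
  have : (ev ((f *m w) 0 0)).[z] = 0.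
    rewrite fE -[w](@vsubmxK _ 2 m) mul_row_col !mxE big_ord_recl big_ord1 !mxE /=.
    rewrite !rmorphD rmorph_sum /= !rmorphM /= !hornerE horner_sum.
    rewrite (rootP rz0) (rootP rz1) !mul0r !add0r big1 // => i _.
    rewrite rmorphM hornerM; have /negP := fz i; rewrite negbK mxE => /rootP ->.
    by rewrite mul0r.
  by rewrite fw mxE eqxx rmorph1 hornerC => /eqP; rewrite oner_eq0.
have /Bezout_eq1_coprimepP[[u1 u2] /= uE] := cop.
pose liftC (q : {poly F}) : {poly A} := map_poly (@mpolyC n F) q.
have liftK q : ev (liftC q) = q.
  by rewrite /ev /liftC /= -map_poly_comp map_poly_id // => x _ /=; rewrite mevalC.
pose lamP : 'cV[{poly A}]_m := \col_i (lam i)%:MP%:P.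
pose f1' := f1 + (fr *m lamP) 0 0.
have evf1' : ev f1' = ev f1 + \sum_i (lam i)%:P * map_mx ev fr 0 i.
  rewrite /f1' rmorphD mxE rmorph_sum; congr (_ + _); apply: eq_bigr => i _ /=.
  by rewrite !mxE rmorphM /= map_polyC /= mevalC mulrC.
pose J q := exists g1 g2, q = f0 * g1 + f1' * g2.
have idJ : is_ideal J.
  split; first by exists 0, 0; rewrite !mulr0 addr0.
  - move=> _ _ [a [b ->]] [a' [b' ->]]; exists (a + a'), (b + b'); ring.
  - move=> a _ [b [b' ->]]; exists (a * b), (a * b'); ring.
have [|||c [g1 [g2 cE]] c1] := @elim_unit _ _ (meval p) J f0 (liftC u1 * f0 + liftC u2 * f1') idJ fm.
- by exists 1, 0; rewrite mulr1 mulr0 addr0.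
- by exists (liftC u1), (liftC u2); ring.
- by rewrite rmorphD !rmorphM /= !liftK -/ev evf1'.
have c0 : c != 0 by apply: contra_eqN c1 => /eqP ->; rewrite rmorph0 eq_sym oner_eq0.
exists c; last by rewrite c1 oner_eq0.
move=> a y; pose M := suslin_mx f0 f1 g1 g2 fr lamP.
have [|G Gu GE] := @orbit_comp_poly _ _ M c a y c0; first by rewrite det_suslin_mx -cE.
exists G => //; have fM : f = row 0 M by rewrite suslin_mx_row.
by rewrite fM !map_row GE row_mul.
Qed.

End Suslin.

Section Completion.

Lemma unit_entry_completion (A : comUnitRingType) m (v : 'rV[A]_m.+1) i :
  v 0 i \is a GRing.unit -> exists2 G, G \in unitmx & v *m G = delta_mx 0 0.
Proof.
move=> vi; pose v' : 'rV_(1 + m) := xcol 0 i v.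
pose G : 'M[A]_(1 + m) := block_mx (v 0 i)^-1%:M (- (v 0 i)^-1 *: rsubmx v') 0 1%:M.
have Gu : G \in unitmx by rewrite unitmxE det_ublock det1 mulr1 det_scalar1 unitrV.
exists (tperm_mx 0 i *m G); first by rewrite unitmx_mul unitmx_perm.
have l1 : lsubmx v' = (v 0 i)%:M.
  apply/rowP => j; rewrite ord1 !mxE mulr1n.
  by congr (v _ _); rewrite -[RHS](tpermL 0 i); congr (tperm _ _ _); apply/val_inj.
rewrite mulmxA -xcolE -/v'.
suff -> : v' *m G = row_mx 1%:M 0.
  apply/rowP => j; rewrite !mxE; case: splitP => k kE; rewrite !mxE ?ord1.
    by rewrite (_ : j = 0) ?eqxx //; apply/val_inj; rewrite /= kE ord1.
  have /negPf -> : j != 0 by rewrite -val_eqE /= kE.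
  by rewrite andbF.
rewrite -[v' in LHS]hsubmxK mul_row_block l1 mulmx0 mulmx1 addr0.
by rewrite -scalar_mxM mulrV // mul_scalar_mx scalerA mulrN mulrV // scaleN1r addNr.
Qed.

(** Once an entry is monic in the last variable, the row is equivalent to its value at 0, which has
    one variable less. *)
Theorem mpoly_unimodular_completion (F : numClosedFieldType) n :
  unimodular_completion {mpoly F[n]}.
Proof.
elim: n => [|n IH] m v w vw.
  have [i vi] : exists i, v 0 i != 0.
    apply: contrapT => /forallNP v0; move/matrixP: vw => /(_ 0 0).
    rewrite !mxE big1 => [/eqP|i _]; first by rewrite eq_sym oner_eq0.
    by have /negP/negPn/eqP -> := v0 i; rewrite mul0r.
  apply: (@unit_entry_completion _ _ _ i).
  move: vi; rewrite (nvar0_mpolyC (v 0 i)) mpolyC_eq0 => vi.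
  by rewrite rmorph_unit // unitfE.
(* A row of length one is a unit; the Suslin matrix needs two columns. *)
case: m v w vw => [|m] v w vw.
  apply: (@unit_entry_completion _ _ _ 0); apply/unitrP; exists (w 0 0).
  by move/matrixP: vw => /(_ 0 0); rewrite !mxE big_ord1 mulrC => ->.
have [i vi] : exists i, v 0 i != 0.
  apply: contrapT => /forallNP v0; move/matrixP: vw => /(_ 0 0).
  rewrite !mxE big1 => [/eqP|i _]; first by rewrite eq_sym oner_eq0.
  by have /negP/negPn/eqP -> := v0 i; rewrite mul0r.
have [l [c [c0 lc]]] := exists_shear_lead vi.
pose T : 'M[{mpoly F[n.+1]}]_m.+2 := tperm_mx 0 i *m (c^-1%:MP)%:M.
have Tu : T \in unitmx.
  rewrite unitmx_mul unitmx_perm /= unitmxE det_scalar unitrX // rmorph_unit //.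
  by rewrite unitfE invr_eq0.
pose f := map_mx (shear l) (v *m T).
pose wf := map_mx (shear l) (invmx T *m w).
have fwf : f *m wf = 1%:M by rewrite -map_mxM mulmxA mulmxK // vw map_mx1.
have fm : f 0 0 \is monic.
  rewrite /f /T mulmxA -xcolE mul_mx_scalar !mxE tpermL shearM shearC.
  by rewrite monicE lead_coefM lead_coefC lc -mpolyCM mulVf.
have [G Gu fG] := suslin_monic fwf fm.
have f0E : map_mx (comp_poly 0) f = map_mx polyC (map_mx (horner_eval 0) f).
  by apply/matrixP => j k; rewrite !mxE comp_poly0r horner_evalE horner_coef0.
have [|G' Gu' GE'] := IH m.+1 (map_mx (horner_eval 0) f) (map_mx (horner_eval 0) wf).
  by rewrite -map_mxM fwf map_mx1.
pose H := T *m map_mx (unshear l) (invmx G *m map_mx polyC G').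
exists H.
  rewrite unitmx_mul Tu /=; rewrite unitmxE det_map_mx rmorph_unit // -unitmxE.
  by rewrite unitmx_mul unitmx_inv Gu unitmxE det_map_mx rmorph_unit // -unitmxE.
have vT : v *m T = map_mx (unshear l) f.
  by rewrite /f -map_mx_comp; apply/matrixP => j k; rewrite [RHS]mxE /= shearK.
rewrite /H mulmxA vT -map_mxM mulmxA fG mulmxK // f0E -map_mxM GE'.
by rewrite !map_delta_mx.
Qed.

Lemma row_mx10E (A : nzRingType) q r (i : 'I_q) (j : 'I_(q + r)) :
  row_mx 1%:M 0 i j = (i == j :> nat)%:R :> A.
Proof.
rewrite !mxE; case: splitP => k kE; rewrite mxE kE ?val_eqE //.
by rewrite ltn_eqF // (leq_trans (ltn_ord i)) ?leq_addr.
Qed.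

(* Only right multiplications are used, so that [G] also completes the rows of
   [K] to a basis. *)
Lemma right_invertible_completion (A : comUnitRingType) q r (K : 'M[A]_(q, q + r)) W :
  unimodular_completion A -> K *m W = 1%:M ->
  exists2 G, G \in unitmx & K *m G = row_mx 1%:M 0.
Proof.
move=> UC; elim: q r K W => [|q IH] r K W KW.
  by exists 1%:M; rewrite ?unitmx1 //; apply/matrixP => -[].
have [|G1 G1u G1E] := UC (q + r)%N (usubmx (K : 'M_(1 + q, _))) (lsubmx (W : 'M_(_, 1 + q))).
  rewrite mulmx_lsub mul_usub_mx [_ *m _]KW (scalar_mx_block 1 q).
  exact: block_mxKul.
pose K1 : 'M[A]_(1 + q, 1 + (q + r)) := (K : 'M_(1 + q, 1 + (q + r))) *m G1.
pose W1 : 'M[A]_(1 + (q + r), 1 + q) := invmx G1 *m W.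
have K1W1 : K1 *m W1 = 1%:M by rewrite /K1 /W1 mulmxA mulmxK.
have K1u : usubmx K1 = row_mx 1%:M 0.
  rewrite /K1 -[K in LHS](@vsubmxK _ 1 q) mul_col_mx col_mxKu G1E.
  apply/rowP => j; rewrite !mxE; case: splitP => k kE; rewrite !mxE ?ord1.
    by rewrite (_ : j = 0) ?eqxx //; apply/val_inj; rewrite /= kE ord1.
  have /negPf -> : j != 0 by rewrite -val_eqE /= kE.
  by rewrite andbF.
have K1E : K1 = block_mx 1%:M 0 (lsubmx (dsubmx K1)) (rsubmx (dsubmx K1)).
  by rewrite -[LHS]vsubmxK K1u -[X in col_mx _ X]hsubmxK.
set c := lsubmx (dsubmx K1) in K1E; set K2 := rsubmx (dsubmx K1) in K1E.
have [ur0 dr1] : ursubmx W1 = 0 /\ c *m ursubmx W1 + K2 *m drsubmx W1 = 1%:M.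
  move: K1W1; rewrite K1E -{1}[W1]submxK mulmx_block (scalar_mx_block 1 q).
  by move=> /eq_block_mx[_]; rewrite mul1mx mul0mx addr0.
have [|G2 G2u G2E] := IH r K2 (drsubmx W1); first by move: dr1; rewrite ur0 mulmx0 add0r.
pose G3 : 'M[A]_(1 + (q + r)) := block_mx 1%:M 0 (- (G2 *m col_mx c 0)) G2.
have G3u : G3 \in unitmx by rewrite unitmxE det_lblock det1 mul1r -unitmxE.
exists ((G1 : 'M_(1 + (q + r))) *m G3); first by rewrite unitmx_mul G1u.
have K1G3 : K1 *m G3 = block_mx 1%:M 0 0 (row_mx 1%:M 0).
  rewrite K1E mulmx_block !mul1mx !mul0mx !addr0 mulmx0 add0r.
  by rewrite mulmxN mulmxA G2E mul_row_col mul1mx mul0mx addr0 mulmx1 subrr.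
rewrite mulmxA [_ *m G3]K1G3; apply/matrixP => i j; rewrite row_mx10E mxE.
case: splitP => i' iE; rewrite mxE; case: splitP => j' jE; rewrite ?row_mx10E ?mxE iE jE //.
- by rewrite ord1.
- by rewrite ord1.
Qed.

End Completion.

(** * Projective modules over polynomial rings are free *)

(** An idempotent matrix stands for a finitely generated projective module, its image; [U] and [V]
    are mutually inverse isomorphisms between this image and a free module. *)
Definition idempotent_split (A : nzRingType) := forall N (E : 'M[A]_N), E *m E = E ->
  exists r (U : 'M[A]_(r, N)) (V : 'M[A]_(N, r)), U *m V = 1%:M /\ V *m U = E.

Lemma idempotent_split_field (F : fieldType) : idempotent_split F.
Proof.
move=> N E EE; exists (\rank E), (row_base E), (col_base E).
split; last exact: mulmx_base.
have gen k (R : 'M_(k, N)) C L P : C *m R = E -> R *m P = 1%:M -> L *m C = 1%:M -> R *m C = 1%:M.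
  move=> CR RP LC; have : L *m (E *m E) *m P = L *m E *m P by rewrite EE.
  by rewrite -CR !mulmxA LC !mul1mx -!mulmxA RP mulmx1.
have /row_freeP[P rbP] := row_base_free E; have /row_fullP[L cbL] := col_base_full E.
exact: gen (mulmx_base E) rbP cbL.
Qed.

Lemma idempotent_split_iso (A B : nzRingType) (f : {rmorphism A -> B})
    (g : {rmorphism B -> A}) : cancel g f -> idempotent_split A -> idempotent_split B.
Proof.
move=> gK sA N E EE; have [|r [U [V [UV VU]]]] := sA N (map_mx g E).
  by rewrite -map_mxM EE.
exists r, (map_mx f U), (map_mx f V); rewrite -!map_mxM UV VU map_mx1; split=> //.
by rewrite -map_mx_comp; apply/matrixP => i j; rewrite mxE /= gK.
Qed.

Section Fractions.
Variable A : idomainType.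
Local Notation tofrac := (@FracField.tofrac A).

Lemma fraction_denominator (x : {fraction A}) :
  exists2 d, d != 0 & exists a, tofrac d * x = tofrac a.
Proof.
elim/quotW: x => x; exists (\d_x); first exact: denom_ratioP.
exists (\n_x); unlock FracField.tofrac; rewrite -[LHS]FracField.pi_mul.
apply/eqmodP; rewrite /= FracField.equivfE /FracField.mulf.
by rewrite !numden_Ratio ?mulf_neq0 ?oner_eq0 ?denom_ratioP // mulr1 mul1r mulrC.
Qed.

Lemma matrix_denominator m n (M : 'M[{fraction A}]_(m, n)) :
  exists2 d, d != 0 & exists M', tofrac d *: M = map_mx tofrac M'.
Proof.
have /choice[d dP] (ij : 'I_m * 'I_n) : exists d, d != 0 /\ exists a, tofrac d * M ij.1 ij.2 = tofrac a.
  by have [d d0 da] := fraction_denominator (M ij.1 ij.2); exists d.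
exists (\prod_ij d ij); first by apply/prodf_neq0 => ij _; case: (dP ij).
have /choice[N NP] (ij : 'I_m * 'I_n) : exists a, tofrac (\prod_ij d ij) * M ij.1 ij.2 = tofrac a.
  have [_ [a aE]] := dP ij; exists (\prod_(kl | kl != ij) d kl * a).
  by rewrite (bigD1 ij) //= [_ * \prod_(_ | _) _]mulrC !rmorphM /= -mulrA aE.
by exists (\matrix_(i, j) N (i, j)); apply/matrixP => i j; rewrite !mxE (NP (i, j)).
Qed.

(** A splitting over the field of fractions, with a common denominator [s] cleared. *)
Lemma idempotent_fraction_split N (E : 'M[A]_N) : E *m E = E ->
  exists r (U : 'M[A]_(r, N)) (V : 'M[A]_(N, r)) s,
    [/\ s != 0, U *m V = s%:M, V *m U = s *: E & E *m V = V].
Proof.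
move=> EE; have [|r [U0 [V0 [UV0 VU0]]]] := @idempotent_split_field _ _ (map_mx tofrac E).
  by rewrite -map_mxM EE.
have [a a0 [U UE]] := matrix_denominator U0; have [b b0 [V VE]] := matrix_denominator V0.
have inj m n : injective (@map_mx _ _ tofrac m n).
  move=> M M' /matrixP MM'; apply/matrixP => i j; apply/eqP; rewrite -tofrac_eq.
  by have := MM' i j; rewrite !mxE => ->.
exists r, U, V, (a * b); split; first by rewrite mulf_neq0.
- apply: inj; rewrite map_mxM -UE -VE -scalemxAl -scalemxAr UV0 map_scalar_mx /=.
  by rewrite rmorphM scalerA -scalemx1 scalemx1 -mul_scalar_mx mulmx1.
- apply: inj; rewrite map_mxM -UE -VE -scalemxAl -scalemxAr VU0 map_mxZ /=.
  by rewrite rmorphM scalerA mulrC.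
- apply: inj; rewrite map_mxM -VE -scalemxAr -VU0 -mulmxA UV0 mulmx1 //.
Qed.

End Fractions.

(** Division with remainder of a vector of polynomials by the monic matrix polynomial ['X - phi]. *)
Lemma companion_division (A : comNzRingType) q (phi : 'M[A]_q) (c : 'rV[{poly A}]_q) :
  exists c' c0, c = c' *m ('X%:M - map_mx polyC phi) + map_mx polyC c0.
Proof.
have [k] : exists k, forall i, (size (c 0%R i) <= k)%N.
  by exists (\max_i size (c 0%R i)) => i; apply: (leq_bigmax i).
elim: k c => [|k IH] c ck.
  exists 0, 0; rewrite mul0mx add0r map_mx0; apply/rowP => i.
  by apply/eqP; rewrite mxE -size_poly_eq0 -leqn0.
pose c1 : 'rV_q := \row_i \poly_(j < k) (c 0 i)`_j.+1.
have [|c' [c0 c1E]] := IH c1; first by move=> i; rewrite mxE size_poly.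
have cE : c = 'X *: c1 + map_mx polyC (\row_i (c 0 i)`_0).
  apply/rowP => i; rewrite !mxE; apply/polyP => -[|j].
    by rewrite coefD coefXM coefC add0r.
  rewrite coefD coefXM coefC addr0 /= coef_poly; case: ltnP => // kj.
  by rewrite nth_default // (leq_trans (ck i)).
exists ('X *: c' + map_mx polyC c0), (c0 *m phi + \row_i (c 0 i)`_0).
rewrite {1}cE c1E mulmxDl -scalemxAl scalerDr -!addrA; congr (_ + _).
rewrite mulmxBr map_mxD map_mxM /= addrA subrK addrC [in RHS]mul_mx_scalar addrC.
by [].
Qed.

Lemma companion_injective (A : idomainType) q (phi : 'M[A]_q) (c : 'rV[{poly A}]_q) :
  c *m ('X%:M - map_mx polyC phi) = 0 -> c = 0.
Proof.
move=> /(congr1 (mulmx^~ (\adj (char_poly_mx phi)))).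
rewrite mul0mx -mulmxA mul_mx_adj mul_mx_scalar => /eqP.
by rewrite scalemx_eq0 (negPf (monic_neq0 (char_poly_monic phi))) => /eqP.
Qed.

(** * Projective modules that become free after inverting a monic polynomial *)

Section MonicLattice.
Variables (A : idomainType) (N r : nat) (s : {poly A}).
Variables (E : 'M[{poly A}]_N) (U : 'M[{poly A}]_(r, N)) (V : 'M[{poly A}]_(N, r)).
Hypotheses (sA : idempotent_split A) (sm : s \is monic) (UV : U *m V = s%:M)
  (VU : V *m U = s *: E) (EV : E *m V = V) (EE : E *m E = E).

Let d := (size s).-1.
Let quo (p : {poly A}) := Pdiv.CommonRing.rdivp p s.
Let rem (p : {poly A}) := Pdiv.CommonRing.rmodp p s.

Let size_rem p : (size (rem p) < size s)%N.
Proof. by rewrite Pdiv.CommonRing.ltn_rmodp monic_neq0. Qed.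

Let quo_linear a p q : quo (a *: p + q) = a *: quo p + quo q.
Proof.
rewrite /quo {1}(Pdiv.RingMonic.rdivp_eq sm p) {1}(Pdiv.RingMonic.rdivp_eq sm q).
rewrite scalerDr addrACA scalerAl -mulrDl Pdiv.RingMonic.rdivp_addl_mul_small //.
by rewrite (leq_ltn_trans (size_polyD _ _)) // gtn_max size_rem (leq_ltn_trans (size_scale_leq _ _)) ?size_rem.
Qed.

Let embed (u : 'rV[A]_(r * d)) : 'rV[{poly A}]_r :=
  \row_j \sum_(k < d) u 0 (mxvec_index j k) *: 'X^k.
Let coords (w : 'rV[{poly A}]_r) : 'rV[A]_(r * d) :=
  mxvec (\matrix_(j < r, k < d) (rem (w 0 j))`_k).
(** On the lattice [w *m U] is a multiple of [s], so the division is exact; elsewhere the remainder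
    is dropped, which keeps the map [A]-linear but not linear over [{poly A}]. *)
Let proj (w : 'rV[{poly A}]_r) := map_mx quo (w *m U) *m V.
Let lattice (w : 'rV[{poly A}]_r) := exists v, w = v *m V.

Let quoZ (v : 'rV[{poly A}]_N) : map_mx quo (s *: v) = v.
Proof. by apply/rowP => i; rewrite !mxE mulrC /quo Pdiv.RingMonic.rdivp_mull. Qed.

Let proj_id w : lattice w -> proj w = w.
Proof.
by move=> [v ->]; rewrite /proj -mulmxA VU -scalemxAr quoZ -mulmxA EV.
Qed.

Let lattice_s t : lattice (s *: t).
Proof. by exists (t *m U); rewrite -mulmxA UV mul_mx_scalar. Qed.

Let latticeB w w' : lattice w -> lattice w' -> lattice (w - w').
Proof. by move=> [v ->] [v' ->]; exists (v - v'); rewrite mulmxBl. Qed.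

Let latticeZ a w : lattice w -> lattice (a *: w).
Proof. by move=> [v ->]; exists (a *: v); rewrite scalemxAl. Qed.

Let rem_eq (w : 'rV[{poly A}]_r) : w = map_mx rem w + s *: map_mx quo w.
Proof.
by apply/rowP => i; rewrite !mxE [s * _]mulrC addrC; apply: (Pdiv.RingMonic.rdivp_eq sm).
Qed.

Let lattice_rem w : lattice w -> lattice (map_mx rem w).
Proof.
move=> Lw; have -> : map_mx rem w = w - s *: map_mx quo w by rewrite {2}(rem_eq w) addrK.
exact: latticeB.
Qed.

Let coordsK w : embed (coords w) = map_mx rem w.
Proof.
apply/rowP => j; rewrite !mxE [RHS](rmodp_expand _ sm); apply: eq_bigr => k _.
by rewrite mxvecE mxE.
Qed.

Let rem_small (p : {poly A}) : (size p <= d)%N -> rem p = p.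
Proof.
move=> pd; rewrite /rem Pdiv.CommonRing.rmodp_small // (leq_ltn_trans pd) //.
by rewrite /d prednK // size_poly_gt0 monic_neq0.
Qed.

Let size_embed u j : (size (embed u 0%R j) <= d)%N.
Proof.
rewrite mxE (leq_trans (size_sum _ _ _)) //; apply/bigmax_leqP => k _.
by rewrite (leq_trans (size_scale_leq _ _)) // size_polyXn.
Qed.

Let embedK u : coords (embed u) = u.
Proof.
rewrite -[RHS]vec_mxK /coords; congr mxvec; apply/matrixP => j k.
rewrite mxE rem_small // mxE coef_sum (bigD1 k) //= coefZ coefXn eqxx mulr1.
rewrite big1 ?addr0 ?mxE // => k' kk'.
by rewrite coefZ coefXn eq_sym val_eqE (negPf kk') mulr0.
Qed.

Let coords_rem w : coords (map_mx rem w) = coords w.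
Proof.
congr mxvec; apply/matrixP => j k; rewrite !mxE rem_small //.
by rewrite -ltnS /d prednK ?size_rem // size_poly_gt0 monic_neq0.
Qed.

Let coords_linear a w w' : coords (a%:P *: w + w') = a *: coords w + coords w'.
Proof.
rewrite /coords -linearP; congr mxvec; apply/matrixP => j k; rewrite !mxE.
rewrite /rem Pdiv.RingMonic.rmodpD // mul_polyC Pdiv.RingMonic.rmodpZ //.
by rewrite coefD coefZ.
Qed.

Let embed_mul q (c : 'rV[A]_q) (M : 'M[A]_(q, r * d)) :
  embed (c *m M) = map_mx polyC c *m \matrix_(i, j) embed (row i M) 0 j.
Proof.
apply/rowP => j; rewrite !mxE.
under eq_bigr => k _ do rewrite mxE scaler_suml.
rewrite exchange_big /=; apply: eq_bigr => i _; rewrite !mxE mulr_sumr.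
by apply: eq_bigr => k _; rewrite mxE mul_polyC scalerA.
Qed.

Let projA (u : 'rV[A]_(r * d)) := coords (proj (embed u)).

Let embed_linear a u v : embed (a *: u + v) = a%:P *: embed u + embed v.
Proof.
apply/rowP => j; rewrite !mxE mulr_sumr -big_split; apply: eq_bigr => k _ /=.
by rewrite !mxE mul_polyC scalerA scalerDl.
Qed.

Let projA_linear : linear projA.
Proof.
move=> a u v; rewrite /projA -coords_linear embed_linear; congr coords.
rewrite /proj scalemxAl -mulmxDl [(_ + _) *m U]mulmxDl -[_ *: _ *m U]scalemxAl.
congr (_ *m _); apply/rowP => i; move: (embed u *m U) (embed v *m U) => x y.
by rewrite !mxE !mul_polyC quo_linear.
Qed.

Let projA_coords w : lattice w -> projA (coords w) = coords w.
Proof.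
by move=> Lw; rewrite /projA coordsK proj_id ?coords_rem //; apply: lattice_rem.
Qed.

(* The lattice [row space of V] lies between [s R^r] and [R^r], and [proj] is an
   [A]-linear retraction of [R^r] onto it, so that its image modulo [s] is a
   direct summand of a finite free [A]-module.  An [A]-basis [b] of that image,
   together with the matrix [phi] of the multiplication by 'X, presents the
   lattice as the cokernel of [K = ('X - phi | - T)]. *)
Lemma monic_lattice_presentation : exists q (K : 'M[{poly A}]_(q, q + r))
    (Z : 'M_(N, q + r)) (Y : 'M_(q + r, N)) W,
  [/\ Z *m Y = E, K *m Y = 0, 1%:M - Y *m Z = W *m K & K *m W = 1%:M].
Proof.
pose pL : {linear 'rV[A]_(r * d) -> 'rV[A]_(r * d)} :=
  HB.pack projA (GRing.isLinear.Build _ _ _ _ projA projA_linear).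
pose EA := lin1_mx pL.
have EAE u : u *m EA = projA u by rewrite mul_rV_lin1.
have EAid : EA *m EA = EA.
  apply/row_matrixP => i; rewrite !rowE mulmxA !EAE.
  rewrite {2}/projA projA_coords //; by eexists.
have [q [U1 [V1 [UV1 VU1]]]] := sA EAid.
pose b := \matrix_(i < q, j < r) embed (row i U1) 0 j.
have rowb i : row i b = embed (row i U1) by apply/rowP => j; rewrite !mxE.
have Lb i : lattice (row i b).
  have -> : row i b = map_mx rem (proj (row i b)).
    rewrite -coordsK rowb -/(projA _) -EAE -row_mul -VU1 mulmxA UV1 mul1mx //.
  by apply: lattice_rem; eexists.
have span w : lattice w -> exists ct : 'rV[A]_q * 'rV[{poly A}]_r,
    w = map_mx polyC ct.1 *m b + s *: ct.2.
  move=> Lw; exists (coords w *m V1, map_mx quo w); rewrite /= -embed_mul -mulmxA VU1.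
  by rewrite EAE projA_coords // coordsK -rem_eq.
have indep (c0 : 'rV[A]_q) t : map_mx polyC c0 *m b + s *: t = 0 -> c0 = 0 /\ t = 0.
  rewrite -embed_mul => E0.
  have c00 : c0 = 0.
    rewrite -[c0]mulmx1 -UV1 mulmxA -[c0 *m U1]embedK -coords_rem.
    have -> : map_mx rem (embed (c0 *m U1)) = map_mx rem (embed (c0 *m U1) + s *: t).
      apply/rowP => j; rewrite !mxE /rem Pdiv.RingMonic.rmodpD //.
      by rewrite mulrC Pdiv.RingMonic.rmodp_mull // addr0.
    rewrite E0 coords_rem; have := coords_linear 0 0 0; rewrite !scale0r !add0r.
    have -> : coords 0 = 0.
      by rewrite /coords (_ : \matrix_(_, _) _ = 0) ?linear0 //; apply/matrixP => i j; rewrite !mxE /rem Pdiv.CommonRing.rmod0p coef0.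
    by rewrite mul0mx.
  split=> //; move: E0; rewrite embed_mul c00 map_mx0 mul0mx add0r => /eqP.
  by rewrite scalemx_eq0 (negPf (monic_neq0 sm)) => /eqP.
(* [H] and [V] have the same row space; [Z] and [Y] below are the transition matrices. *)
pose H := col_mx b s%:M.
have /choice[ZP ZPE] := fun i => span (row i V) (ex_intro _ (delta_mx 0 i) (rowE _ _)).
pose Z : 'M[{poly A}]_(N, q + r) := \matrix_(i, j) row_mx (map_mx polyC (ZP i).1) (ZP i).2 0 j.
have ZH : Z *m H = V.
  apply/row_matrixP => i; rewrite row_mul [row i V]ZPE.
  have -> : row i Z = row_mx (map_mx polyC (ZP i).1) (ZP i).2 by apply/rowP => j; rewrite !mxE.
  by rewrite mul_row_col mul_mx_scalar.
have /choice[YP YPE] := Lb.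
pose Y0 : 'M[{poly A}]_(q + r, N) := col_mx (\matrix_(i, j) YP i 0 j) U.
pose Y := Y0 *m E.
have YV : Y *m V = H.
  rewrite /Y -mulmxA EV /Y0 mul_col_mx UV; congr col_mx.
  by apply/row_matrixP => i; rewrite row_mul YPE; congr (_ *m _); apply/rowP => j; rewrite !mxE.
have YE : Y *m E = Y by rewrite /Y -mulmxA EE.
have Lxb i : lattice ('X *: row i b) by apply: latticeZ.
have /choice[TP TPE] := fun i => span _ (Lxb i).
pose phi := \matrix_(i, j) (TP i).1 0 j.
pose T := \matrix_(i, j) (TP i).2 0 j.
pose K := row_mx ('X%:M - map_mx polyC phi) (- T) : 'M[{poly A}]_(q, q + r).
have s0 := monic_neq0 sm.
have KH : K *m H = 0.
  rewrite mul_row_col mulmxBl mul_scalar_mx mulNmx mul_mx_scalar.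
  apply/row_matrixP => i; rewrite !linearB /= !linearZ /= row_mul TPE row0.
  have -> : row i (map_mx polyC phi) = map_mx polyC (TP i).1 by apply/rowP => j; rewrite !mxE.
  have -> : row i T = (TP i).2 by apply/rowP => j; rewrite !mxE.
  by rewrite scalerN; move: (_ *m b) (s *: _) => x y; rewrite [x + y]addrC addrK subrr.
have cancelE p (M : 'M[{poly A}]_(p, N)) : M *m V = 0 -> M *m E = 0.
  move=> /(congr1 (mulmx^~ U)); rewrite mul0mx -mulmxA VU -scalemxAr => /eqP.
  by rewrite scalemx_eq0 (negPf s0) => /eqP.
have ZY : Z *m Y = E.
  have := @cancelE _ (Z *m Y - 1%:M); rewrite mulmxBl -mulmxA YV ZH mul1mx subrr => /(_ erefl).
  by rewrite mulmxBl mul1mx -mulmxA YE => /eqP; rewrite subr_eq0 => /eqP.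
have KY : K *m Y = 0 by rewrite -YE mulmxA cancelE // -mulmxA YV KH.
(* Subtracting a multiple of [K], by division by ['X - phi], makes the coefficients of a relation on
   [b] constant, and the independence of [b] modulo [s] then kills it. *)
have kerH p (M : 'M[{poly A}]_(p, q + r)) : M *m H = 0 -> exists M', M = M' *m K.
  move=> MH; suff /choice[M' M'E] : forall i, exists c, row i M = c *m K.
    exists (\matrix_(i, j) M' i 0 j); apply/row_matrixP => i.
    by rewrite M'E row_mul; congr (_ *m _); apply/rowP => j; rewrite !mxE.
  move=> i; have {MH} : row i M *m H = 0 by rewrite -row_mul MH row0.
  move: (row i M) => v vH.
  have [c' [c0 cE]] := companion_division phi (lsubmx v).
  exists c'; have vK : v - c' *m K = row_mx (map_mx polyC c0) (rsubmx v + c' *m T).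
    rewrite -{1}[v]hsubmxK mul_mx_row opp_row_mx add_row_mx {1}cE addrC addKr.
    by rewrite mulmxN opprK.
  have : (v - c' *m K) *m H = 0 by rewrite mulmxBl vH -mulmxA KH mulmx0 subrr.
  rewrite vK mul_row_col mul_mx_scalar => /indep[c00 t0].
  by apply/eqP; rewrite -subr_eq0 vK c00 t0 map_mx0 row_mx0.
have [|W WK] := kerH _ (1%:M - Y *m Z).
  by rewrite mulmxBl mul1mx -mulmxA ZH YV subrr.
exists q, K, Z, Y, W; split=> //.
(* [K] can be cancelled on the right, the determinant of its first block being a monic
   characteristic polynomial. *)
have KWK : (K *m W - 1%:M) *m K = 0.
  by rewrite mulmxBl mul1mx -mulmxA -WK mulmxBr mulmx1 mulmxA KY mul0mx subr0 subrr.
apply/eqP; rewrite -subr_eq0; apply/eqP/row_matrixP => i; rewrite row0.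
apply: (@companion_injective _ _ phi); have := congr1 (row i) KWK.
by rewrite row_mul row0 mul_mx_row -[in RHS]row_mx0 => /eq_row_mx[].
Qed.

(** The completion [G] turns [K] into [(1 | 0)], so its cokernel is free on the last [r]
    coordinates, extracted by [p0] and inserted by [i0]. *)
Lemma monic_lattice_split : unimodular_completion {poly A} ->
  exists k (U' : 'M[{poly A}]_(k, N)) (V' : 'M_(N, k)), U' *m V' = 1%:M /\ V' *m U' = E.
Proof.
move=> UC; have [q [K [Z [Y [W [ZY KY WK KW]]]]]] := monic_lattice_presentation.
have [G Gu KG] := right_invertible_completion UC KW.
pose p0 : 'M[{poly A}]_(r, q + r) := row_mx 0 1%:M.
pose i0 : 'M[{poly A}]_(q + r, r) := col_mx 0 1%:M.
have KGi : K = row_mx 1%:M 0 *m invmx G by rewrite -KG mulmxK.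
have ip : i0 *m p0 = 1%:M - col_mx 1%:M 0 *m row_mx 1%:M 0 :> 'M[{poly A}]_(q + r).
  rewrite !mul_col_row !mulmx0 !mul0mx !mulmx1 (scalar_mx_block q r).
  by rewrite opp_block_mx add_block_mx !oppr0 !addr0 subrr.
exists r, (p0 *m invmx G *m Y), (Z *m G *m i0); split.
- have -> : p0 *m invmx G *m Y *m (Z *m G *m i0) = p0 *m invmx G *m (Y *m Z) *m G *m i0.
    by rewrite !mulmxA.
  have -> : Y *m Z = 1%:M - W *m K by rewrite -WK opprB addrC subrK.
  rewrite mulmxBr mulmx1 !mulmxBl mulmxKV // -!mulmxA [K *m _]mulmxA KG.
  by rewrite !mul_row_col !mulmx0 mul0mx add0r !mulmx1 addr0 !mulmx0 subr0.
- have -> : Z *m G *m i0 *m (p0 *m invmx G *m Y) = Z *m G *m (i0 *m p0) *m invmx G *m Y.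
    by rewrite !mulmxA.
  rewrite ip mulmxBr mulmx1 !mulmxBl mulmxK // ZY -!mulmxA [row_mx _ _ *m _]mulmxA -KGi KY.
  by rewrite !mulmx0 subr0.
Qed.

End MonicLattice.

(** A shear makes the common denominator [s] monic up to a scalar. The induction hypothesis splits
    the idempotent over the coefficients in the presentation of the lattice; unimodular completion
    is used with all the [n.+1] variables. *)
Theorem quillen_suslin (F : numClosedFieldType) n : idempotent_split {mpoly F[n]}.
Proof.
elim: n => [|n IH].
  apply: (@idempotent_split_iso _ _ (@mpolyC 0 F) (mcoeff 0%MM)); last exact: idempotent_split_field.
  by move=> p; rewrite /= -nvar0_mpolyC.
move=> N E EE; have [r [U [V [s [s0 UV VU EV]]]]] := idempotent_fraction_split EE.
have [l [c [c0 lc]]] := exists_shear_lead s0.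
have cu : (c^-1)%:MP%:P * c%:MP%:P = 1 :> {poly {mpoly F[n]}}.
  by rewrite -!rmorphM /= mulVf // !rmorph1.
pose f := shear l.
have [||||||k [U' [V' [UV' VU']]]] := @monic_lattice_split _ _ _ ((c^-1)%:MP%:P * f s)
  (map_mx f E) (map_mx f U) ((c^-1)%:MP%:P *: map_mx f V) IH.
- by rewrite monicE lead_coefM lead_coefC lc -mpolyCM mulVf.
- by rewrite -scalemxAr -map_mxM UV map_scalar_mx -scale_scalar_mx.
- by rewrite -scalemxAl -map_mxM VU map_mxZ scalerA.
- by rewrite -scalemxAr -map_mxM EV.
- by rewrite -map_mxM EE.
- move=> m v w vw.
  have [|G Gu GE] := @mpoly_unimodular_completion F n.+1 m (map_mx (unshear l) v) (map_mx (unshear l) w).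
    by rewrite -map_mxM vw map_mx1.
  exists (map_mx f G); first by rewrite unitmxE det_map_mx rmorph_unit // -unitmxE.
  rewrite -(map_delta_mx f) -GE map_mxM; congr (_ *m _).
  by rewrite -map_mx_comp; apply/matrixP => i j; rewrite [RHS]mxE /= unshearK.
exists k, (map_mx (unshear l) U'), (map_mx (unshear l) V'); rewrite -!map_mxM UV' VU' map_mx1.
by split=> //; rewrite -map_mx_comp; apply/matrixP => i j; rewrite [LHS]mxE /= shearK.
Qed.

(** * Hilbert's basis theorem and Artin-Rees *)

(* Impredicative form of the ideal spanned by [s]. *)
Definition ideal_span (A : comNzRingType) (s : seq A) (a : A) :=
  forall J, is_ideal J -> (forall g, g \in s -> J g) -> J a.

Definition noetherian (A : comNzRingType) := forall I : A -> Prop, is_ideal I ->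
  exists s, (forall g, g \in s -> I g) /\ (forall a, I a -> ideal_span s a).

Lemma noetherian_field (F : fieldType) : noetherian F.
Proof.
move=> I [I0 ID IM]; have [[a Ia a0]|nI] := pselect (exists2 a, I a & a != 0).
  exists [:: a]; split=> [g|b _ J [J0 JD JM] Ja]; first by rewrite inE => /eqP ->.
  by rewrite -(divfK a0 b); apply: JM; apply: Ja; rewrite mem_head.
exists [::]; split=> // a Ia J [J0 _ _] _.
by have [->//|a0] := eqVneq a 0; case: nI; exists a.
Qed.

Lemma noetherian_iso (A B : comNzRingType) (f : {rmorphism A -> B}) (g : {rmorphism B -> A}) :
  cancel f g -> cancel g f -> noetherian A -> noetherian B.
Proof.
have pull (S T : comNzRingType) (h : {rmorphism S -> T}) J :
    is_ideal J -> is_ideal (fun a => J (h a)).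
  move=> [J0 JD JM]; split=> [|a b|a b]; rewrite ?rmorph0 ?rmorphD ?rmorphM //.
    exact: JD.
  exact: JM.
move=> fK gK nA I idI; have [s [sI Is]] := nA _ (pull _ _ f _ idI).
exists [seq f a | a <- s]; split=> [_ /mapP[a as_ ->]|b Ib J idJ Js]; first exact: sI.
rewrite -[b]gK; apply: (Is (g b) _ (fun a => J (f a))); rewrite ?gK //; first exact: pull.
by move=> a as_; apply: Js; apply: map_f.
Qed.

Section HilbertBasis.
Variable A : comNzRingType.
Hypothesis nA : noetherian A.

Let lead_at (I : {poly A} -> Prop) k a := exists2 f, I f & (size f <= k.+1)%N /\ f`_k = a.

Let lead_at_ideal I k : is_ideal I -> is_ideal (lead_at I k).
Proof.
move=> [I0 ID IM]; split.
- by exists 0 => //; rewrite size_poly0 coef0.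
- move=> a b [f If [fk <-]] [g Ig [gk <-]]; exists (f + g); first exact: ID.
  by rewrite coefD (leq_trans (size_polyD _ _)) // geq_max fk.
- move=> a b [f If [fk <-]]; exists (a%:P * f); first exact: IM.
  by rewrite coefCM mul_polyC (leq_trans (size_scale_leq _ _)).
Qed.

Let lead_atS I k j a : is_ideal I -> (k <= j)%N -> lead_at I k a -> lead_at I j a.
Proof.
move=> [_ _ IM] kj [f If [fk fa]]; exists ('X^(j - k) * f); first exact: IM.
rewrite coefXnM ltnNge leq_subr /= subKn //; split=> //.
by rewrite (leq_trans (size_polyMleq _ _)) // size_polyXn addSn /= (leq_trans (leq_add (leqnn _) fk)) // addnS subnK.
Qed.

(** The ideals of coefficients in degree [k] grow with [k] and are constant from some [K] on;
    generators of the first ones, lifted to polynomials, cancel every leading term. *)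
Theorem hilbert_basis : noetherian {poly A}.
Proof.
move=> I idI; pose L a := exists k, lead_at I k a.
have idL : is_ideal L.
  split; first by exists 0%N; case: (lead_at_ideal 0 idI).
  - move=> a b [k La] [j Lb]; exists (maxn k j).
    have [_ LD _] := lead_at_ideal (maxn k j) idI.
    by apply: LD; [apply: lead_atS La | apply: lead_atS Lb]; rewrite // ?leq_maxl ?leq_maxr.
  - by move=> a b [k Lb]; exists k; have [_ _ LM] := lead_at_ideal k idI; apply: LM.
have [K LK] : exists K, forall a, L a -> lead_at I K a.
  have [t [tL Lt]] := nA idL.
  have /choice[k kP] (a : A) : exists k, a \in t -> lead_at I k a.
    have [/tL[k La]|_] := boolP (a \in t); last by exists 0%N.
    by exists k.
  exists (\max_(a <- t) k a) => a La.
  apply: (Lt a La _ (lead_at_ideal _ idI)).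
  by move=> b bt; apply: lead_atS (kP b bt) => //; apply: leq_bigmax_seq.
have /choice[fs fsP] (k : nat) : exists fs : seq {poly A},
    (forall f, f \in fs -> I f /\ (size f <= k.+1)%N) /\
    (forall a, lead_at I k a -> ideal_span [seq f`_k | f : {poly A} <- fs] a).
  have [t [tL Lt]] := nA (lead_at_ideal k idI).
  have /choice[F FP] (a : A) : exists f, a \in t -> [/\ I f, (size f <= k.+1)%N & f`_k = a].
    have [/tL[f If [fk fa]]|_] := boolP (a \in t); last by exists 0.
    by exists f.
  exists [seq F a | a <- t]; split=> [_ /mapP[a at_ ->]|a La].
    by have [] := FP a at_.
  rewrite -map_comp (_ : map _ t = t); first exact: Lt.
  by rewrite -[RHS]map_id; apply/eq_in_map => b bt /=; have [] := FP b bt.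
exists (flatten [seq fs k | k <- iota 0 K.+1]); split.
  by move=> g /flattenP[_ /mapP[k _ ->] gk]; have [/(_ g gk)[]] := fsP k.
move=> f If J idJ Js; have [J0 JD JM] := idJ; have [I0 ID IM] := idI.
(* The impredicative span is applied to the ideal of coefficients in degree [k] of elements common
   to [I] and [J]. *)
have low k a : (k <= K)%N -> lead_at I k a ->
    exists2 h, I h & J h /\ (size h <= k.+1)%N /\ h`_k = a.
  move=> kK La; apply: ((fsP k).2 a La (fun a => exists2 h, I h &
    J h /\ (size h <= k.+1)%N /\ h`_k = a)); first split.
  - by exists 0 => //; rewrite size_poly0 coef0.
  - move=> b c [h Ih [Jh [hk <-]]] [h' Ih' [Jh' [hk' <-]]]; exists (h + h'); first exact: ID.
    by split; [exact: JD|rewrite coefD (leq_trans (size_polyD _ _)) // geq_max hk].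
  - move=> b c [h Ih [Jh [hk <-]]]; exists (b%:P * h); first exact: IM.
    by split; [exact: JM|rewrite coefCM mul_polyC (leq_trans (size_scale_leq _ _))].
  - move=> _ /mapP[h hs ->]; exists h; first by have [/(_ h hs)[]] := fsP k.
    split; last by split=> //; have [/(_ h hs)[]] := fsP k.
    by apply: Js; apply/flattenP; exists (fs k) => //; apply: map_f; rewrite mem_iota ltnS.
have [k] := ubnP (size f); elim: k f If => // k IH f If; rewrite ltnS => fk.
have [f0|] := eqVneq (size f) 0%N.
  by move/eqP: f0; rewrite size_poly_eq0 => /eqP ->.
rewrite -lt0n => f0; set j := (size f).-1; have jE : size f = j.+1 by rewrite prednK.
have Lf : lead_at I j f`_j by exists f => //; rewrite jE.
have [h Ih [Jh [hj hE]]] : exists2 h, I h & J h /\ (size h <= j.+1)%N /\ h`_j = f`_j.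
  have [jK|Kj] := leqP j K; first exact: low.
  have [h Ih [Jh [hK hE]]] := low K _ (leqnn K) (LK _ (ex_intro _ j Lf)).
  exists ('X^(j - K) * h); first exact: IM.
  split; first exact: JM.
  rewrite coefXnM ltnNge leq_subr /= subKn ?(ltnW Kj) //; split=> //.
  by rewrite (leq_trans (size_polyMleq _ _)) // size_polyXn addSn /= (leq_trans (leq_add (leqnn _) hK)) // addnS subnK // ltnW.
rewrite -(subrK h f); apply: (JD) => //; apply: IH; first exact: idealB.
rewrite (leq_trans _ fk) // jE ltnS; apply/leq_sizeP => i; rewrite leq_eqVlt coefB.
move=> /predU1P[<-|ji]; first by rewrite hE subrr.
by rewrite !nth_default ?subrr ?jE // (leq_trans hj).
Qed.

End HilbertBasis.

Theorem noetherian_mpoly (A : comNzRingType) n : noetherian A -> noetherian {mpoly A[n]}.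
Proof.
move=> nA; elim: n => [|n IH].
  apply: (noetherian_iso (f := @mpolyC 0 A) (g := mcoeff 0%MM)) => //.
  - exact: mpolyCK.
  - by move=> p; rewrite /= -nvar0_mpolyC.
exact: (noetherian_iso (unshearK (fun=> 0)) (shearK _) (hilbert_basis IH)).
Qed.

Definition mord_ge (A : nzRingType) n d (p : {mpoly A[n]}) :=
  forall m, (mdeg m < d)%N -> p@_m = 0.

Section Order.
Variables (A : comNzRingType) (n : nat).
Implicit Types p q : {mpoly A[n]}.

Lemma mord_geW d e p : (e <= d)%N -> mord_ge d p -> mord_ge e p.
Proof. by move=> ed pd m me; apply: pd; apply: leq_trans ed. Qed.

Lemma mord_ge0 p : mord_ge 0 p.
Proof. by []. Qed.

Lemma mord_ge_zero d : mord_ge d (0 : {mpoly A[n]}).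
Proof. by move=> m _; rewrite mcoeff0. Qed.

Lemma mord_geD d p q : mord_ge d p -> mord_ge d q -> mord_ge d (p + q).
Proof. by move=> pd qd m md; rewrite mcoeffD pd ?qd ?addr0. Qed.

Lemma mord_ge_sum d (I : Type) (s : seq I) (P : pred I) (G : I -> {mpoly A[n]}) :
  (forall i, P i -> mord_ge d (G i)) -> mord_ge d (\sum_(i <- s | P i) G i).
Proof.
move=> Gd; apply: (big_ind (mord_ge d)) => //; [exact: mord_ge_zero | exact: mord_geD].
Qed.

Lemma mord_geM d e p q : mord_ge d p -> mord_ge e q -> mord_ge (d + e) (p * q).
Proof.
move=> pd qe m md; rewrite mcoeffM big1 // => -[k1 k2] /= /eqP mE.
have [k1d|dk1] := ltnP (mdeg k1) d; first by rewrite pd ?mul0r.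
rewrite qe ?mulr0 // -(ltn_add2l d) (leq_ltn_trans _ md) //.
by rewrite [leqRHS](congr1 mdeg mE) mdegD leq_add2r.
Qed.

Lemma mord_geMl d p q : mord_ge d q -> mord_ge d (p * q).
Proof. by move=> qd; rewrite -[d]add0n; apply: mord_geM. Qed.

End Order.

Section ArtinRees.
Variables (F : fieldType) (n : nat).
Local Notation P := {mpoly F[n]}.

(* Its image is the Rees algebra of the ideal of the origin. *)
Definition rees := mmap (@polyC P) (fun i : 'I_n => ('X_i)%:P * 'X).
HB.instance Definition _ := GRing.RMorphism.copy rees rees.

Lemma reesD p q : rees (p + q) = rees p + rees q. Proof. exact: rmorphD. Qed.
Lemma reesM p q : rees (p * q) = rees p * rees q. Proof. exact: rmorphM. Qed.
Lemma rees0 : rees 0 = 0. Proof. exact: rmorph0. Qed.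
Lemma reesC p : rees p%:MP = p%:P. Proof. by rewrite /rees mmapC. Qed.
Lemma reesX i : rees 'X_i = ('X_i)%:P * 'X. Proof. by rewrite /rees mmapX mmap1U. Qed.
Opaque rees.

Lemma mord_rees f N : mord_ge N (rees f)`_N.
Proof.
move: f N; apply: mpoly_gen_ind => [c|i|p q Hp Hq|p q Hp Hq] N.
- by rewrite reesC coefC; case: N => [|N] //=; exact: mord_ge_zero.
- rewrite reesX coefCM coefX; case: eqP => [->|_]; last by rewrite mulr0; exact: mord_ge_zero.
  rewrite mulr1 => m; rewrite ltnS leqn0 mdeg_eq0 => /eqP ->.
  by rewrite mcoeffX mnm1_eq0.
- rewrite reesD coefD; exact: mord_geD (Hp N) (Hq N).
- rewrite reesM coefM; apply: mord_ge_sum => i _.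
  by rewrite -{1}(subnKC (ltn_ord i : (i <= N)%N)); exact: mord_geM (Hp i) (Hq _).
Qed.

Lemma rees_surj N p : mord_ge N p -> exists f, rees f = p%:P * 'X^N.
Proof.
move=> pN; have mon N' m : (N' <= mdeg m)%N -> exists f, rees f = ('X_[m] : P)%:P * 'X^N'.
  elim: N' m => [|N' IH] m Nm; first by exists ('X_[m])%:MP; rewrite reesC expr0 mulr1.
  have [i mi] : exists i, m i != 0%N.
    apply: contrapT => /forallNP m0; move: Nm; rewrite mdegE big1 // => i _.
    by apply/eqP; have /negP := m0 i; rewrite negbK.
  have mE : m = (m - U_(i) + U_(i))%MM by rewrite submK // lep1mP.
  have [|f fE] := IH (m - U_(i))%MM.
    by rewrite -ltnS -(addn1 (mdeg _)) -(mdeg1 i) -mdegD -mE.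
  exists (f * 'X_i); rewrite reesM reesX fE [in RHS]mE mpolyXD polyCM exprSr; ring.
have mem m : exists f, rees f = (p@_m *: 'X_[m])%:P * 'X^N.
  have [mN|Nm] := ltnP (mdeg m) N.
    by exists 0; rewrite rees0 pN // scale0r polyC0 mul0r.
  have [f fE] := mon N m Nm; exists ((p@_m)%:MP%:MP * f).
  rewrite reesM reesC fE mulrA; congr (_ * _); rewrite -mul_mpolyC; exact: (esym (polyCM _ _)).
have /choice[f fE] := mem; exists (\sum_(m <- msupp p) f m).
rewrite (rmorph_sum rees) [in RHS](mpolyE p) (rmorph_sum (@polyC P)) mulr_suml.
by apply: eq_bigr => m _; rewrite /= fE.
Qed.

Lemma sum_conv (A : comNzRingType) k (G : 'I_k -> A) (u v : nat -> A) a M :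
  (forall N, v N = \sum_i a N i * G i) ->
  \sum_(j < M.+1) u j * v (M - j)%N = \sum_i (\sum_(j < M.+1) u j * a (M - j)%N i) * G i.
Proof.
move=> vE; under eq_bigr => j _ do rewrite vE mulr_sumr.
rewrite exchange_big; apply: eq_bigr => i _ /=; rewrite mulr_suml.
by apply: eq_bigr => j _; rewrite mulrA.
Qed.

(** The elements whose images in the Rees algebra have all their coefficients in [J] form an ideal
    of a polynomial ring, finitely generated by Hilbert. The generators have images of degree below
    [c], so in degree [N] their cofactors have degree at least [N - c], hence that order. *)
Theorem artin_rees k (G : 'I_k -> P) : exists c, forall N p, mord_ge N p ->
  (exists a, p = \sum_i a i * G i) ->
  exists a, p = \sum_i a i * G i /\ forall i, mord_ge (N - c) (a i).
Proof.
pose J p := exists a, p = \sum_i a i * G i.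
have idJ : is_ideal J.
  split; first by exists (fun=> 0); rewrite big1 // => i _; rewrite mul0r.
  - move=> _ _ [a ->] [b ->]; exists (fun i => a i + b i).
    by rewrite -big_split; apply: eq_bigr => i _; rewrite mulrDl.
  - move=> c _ [a ->]; exists (fun i => c * a i).
    by rewrite mulr_sumr; apply: eq_bigr => i _; rewrite mulrA.
have [J0 JD JM] := idJ.
pose I f := forall j, J (rees f)`_j.
have idI : is_ideal I.
  split=> [j|f g If Ig j|f g Ig j]; first by rewrite rees0 coef0.
    by rewrite reesD coefD; exact: JD (If j) (Ig j).
  by rewrite reesM coefM; apply: (ideal_sum idJ) => i _; exact: JM (Ig _).
have [s [sI Is]] := @noetherian_mpoly _ n (@noetherian_mpoly _ n (@noetherian_field F)) I idI.
exists (\max_(f <- s) size (rees f)); set c := \max_(f <- s) _.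
move=> N p pN pJ; have [f fE] := rees_surj pN.
have If : I f.
  by move=> j; rewrite fE coefMXn coefC; case: ifP => // _; case: eqP.
pose K f := forall N, exists a, (rees f)`_N = \sum_i a i * G i /\
  forall i, mord_ge (N - c) (a i).
(* The elements satisfying [K] form an ideal. It contains the generators: up to degree [c] no order
   is demanded, and beyond it their coefficients vanish. *)
suff /(_ N) : K f by rewrite fE coefMXn ltnn subnn coefC.
apply: (Is f If K) => [|g gs M]; last first.
  have [Mc|cM] := leqP M c.
    have [a aE] := sI g gs M; exists a; split=> // i.
    by rewrite (eqP Mc); exact: mord_ge0.
  exists (fun=> 0); split=> [|i]; last exact: mord_ge_zero.
  rewrite big1 => [|i _]; last by rewrite mul0r.
  by rewrite nth_default // (leq_trans _ (ltnW cM)) //; apply: leq_bigmax_seq.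
split=> [M|g h Kg Kh M|g h Kh M].
- exists (fun=> 0); rewrite rees0 coef0; split=> [|i]; last exact: mord_ge_zero.
  by rewrite big1 // => i _; rewrite mul0r.
- have [a [aE ad]] := Kg M; have [b [bE bd]] := Kh M.
  exists (fun i => a i + b i); split=> [|i]; last by apply: mord_geD.
  rewrite reesD coefD; apply: etrans (congr2 +%R aE bE) _; rewrite -big_split.
  by apply: eq_bigr => i _; rewrite mulrDl.
- have /choice[a aP] := Kh.
  exists (fun i => \sum_(j < M.+1) (rees g)`_j * a (M - j)%N i); split=> [|i].
    rewrite reesM coefM.
    exact: (@sum_conv _ _ G (fun j => (rees g)`_j) (fun j => (rees h)`_j) a M (fun N => (aP N).1)).
  apply: mord_ge_sum => j _; apply: (@mord_geW _ _ (j + (M - j - c))).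
    by rewrite leq_subLR addnCA -leq_subLR -leq_subLR.
  by apply: mord_geM; [exact: mord_rees | exact: (aP _).2].
Qed.

End ArtinRees.

(** * Logarithmic derivations *)

Section FreeMatrix.
Variables (A : comNzRingType) (n : nat) (D : 'I_n -> A -> A) (h : A).
Local Notation M := (logder D h).

Definition logder_rows r (De : 'M[A]_(r, n)) := forall i, row i De \in logder_pred D h.

Lemma logder_mulmx r (De : 'M[A]_(r, n)) (c : 'rV[A]_r) :
  logder_rows De -> c *m De \in logder_pred D h.
Proof.
move=> Der; have [d0 dZ] := logder_submod D h.
rewrite mulmx_sum_row; apply: (big_ind (fun x => x \in logder_pred D h)) => // [x y xD yD|i _].
  by rewrite -[x]scale1r; apply: dZ.
by rewrite -[_ *: _]addr0; apply: dZ.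
Qed.

Lemma logder_val_sum (I : Type) (s : seq I) (a : I -> A) (x : I -> M) :
  logder_val (\sum_(i <- s) a i *: x i) = \sum_(i <- s) a i *: logder_val (x i).
Proof. exact: (big_morph (@logder_val _ _ D h)). Qed.

Lemma logder_valZ a (x : M) : logder_val (a *: x) = a *: logder_val x.
Proof. by []. Qed.

Lemma logder_val_inj : injective (@logder_val _ _ D h).
Proof. exact: val_inj. Qed.

Lemma free_module_of_basis r (De : 'M[A]_(r, n)) : logder_rows De ->
  (forall x, x \in logder_pred D h -> exists c, x = c *m De) ->
  (forall c : 'rV_r, c *m De = 0 -> c = 0) -> free_module M.
Proof.
move=> Der span indep; pose b i : M := LogDer (Der i).
exists (fun x => exists i, x = b i); split=> [x|s a us sB].
  have [c cE] := span _ (valP x).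
  exists [seq (c 0 i, b i) | i <- enum 'I_r].
    by move=> _ /mapP[i _ ->]; exists i.
  apply: logder_val_inj; rewrite logder_val_sum big_map /= big_enum /= [LHS]cE mulmx_sum_row.
  by apply: eq_bigr.
move=> sum0.
have binj : injective b.
  move=> i j /(congr1 (@logder_val _ _ D h)) /= ij; have := indep (delta_mx 0 i - delta_mx 0 j).
  rewrite mulmxBl -!rowE ij subrr => /(_ erefl)/rowP/(_ i).
  rewrite !mxE eqxx eqxx /=; case: eqP => // _ /eqP.
  by rewrite subr0 oner_eq0.
pose c := \row_i (if b i \in s then a (b i) else 0).
have /indep/rowP c0 : c *m De = 0.
  rewrite -[RHS](congr1 (@logder_val _ _ D h) sum0) logder_val_sum mulmx_sum_row.
  have sp : perm_eq s [seq b i | i <- enum 'I_r & b i \in s].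
    apply: uniq_perm => //.
      by rewrite (map_inj_uniq binj); apply: filter_uniq; apply: enum_uniq.
    move=> x; apply/idP/mapP => [xs|]; last by case=> i; rewrite mem_filter => /andP[iS _] ->.
    by have [i xE] := sB x xs; exists i; rewrite // mem_filter -xE xs mem_enum.
  rewrite (perm_big _ sp) big_map big_filter big_enum_cond [RHS]big_mkcond /=.
  apply: eq_bigr => i _; rewrite mxE; case: ifP => // _; rewrite scale0r //.
move=> x xs; have [i xE] := sB x xs; have := c0 i.
by rewrite !mxE -xE xs.
Qed.

Let span_in (S : seq M) (x : M) := exists a : M -> A, x = \sum_(s <- S) a s *: s.

Let span_inD S x y : span_in S x -> span_in S y -> span_in S (x + y).
Proof.
move=> [a ->] [b ->]; exists (fun s => a s + b s); rewrite -big_split.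
by apply: eq_bigr => s _; rewrite scalerDl.
Qed.

Let span_inZ S c x : span_in S x -> span_in S (c *: x).
Proof.
move=> [a ->]; exists (fun s => c * a s); rewrite scaler_sumr.
by apply: eq_bigr => s _; rewrite scalerA.
Qed.

Let span_in0 S : span_in S 0.
Proof. by exists (fun=> 0); rewrite big1 // => s _; rewrite scale0r. Qed.

Let span_in_mem S x : uniq S -> x \in S -> span_in S x.
Proof.
move=> uS xS; exists (fun s => (s == x)%:R).
rewrite (bigD1_seq x) //= eqxx scale1r big1 ?addr0 // => s /negPf ->.
by rewrite scale0r.
Qed.

Lemma logder_scalar_row j : h *: delta_mx 0 j \in logder_pred D h.
Proof.
apply/asboolP; exists (D j h); rewrite (bigD1 j) //= !mxE !eqxx mulr1 big1 ?addr0.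
  by rewrite mulrC.
by move=> i ij; rewrite !mxE (negPf ij) mulr0 mul0r.
Qed.

(* Comparing the traces of [U De] and [De U] shows that the basis has exactly
   [n] elements. *)
Lemma basis_of_free_module : free_module M ->
  (forall m, h *+ m = 0 -> m = 0%N) ->
  exists De U : 'M[A]_n, [/\ logder_rows De, U *m De = h%:M,
    (forall x, x \in logder_pred D h -> exists c, x = c *m De)
    & (forall c : 'rV_n, c *m De = 0 -> c = 0)].
Proof.
move=> [B [Bspan Bind]] hchar.
have h0 : h <> 0 by move=> h0; have := hchar 1%N; rewrite h0 mulr1n => /(_ erefl).
suff [k [De [U [Der UDe DeU span ind]]]] : exists k (De : 'M[A]_(k, n)) U,
    [/\ logder_rows De, U *m De = h%:M, De *m U = h%:M,
    (forall x, x \in logder_pred D h -> exists c, x = c *m De)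
    & (forall c : 'rV_k, c *m De = 0 -> c = 0)].
  have E : h *+ k = h *+ n by rewrite -!mxtrace_scalar -UDe -DeU mxtrace_mulC.
  have hle i j : h *+ i = h *+ j -> (i <= j)%N.
    move=> E'; rewrite leqNgt; apply/negP => ij; have := hchar (i - j)%N.
    rewrite mulrnBr ?(ltnW ij) // E' subrr => /(_ erefl)/eqP.
    by rewrite subn_eq0 leqNgt ij.
  have kn : k = n by apply/eqP; rewrite eqn_leq !hle.
  by subst k; exists De, U.
pose x j : M := LogDer (logder_scalar_row j).
have /choice[s sP] (j : 'I_n) : exists s : seq (A * M),
    (forall t, t \in s -> B t.2) /\ x j = \sum_(t <- s) t.1 *: t.2.
  by have [s sB xE] := Bspan (x j); exists s.
pose S := undup (flatten [seq [seq t.2 | t <- s j] | j <- enum 'I_n]).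
have uS : uniq S := undup_uniq _.
have SB b : b \in S -> B b.
  by rewrite mem_undup => /flattenP[_ /mapP[j _ ->] /mapP[t ts ->]]; apply: (sP j).1.
have spanx j : span_in S (x j).
  rewrite (sP j).2 big_seq; apply: (big_ind (span_in S) (span_in0 S) (@span_inD S)) => t ts.
  apply: span_inZ; apply: span_in_mem => //; rewrite mem_undup; apply/flattenP.
  exists [seq t.2 | t <- s j]; last exact: map_f.
  by apply: map_f; rewrite mem_enum.
(* The basis is finite: [h *: b] is a combination of the [x j], thus of [S], which for [b] outside
   [S] would be a relation with coefficient [h] on [b]. *)
have BS b : B b -> b \in S.
  move=> Bb; apply: contrapT => /negP bS; apply: h0.
  have [a aE] : span_in S (h *: b).
    have -> : h *: b = \sum_j (logder_val b) 0 j *: x j.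
      apply: logder_val_inj; rewrite logder_val_sum logder_valZ /=.
      apply/rowP => i; rewrite !mxE summxE (bigD1 i) //= !mxE !eqxx /= mulr1 mulrC.
      rewrite big1 ?addr0 // => j ji; rewrite !mxE eq_sym (negPf ji) /=.
      by rewrite !mulr0.
    by apply: (big_ind (span_in S) (span_in0 S) (@span_inD S)) => j _; apply: span_inZ.
  pose a' y := if y == b then h else - a y.
  have : \sum_(y <- b :: S) a' y *: y = 0.
    rewrite big_cons /a' eqxx aE big_seq [X in _ + X]big_seq.
    rewrite -big_split big1 //= => y yS.
    by case: eqP => [yb|_]; [rewrite yb (negPf bS) in yS | rewrite scaleNr subrr].
  move=> /(Bind (b :: S) a'); rewrite /= uS bS => /(_ isT) H.
  have := H _ b; rewrite mem_head /a' eqxx; apply=> // y; rewrite inE.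
  by move=> /predU1P[->//|/SB].
have spanM y : span_in S y.
  have [t tB ->] := Bspan y; rewrite big_seq; apply: (big_ind (span_in S) (span_in0 S) (@span_inD S)) => u ut.
  by apply: span_inZ; apply: span_in_mem => //; apply/BS/tB.
pose De : 'M[A]_(size S, n) := \matrix_(i, j) (logder_val S`_i) 0 j.
have rowDe i : row i De = logder_val S`_i by apply/rowP => j; rewrite !mxE.
have valS (a : M -> A) : logder_val (\sum_(y <- S) a y *: y) = (\row_(i < size S) a S`_i) *m De.
  rewrite logder_val_sum (big_nth 0) big_mkord mulmx_sum_row; apply: eq_bigr => i _.
  by rewrite rowDe mxE.
have Dspan y : y \in logder_pred D h -> exists c, y = c *m De.
  move=> yD; have [a aE] := spanM (LogDer yD); exists (\row_i a S`_i).
  by rewrite -valS -aE.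
have Dind (c : 'rV_(size S)) : c *m De = 0 -> c = 0.
  move=> cDe; pose a y := if insub (index y S) is Some i then c 0 i else 0.
  have aS (i : 'I_(size S)) : a S`_i = c 0 i by rewrite /a index_uniq // valK.
  have a0 : \sum_(y <- S) a y *: y = 0.
    apply: logder_val_inj; rewrite valS (_ : \row_i _ = c) ?cDe //.
    by apply/rowP => i; rewrite mxE.
  apply/rowP => i; rewrite mxE -aS; apply: (Bind S a uS SB a0).
  exact: mem_nth.
have Drows : logder_rows De by move=> i; rewrite rowDe; apply: valP.
have [u uP] := choice (fun j : 'I_n => Dspan _ (logder_scalar_row j)).

pose U : 'M[A]_(n, size S) := \matrix_(j, i) u j 0 i.
have UDe : U *m De = h%:M.
  apply/row_matrixP => j; rewrite row_mul -scalemx1 [RHS]linearZ /= [row j 1%:M]rowE mulmx1 uP; congr (_ *m _).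
  by apply/rowP => i; rewrite !mxE.
have DeU : De *m U = h%:M.
  apply/eqP; rewrite -subr_eq0; apply/eqP/row_matrixP => i; rewrite row0.
  apply: Dind; rewrite -row_mul mulmxBl -mulmxA UDe mul_mx_scalar mul_scalar_mx subrr.
  by rewrite row0.
by exists (size S), De, U.
Qed.

End FreeMatrix.

(** * Determinants of logarithmic derivations *)

Section LogderMatrices.
Variables (A : comNzRingType) (n : nat) (D : 'I_n -> A -> A) (h : A).

Definition gradient : 'cV[A]_n := \col_j D j h.

Lemma logderP (x : 'rV[A]_n) :
  x \in logder_pred D h <-> divides h ((x *m gradient) 0 0).
Proof.
have E : (x *m gradient) 0 0 = \sum_j x 0 j * D j h.
  by rewrite mxE; apply: eq_bigr => j _; rewrite mxE.
by split => [/asboolP[b bE]|[b bE]]; [|apply/asboolP]; exists b; rewrite -?E // E.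
Qed.

Lemma det_logder_gradient (De : 'M[A]_n) j :
  logder_rows D h De -> divides h (\det De * D j h).
Proof.
move=> Der; have [b bE] := choice (fun i => (logderP _).1 (Der i)).
have E : De *m gradient = h *: \col_i b i.
  apply/colP => i; have := bE i; rewrite -row_mul mxE => ->.
  by rewrite !mxE mulrC.
have : (\adj De *m (De *m gradient)) j 0 = \det De * D j h.
  by rewrite mulmxA mul_adj_mx mul_scalar_mx !mxE.
by rewrite E -scalemxAr mxE => <-; exists ((\adj De *m \col_i b i) j 0); rewrite mulrC.
Qed.

Definition replace_row (De : 'M[A]_n) i (x : 'rV[A]_n) : 'M[A]_n :=
  \matrix_(k, j) if k == i then x 0 j else De k j.

Lemma mul_adj_row (De : 'M[A]_n) i (x : 'rV[A]_n) :
  (x *m \adj De) 0 i = \det (replace_row De i x).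
Proof.
rewrite (expand_det_row _ i) mxE; apply: eq_bigr => j _; rewrite !mxE eqxx; congr (_ * (_ * \det _)).
by apply/matrixP => k l; rewrite !mxE eq_sym (negPf (neq_lift _ _)).
Qed.

Lemma logder_replace_row (De : 'M[A]_n) i x : logder_rows D h De ->
  x \in logder_pred D h -> logder_rows D h (replace_row De i x).
Proof.
move=> Der xD k; have [->|ki] := eqVneq k i.
  by rewrite (_ : row i _ = x) //; apply/rowP => j; rewrite !mxE eqxx.
by rewrite (_ : row k _ = row k De) //; apply/rowP => j; rewrite !mxE (negPf ki).
Qed.

(** With [b] for [u *m gradient], the rows of [b%:M - gradient *m u] annihilate [h], but their
    determinant vanishes as soon as [u] is nonzero over a domain. The term [h *: w *m u] keeps the
    rows logarithmic and, when [u *m w] is 1, raises the determinant to [b ^+ n * h] in size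
    [n.+1]. *)
Definition koszul_mx (u : 'rV[A]_n) (w : 'cV[A]_n) : 'M[A]_n :=
  ((u *m gradient) 0 0)%:M + (h *: w - gradient) *m u.

Lemma koszul_mx_rows u w : logder_rows D h (koszul_mx u w).
Proof.
move=> i; apply/logderP; rewrite -row_mul mxE /koszul_mx; set b := (u *m gradient) 0 0.
have ug : u *m gradient = b%:M by rewrite [LHS]mx11_scalar.
rewrite mulmxDl -mulmxA ug mul_scalar_mx mul_mx_scalar -/b scalerBr addrCA subrr addr0.
by rewrite scalerA mxE; exists (b * w i 0); ring.
Qed.

End LogderMatrices.

(** The same bordered matrix is made triangular by columns and by rows; the factor [b] on the left
    avoids inverting [b]. *)
Lemma det_scalar_rank1 (A : comNzRingType) n b (c : 'cV[A]_n) (r : 'rV[A]_n) :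
  \det (b%:M + c *m r) * b = (b + (r *m c) 0 0) * b ^+ n.
Proof.
have : r *m c = ((r *m c) 0 0)%:M by rewrite [LHS]mx11_scalar.
move: ((r *m c) 0 0) => t rc.
pose M : 'M[A]_(1 + n) := block_mx 1%:M (- r) c b%:M.
have E1 : M *m block_mx b%:M 0 (- c) 1%:M = block_mx (b + t)%:M (- r) 0 b%:M.
  rewrite mulmx_block !mul1mx !mulmx1 !mulmx0 !add0r mulNmx mulmxN opprK rc -raddfD /=.
  by rewrite mulmxN mul_mx_scalar mul_scalar_mx subrr.
have E2 : block_mx 1%:M 0 (- c) 1%:M *m M = block_mx 1%:M (- r) 0 (b%:M + c *m r).
  rewrite mulmx_block !mul1mx !mul0mx !addr0 mulmx1 addNr mulmxN mulNmx opprK.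
  by rewrite addrC.
have := congr1 determinant E1; rewrite det_mulmx det_lblock det_ublock !det_scalar expr1 expr1n mulr1.
have := congr1 determinant E2; rewrite det_mulmx det_lblock det_ublock !det1 !mul1r => ->.
by rewrite expr1.
Qed.

Lemma det_koszul_mx (A : idomainType) n (D : 'I_n.+1 -> A -> A) h u w :
  (u *m w) 0 0 = 1 -> (u *m gradient D h) 0 0 != 0 ->
  \det (koszul_mx D h u w) = (u *m gradient D h) 0 0 ^+ n * h.
Proof.
move=> uw; set b := _ 0 0 => b0; apply: (mulIf b0); rewrite det_scalar_rank1 -/b.
have subE (X Y : 'M[A]_1) : (h *: X - Y) 0 0 = h * X 0 0 - Y 0 0 by rewrite !mxE.
by rewrite mulmxBr -scalemxAr subE uw -/b exprS; ring.
Qed.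

(** * Square-free elements and derivations, for partial derivatives and for the derivative in one
    variable *)

Section SquarefreeDerivations.
Variables (A : idomainType) (J : Type) (delta : J -> A -> A).
Hypothesis facA : factorial_ring A.
Hypothesis leibniz : forall j a b, delta j (a * b) = delta j a * b + a * delta j b.

Definition square_free (g : A) := forall q r, g = q ^+ 2 * r -> q \is a GRing.unit.

Lemma square_free_cofactor g p h : square_free g -> prime_elt p -> g = h * p -> ~ divides p h.
Proof.
move=> gsf [_ pu _] gE [y hE]; case/negP: pu; apply: (gsf p y).
by rewrite gE hE; ring.
Qed.

Variable g : A.
Hypotheses (g0 : g != 0) (gsf : square_free g).
Hypothesis gdelta : forall p, prime_elt p -> divides p g -> exists j, ~ divides p (delta j p).

Lemma square_free_derivation p : prime_elt p -> divides p g ->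
  exists j, ~ divides p (delta j g).
Proof.
move=> pp pg; have [j pj] := gdelta pp pg; have [h gE] := pg.
exists j; rewrite gE leibniz => pdg; have [_ _ pP] := pp.
have : divides p (h * delta j p).
  have -> : h * delta j p = (delta j h * p + h * delta j p) - delta j h * p by ring.
  by apply: divides_sub => //; exists (delta j h).
by case/pP => //; apply: square_free_cofactor gE.
Qed.

(** For a prime factor [p] with [g = h * p], the derivative of [g] is [h * delta j p] modulo [p].
    Neither factor is divisible by [p] for a suitable [j], so [p] divides [a]. *)
Lemma square_free_divides a : (forall j, divides g (a * delta j g)) -> divides g a.
Proof.
move=> ga; have [u [s [uu sp gE]]] := facA g0.
(* The primes move from [s2] to [s1], the list of those whose product is already known to divide
   [a]. *)
suff H s2 s1 : g = u * (\prod_(p <- s1) p * \prod_(p <- s2) p) ->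
    (forall p, p \in s1 -> prime_elt p) -> (forall p, p \in s2 -> prime_elt p) ->
    divides (\prod_(p <- s1) p) a -> divides g a.
  by apply: (H s [::]) => //; rewrite big_nil ?mul1r //; exists a; rewrite mulr1.
elim: s2 s1 => [|p s2 IH] s1 gE' s1p s2p [x aE].
  rewrite gE' big_nil mulr1; exists (x / u).
  by rewrite mulrA divrK.
have pp : prime_elt p by apply: s2p; rewrite mem_head.
have [_ _ pP] := pp.
set h := u * (\prod_(q <- s1) q * \prod_(q <- s2) q).
have gh : g = h * p by rewrite gE' big_cons /h; ring.
have ph := square_free_cofactor gsf pp gh.
have pa : divides p a.
  have [|j pj] := gdelta pp; first by exists h.
  have [z zE] := ga j.
  have : divides p (h * (a * delta j p)).
    have -> : h * (a * delta j p) = a * delta j g - a * delta j h * p.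
      by rewrite gh leibniz; ring.
    apply: divides_sub; last by exists (a * delta j h).
    by rewrite zE gh; exists (z * h); rewrite mulrA.
  by case/pP => // /pP[].
have px : divides p x.
  move: pa; rewrite aE => /pP[//|ps1]; case: ph; rewrite /h mulrCA.
  by apply: divides_mulr.
have [y xE] := px.
apply: (IH (p :: s1)).
- by rewrite gE' !big_cons; ring.
- by move=> q; rewrite inE => /predU1P[->//|/s1p].
- by move=> q qs; apply: s2p; rewrite inE qs orbT.
- by rewrite aE xE big_cons; exists y; ring.
Qed.

End SquarefreeDerivations.

Section Squarefree.
Variables (F : numFieldType) (n : nat).
Local Notation P := {mpoly F[n]}.
Implicit Types (g p q : P).

Lemma divides_mderiv p j : divides p p^`M(j) -> p^`M(j) = 0.
Proof.
move=> [y E]; apply: contrapT => /eqP pj0.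
have p0 : p != 0 by apply: contraNneq pj0 => ->; rewrite mderiv0.
have y0 : y != 0 by apply: contraNneq pj0 => y0; rewrite E y0 mul0r.
have : mlead p^`M(j) \in msupp p^`M(j) by apply: mlead_supp.
rewrite mcoeff_msupp mcoeff_deriv => pm.
have : (mlead p^`M(j) + U_(j))%MM \in msupp p.
  by rewrite mcoeff_msupp; apply: contraNneq pm => ->; rewrite mul0rn.
move=> /msize_mdeg_lt; rewrite mdegD mdeg1 addn1 mlead_deg // E msizeM //.
rewrite ltnNge -subn1 leq_subRL ?addn_gt0 ?lt0n ?msize_poly_eq0 ?y0 //.
by rewrite leq_add2r lt0n msize_poly_eq0 y0.
Qed.

Lemma mderiv_eq0_const p : (forall j, p^`M(j) = 0) -> p = (p@_0)%:MP.
Proof.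
move=> dp; apply/mpolyP => m; rewrite mcoeffC.
have [->|m0] := eqVneq m 0%MM; first by rewrite mulr1.
rewrite mulr0; have [j mj] : exists j, m j != 0%N.
  apply: contrapT => /forallNP mj; case/eqP: m0; apply/mnmP => j; rewrite mnm0E.
  by apply/eqP; have /negP := mj j; rewrite negbK.
have /mpolyP/(_ (m - U_(j))%MM) := dp j.
rewrite mcoeff_deriv mcoeff0 submK ?lep1mP // => /eqP.
by rewrite mulrn_eq0 => /eqP.
Qed.

(** A partial derivative divisible by [p] vanishes by its degree, and in characteristic 0 a
    polynomial with zero gradient is constant. *)
Lemma prime_not_divides_gradient p : prime_elt p -> exists j, ~ divides p p^`M(j).
Proof.
move=> [p0 pu _]; apply: contrapT => /forallNP pd.
have pE : p = (p@_0)%:MP.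
  by apply: mderiv_eq0_const => j; apply: divides_mderiv; have /contrapT := pd j.
case/negP: pu; rewrite pE; apply: rmorph_unit; rewrite unitfE.
by apply: contraNneq p0 => c0; rewrite pE c0 mpolyC0.
Qed.

Lemma det_logder_divides g (De : 'M[P]_n) : g != 0 -> square_free g ->
  logder_rows (@mderiv n F) g De -> divides g (\det De).
Proof.
move=> g0 gsf Der; apply: (@square_free_divides _ _ (@mderiv n F)) => //.
- exact: factorial_mpoly.
- by move=> j p q; rewrite mderivM.
- by move=> p /prime_not_divides_gradient.
- by move=> j; apply: det_logder_gradient.
Qed.

End Squarefree.

(** * Gluing local bases *)

Section Patching.
Variables (F : numClosedFieldType) (n : nat).
Local Notation P := {mpoly F[n]}.

(** [I] consists of the [c] such that multiplication by [c] on the logarithmic derivations factors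
    through a free module, as [T / g] followed by [S]. Sums are obtained by stacking. At a point,
    the adjugate of [De] serves as [T]: the entries of [x *m \adj De] are determinants of
    logarithmic derivations, thus divisible by [g]. Once 1 is in [I], the matrix [S *m T / g] is
    idempotent with image the module itself. *)
Lemma free_logder_of_local (g : P) : g != 0 -> square_free g ->
  (forall a : 'I_n -> F, exists (De : 'M[P]_n) c,
    [/\ logder_rows (@mderiv n F) g De, \det De = c * g & c.@[a] != 0]) ->
  free_module (logder (@mderiv n F) g).
Proof.
move=> g0 gsf loc; pose Der x := x \in logder_pred (@mderiv n F) g.
pose I (c : P) := exists m (S : 'M[P]_(m, n)) (T : 'M[P]_(n, m)),
  [/\ logder_rows (@mderiv n F) g S, T *m S = (c * g)%:M
    & forall x, Der x -> exists y, x *m T = g *: y].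
have idI : is_ideal I.
  split.
  - exists 0%N, 0, 0; split=> [[]//||x _]; last by exists 0; rewrite mulmx0 scaler0.
    by rewrite mul0mx mul0r raddf0.
  - move=> c c' [m [S [T [SD TS TD]]]] [m' [S' [T' [SD' TS' TD']]]].
    exists (m + m')%N, (col_mx S S'), (row_mx T T'); split.
    + move=> i; rewrite (_ : row i _ = match fintype.split i with inl j => row j S | inr j => row j S' end).
        by case: (fintype.split _) => j; [exact: SD | exact: SD'].
      by apply/rowP => j; rewrite !mxE; case: (fintype.split _) => k; rewrite mxE.
    + by rewrite mul_row_col TS TS' mulrDl raddfD.
    + move=> x xD; have [y yE] := TD x xD; have [y' yE'] := TD' x xD.
      by exists (row_mx y y'); rewrite mul_mx_row yE yE' scale_row_mx.
  - move=> b c [m [S [T [SD TS TD]]]]; exists m, S, (b *: T); split=> //.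
      by rewrite -scalemxAl TS scale_scalar_mx mulrA.
    move=> x xD; have [y yE] := TD x xD; exists (b *: y).
    by rewrite -scalemxAr yE !scalerA mulrC.
have [|m [S [T [SD TS TD]]]] := weak_nullstellensatz idI.
  move=> a; have [De [c [DeD detDe ca]]] := loc a; exists c => //.
  exists n, De, (\adj De); split=> //; first by rewrite mul_adj_mx detDe.
  move=> x xD; have [y yE] := choice (fun i => det_logder_divides g0 gsf
    (logder_replace_row i DeD xD)).
  exists (\row_i y i); apply/rowP => i; rewrite mul_adj_row !mxE yE mulrC //.
rewrite mul1r in TS.
have [e eE] := choice (fun i => TD _ (SD i)).
pose E : 'M[P]_m := \matrix_(i, j) e i 0 j.
have rowE' i : row i E = e i by apply/rowP => j; rewrite !mxE.
have ST : S *m T = g *: E.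
  by apply/row_matrixP => i; rewrite row_mul eE linearZ /= rowE'.
have scaleI k l : injective (fun M : 'M[P]_(k, l) => g *: M) := scalemx_inj g0.
have EE : E *m E = E.
  apply: (scaleI _ _); apply: (scaleI _ _).
  rewrite scalemxAr scalemxAl -ST mulmxA -[S *m T *m S]mulmxA TS mul_mx_scalar.
  by rewrite -scalemxAl ST.
have [r [U [V [UV VU]]]] := quillen_suslin EE.
have Dspan x : Der x -> exists c, x = c *m (U *m S).
  move=> xD; have [y yE] := TD x xD; exists (y *m V).
  have xyS : x = y *m S.
    apply: (scaleI _ _); rewrite /= scalemxAl -yE -mulmxA TS mul_mx_scalar //.
  have yEy : y *m E = y.
    apply: (scaleI _ _); rewrite /= -[in RHS]yE xyS -mulmxA ST -scalemxAr //.
  by rewrite mulmxA -[y *m V *m U]mulmxA VU yEy.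
apply: (free_module_of_basis (De := U *m S)) => // [i|c cUS].
  by rewrite row_mul; apply: logder_mulmx.
have : g *: (c *m U) = 0.
  have <- : c *m U *m (g *: E) = g *: (c *m U).
    by rewrite -scalemxAr -VU -mulmxA (mulmxA U) UV mul1mx.
  by rewrite -ST !mulmxA -[c *m U *m S]mulmxA cUS mul0mx.
move=> /eqP; rewrite scalemx_eq0 (negPf g0) /= => /eqP cU.
by rewrite -[c]mulmx1 -UV mulmxA cU mul0mx.
Qed.

End Patching.

(** * Orders of vanishing *)

Section Graded.
Variables (A S : comNzRingType) (f : {rmorphism A -> S}) (n : nat) (v : 'I_n -> S).

(** The restriction to the line [X_i = v_i t], the homogeneous parts being separated by the powers
    of [t]; [f] lets the direction [v] have its coordinates in a larger ring. *)
Definition graded : {mpoly A[n]} -> {poly S} :=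
  mmap (polyC \o f) (fun i => (v i)%:P * 'X).

Lemma gradedD p q : graded (p + q) = graded p + graded q.
Proof. exact: (rmorphD (mmap _ _)). Qed.

Lemma gradedB p q : graded (p - q) = graded p - graded q.
Proof. exact: (rmorphB (mmap _ _)). Qed.

Lemma gradedM p q : graded (p * q) = graded p * graded q.
Proof. exact: (rmorphM (mmap _ _)). Qed.

Lemma graded_monom c m :
  graded (c *: 'X_[m]) = (f c * \prod_i v i ^+ m i)%:P * 'X^(mdeg m).
Proof.
rewrite /graded mmapZ mmapX /mmap1 /= polyCM -mulrA; congr (_ * _).
rewrite mdegE expr_sum rmorph_prod -big_split /=; apply: eq_bigr => i _.
by rewrite exprMn -rmorphXn.
Qed.

Lemma graded_expand p : graded p =
  \sum_(m <- msupp p) (f p@_m * \prod_i v i ^+ m i)%:P * 'X^(mdeg m).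
Proof.
rewrite {1}(mpolyE p) -[LHS]/(mmap _ _ _) (raddf_sum (mmap _ _)) /=.
by apply: eq_bigr => m _; apply: graded_monom.
Qed.

Lemma coef_graded p k : (graded p)`_k =
  \sum_(m <- msupp p | mdeg m == k) f p@_m * \prod_i v i ^+ m i.
Proof.
rewrite graded_expand coef_sum [RHS]big_mkcond; apply: eq_bigr => m _.
by rewrite coefCM coefXn eq_sym; case: eqP; rewrite ?mulr1 ?mulr0.
Qed.

Lemma horner_graded p t : (graded p).[t] = mmap f (fun i => v i * t) p.
Proof.
rewrite graded_expand horner_sum; apply: eq_bigr => m _.
rewrite hornerM hornerC hornerXn -mulrA; congr (_ * _).
rewrite /mmap1 mdegE expr_sum -big_split /=; apply: eq_bigr => i _.
by rewrite exprMn.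
Qed.

Lemma coef_graded_mord d p : mord_ge d p -> forall k, (k < d)%N -> (graded p)`_k = 0.
Proof.
move=> pd k kd; rewrite coef_graded big1 // => m /eqP mk.
by rewrite pd ?mk // rmorph0 mul0r.
Qed.

End Graded.

Lemma coef_graded_id (A : comNzRingType) n (v : 'I_n -> A) p k :
  (graded idfun v p)`_k = (pihomog mdeg k p).@[v].
Proof.
rewrite coef_graded pihomogE raddf_sum /=; apply: eq_bigr => m _.
by rewrite mevalZ mevalX.
Qed.

Lemma mord_ge_pihomog (A : nzRingType) n d (p : {mpoly A[n]}) :
  (forall k, (k < d)%N -> pihomog mdeg k p = 0) -> mord_ge d p.
Proof.
move=> pd m md; have := mcoeff_pihomog (mdeg m) p m.
by rewrite eqxx pd // mcoeff0.
Qed.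

Lemma mord_ge_of_values (F : numDomainType) n d (p : {mpoly F[n]}) :
  (forall v k, (k < d)%N -> (graded idfun v p)`_k = 0) -> mord_ge d p.
Proof.
move=> pd; apply: mord_ge_pihomog => k kd; apply/eqP; apply: contraT.
by move=> /mpoly_nonzero_pt[v]; rewrite -coef_graded_id pd ?eqxx.
Qed.

Lemma low_coefM (S : idomainType) (p q : {poly S}) i j :
  (forall k, (k < i)%N -> p`_k = 0) -> (forall k, (k < j)%N -> q`_k = 0) ->
  (p * q)`_(i + j) = p`_i * q`_j /\ forall k, (k < i + j)%N -> (p * q)`_k = 0.
Proof.
move=> pi qj; split=> [|k kij]; rewrite coefM.
- have iP : (i < (i + j).+1)%N by rewrite ltnS leq_addr.
  rewrite (bigD1 (Ordinal iP)) //= addKn big1 ?addr0 // => -[l lP] /eqP/val_eqP /= li.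
  have [lti|] := ltnP l i; first by rewrite pi ?mul0r.
  rewrite leq_eqVlt eq_sym (negPf li) /= => il; rewrite qj ?mulr0 //.
  by rewrite ltn_subLR // ltn_add2r.
- rewrite big1 // => -[l lP] _ /=.
  have [lti|il] := ltnP l i; first by rewrite pi ?mul0r.
  by rewrite qj ?mulr0 // ltn_subLR // (leq_trans kij) // leq_add2r.
Qed.

Lemma low_coef_exists (S : nzRingType) (p : {poly S}) : p != 0 ->
  exists i, p`_i != 0 /\ forall k, (k < i)%N -> p`_k = 0.
Proof.
move=> p0; have ex : exists k, p`_k != 0.
  by exists (size p).-1; rewrite -lead_coefE lead_coef_eq0.
case: (ex_minnP ex) => i pi imin; exists i; split=> // l li.
by apply/eqP; apply: contraTT li => /imin; rewrite -leqNgt.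
Qed.

Lemma mord_exists (A : nzRingType) n (p : {mpoly A[n]}) : p != 0 ->
  exists e, mord_ge e p /\ pihomog mdeg e p != 0.
Proof.
move=> p0; have ex : exists k, pihomog mdeg k p != 0.
  exists (mdeg (mlead p)); apply/eqP => /mpolyP/(_ (mlead p)).
  by rewrite mcoeff_pihomog eqxx mcoeff0 => /eqP; rewrite mleadc_eq0 (negPf p0).
case: (ex_minnP ex) => e pe emin; exists e; split=> //.
apply: mord_ge_pihomog => k ke; apply/eqP.
by apply: contraTT ke => /emin; rewrite -leqNgt.
Qed.

(** Orders add up, since the product of two initial forms is nonzero over a domain. *)
Lemma mord_ge_mul_cancel (F : numDomainType) n N e (g p : {mpoly F[n]}) :
  mord_ge e g -> pihomog mdeg e g != 0 -> mord_ge N (p * g) -> mord_ge (N - e) p.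
Proof.
move=> ge ge0 pgN; have [->|p0] := eqVneq p 0; first exact: mord_ge_zero.
have [k [pk pk0]] := mord_exists p0.
apply: (mord_geW _ pk); rewrite leqNgt; apply/negP => kN.
have [v] := mpoly_nonzero_pt (mulf_neq0 pk0 ge0); rewrite mevalM => /negP[].
rewrite -!coef_graded_id.
have [<- _] := low_coefM (coef_graded_mord idfun v pk) (coef_graded_mord idfun v ge).
by rewrite -gradedM (coef_graded_mord _ _ pgN) // addnC -ltn_subRL.
Qed.

(** * The order of vanishing of an analytic function *)

Section VanishingOrder.
Local Open Scope classical_set_scope.
Variables (R : realType) (n : nat).
Local Notation C := (Cplx R).
Local Notation F := ('rV[C]_n -> C).
Implicit Types (f g : F) (p : {mpoly C[n]}) (c : 'X_{1..n} -> C).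

(** Stated as a growth condition, the order depends on the germ alone and not on a chosen series,
    and sums and products are immediate. *)
Definition vanish_order d f := exists2 K : C, 0 <= K &
  \forall z \near (0 : 'rV[C]_n), `|f z| <= K * `|z| ^+ d.

Lemma vanish_order_near d f g :
  (\forall z \near (0 : 'rV[C]_n), f z = g z) -> vanish_order d f -> vanish_order d g.
Proof.
by move=> fg [K K0 fK]; exists K => //; near=> z; rewrite -(near fg z) //; near: z.
Unshelve. all: by end_near. Qed.

Lemma vanish_orderD d f g : vanish_order d f -> vanish_order d g -> vanish_order d (f + g).
Proof.
move=> [K K0 fK] [L L0 gL]; exists (K + L); first exact: addr_ge0.
near=> z; rewrite mulrDl (le_trans (ler_normD _ _)) // lerD //; by near: z.
Unshelve. all: by end_near. Qed.

Lemma vanish_orderN d f : vanish_order d f -> vanish_order d (- f).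
Proof.
move=> [K K0 fK]; exists K => //; near=> z.
by rewrite (_ : (- f) z = - f z) // normrN; near: z.
Unshelve. all: by end_near. Qed.

Lemma vanish_orderW d e f : (e <= d)%N -> vanish_order d f -> vanish_order e f.
Proof.
move=> ed [K K0 fK]; exists K => //.
have n1 := nbhs0_le (V := 'rV[C]_n) (ltr01 : 0 < 1 :> C); near=> z.
have z1 : `|z| <= 1 by near: z.
apply: (@le_trans _ _ (K * `|z| ^+ d)); first by near: z.
by rewrite ler_wpM2l // ler_wiXn2l.
Unshelve. all: by end_near. Qed.

Lemma vanish_orderM d e f g : vanish_order d f -> vanish_order e g ->
  vanish_order (d + e) (f * g).
Proof.
move=> [K K0 fK] [L L0 gL]; exists (K * L); first exact: mulr_ge0.
near=> z; rewrite exprD mulrACA normrM ler_pM //; by near: z.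
Unshelve. all: by end_near. Qed.

(** A term of degree at least [d] is at most [(|z| / (r / 2)) ^ d] times its absolute value on the
    polyradius [r / 2], where the series converges absolutely. *)
Lemma vanish_order_psum c r f d : has_pseries c r f ->
  vanish_order d (f - (fun z => (ptrunc c d).@[z 0])).
Proof.
move=> [r0 [M cM] cf]; have M0 : 0 <= M.
  by apply: le_trans (cM 0%MM); rewrite mulr_ge0 // exprn_ge0 // ltW.
have r20 : 0 < r / 2 by rewrite divr_gt0.
exists ((r / 2)^-1 ^+ d * (M * 2 ^+ n)).
  by rewrite mulr_ge0 ?exprn_ge0 ?invr_ge0 ?(ltW r20) // mulr_ge0 ?exprn_ge0.
have nr2 := nbhs0_le (V := 'rV[C]_n) r20; near=> z.
have zr2 : `|z| <= r / 2 by near: z.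
have zr : `|z| < r.
  by rewrite (le_lt_trans zr2) // ltr_pdivrMr // ltr_pMr // ltr1n.
rewrite (_ : (f - _) z = f z - (ptrunc c d).@[z 0]) // meval_ptrunc.
apply: (@cvg_norm_le _ (fun e => psum c (e + d) z - psum c d z)).
- rewrite mulr_ge0 ?exprn_ge0 // mulr_ge0 ?exprn_ge0 ?invr_ge0 ?(ltW r20) //.
  by rewrite mulr_ge0 ?exprn_ge0.
- by apply: cvgB; [rewrite (cvg_shiftn d (fun e => psum c e z)); exact: cf | exact: cvg_cst].
- move=> e; rewrite /psum (sum_trunc (fun m => c m * \prod_i z 0 i ^+ m i) (leq_addl e d)).
  rewrite addrAC subrr add0r (le_trans (ler_norm_sum _ _ _)) //.
  apply: (@le_trans _ _ (\sum_(m : 'X_{1..n < e + d}) `|z| ^+ d * (r / 2)^-1 ^+ d *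
      (`|c m| * (r / 2) ^+ mdeg m))); last first.
    rewrite -mulr_sumr [leRHS]mulrAC [X in _ <= X * _]mulrC ler_wpM2l ?sum_coef_half //.
    by rewrite mulr_ge0 ?exprn_ge0 ?invr_ge0 ?(ltW r20).
  rewrite [leRHS](bigID (fun m : 'X_{1..n < e + d} => (d <= mdeg m)%N)) /=.
  rewrite -[leLHS]addr0 lerD //; last first.
    apply: sumr_ge0 => m _; rewrite mulr_ge0 // mulr_ge0 ?exprn_ge0 ?invr_ge0 ?(ltW r20) //.
  apply: ler_sum => m dm; rewrite normrM [leRHS]mulrCA ler_wpM2l //.
  apply: le_trans (norm_monom _ (norm_entry z)) _.
  rewrite -{1 2}(subnKC dm) !exprD -mulrA ler_wpM2l ?exprn_ge0 // mulrA -exprMn mulVf ?gt_eqF //.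
  by rewrite expr1n mul1r lerXn2r // nnegrE ?(ltW r20).
Unshelve. all: by end_near. Qed.

Lemma vanish_order_poly d p : mord_ge d p -> vanish_order d (fun z => p.@[z 0]).
Proof.
move=> pd; exists (\sum_(m <- msupp p) `|p@_m|); first exact: sumr_ge0.
have n1 := nbhs0_le (V := 'rV[C]_n) (ltr01 : 0 < 1 :> C).
near=> z; have z1 : `|z| <= 1 by near: z.
rewrite mevalE (le_trans (ler_norm_sum _ _ _)) // mulr_suml big_seq [leRHS]big_seq.
apply: ler_sum => m mp; rewrite normrM ler_wpM2l // (le_trans (norm_monom _ (norm_entry z))) //.
rewrite ler_wiXn2l // leqNgt; apply/negP => /pd p0.
by move: mp; rewrite mcoeff_msupp p0 eqxx.
Unshelve. all: by end_near. Qed.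

(** A nonzero constant term would be at most [(K + L) * t] for all small [t]; once it is zero, [t]
    is divided out. *)
Lemma poly_small_coef0 (P : {poly C}) (K r : C) d : 0 <= K -> 0 < r ->
  (forall t, 0 < t -> t < r -> `|P.[t]| <= K * t ^+ d) ->
  forall i, (i < d)%N -> P`_i = 0.
Proof.
move=> K0 r0; elim: d P => // d IH P PK.
pose Q := \poly_(i < (size P).-1) P`_i.+1.
have PE : P = Q * 'X + (P`_0)%:P.
  apply/polyP => -[|i]; rewrite coefD coefMX coefC /= ?add0r ?addr0 //.
  rewrite coef_poly; case: ltnP => // Pi; rewrite nth_default //.
  by move: Pi; case: (size P).
pose L := \sum_(i < size Q) `|Q`_i|.
have QL t : 0 <= t -> t <= 1 -> `|Q.[t]| <= L.
  move=> t0 t1; rewrite horner_coef (le_trans (ler_norm_sum _ _ _)) //.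
  apply: ler_sum => i _; rewrite normrM ler_piMr // normrX exprn_ile1 //.
  by rewrite ger0_norm.
have L0 : 0 <= L by apply: sumr_ge0.
have P00 : P`_0 = 0.
  apply/eqP; apply: contraT => p0; set a := `|P`_0|.
  have a0 : 0 < a by rewrite normr_gt0.
  have S1 : 1 <= K + L + 1 by rewrite lerDr addr_ge0.
  set S := K + L + 1 in S1; have S0 : 0 < S by apply: lt_le_trans S1.
  have a1 : 1 <= 1 + a by rewrite lerDl ltW.
  have r1 : 1 <= 1 + r by rewrite lerDl ltW.
  have a10 : 0 < 1 + a by apply: lt_le_trans a1.
  have r10 : 0 < 1 + r by apply: lt_le_trans r1.
  have aB : a < S * (1 + a).
    by apply: (@lt_le_trans _ _ (1 + a)); rewrite ?ltrDr // ler_peMl // ltW.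
  have B0 := lt_trans a0 aB; set B := S * (1 + a) in aB B0.
  have D0 : 0 < (1 + r) * B by rewrite mulr_gt0.
  (* One point below [r], 1 and [a / (K + L)], written without a minimum as the order of [C] is only
     partial. *)
  pose t := r * a / ((1 + r) * B).
  have t0 : 0 < t by rewrite divr_gt0 // mulr_gt0.
  have tr : t < r.
    by rewrite ltr_pdivrMr // ltr_pM2l // (lt_le_trans aB) // ler_peMl // ltW.
  have t1 : t < 1.
    by rewrite ltr_pdivrMr // mul1r ltr_pM ?(ltW r0) ?(ltW a0) // ltrDr.
  have ta : (K + L) * t < a.
    have rD : t * S < a.
      rewrite /t mulrAC ltr_pdivrMr // /B.
      have -> : a * ((1 + r) * (S * (1 + a))) = (1 + r) * (1 + a) * a * S by ring.
      rewrite !ltr_pM2r //; apply: (@lt_le_trans _ _ (1 + r)); first by rewrite ltrDr.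
      by rewrite ler_peMr // ltW.
    by apply: le_lt_trans rD; rewrite /S [leLHS]mulrC ler_pM2l // lerDl.
  move: t t0 tr t1 ta => t t0 tr t1 ta; have : a <= (K + L) * t.
    have E : P.[t] = Q.[t] * t + P`_0 by rewrite {1}PE hornerD hornerMX hornerC.
    have -> : a = `|P.[t] - Q.[t] * t| by rewrite E addrC addKr.
    rewrite mulrDl (le_trans (ler_normB _ _)) // lerD //.
      rewrite (le_trans (PK t t0 tr)) // exprS mulrA ler_piMr ?mulr_ge0 ?(ltW t0) //.
      by rewrite exprn_ile1 // ltW.
    by rewrite normrM (gtr0_norm t0) ler_wpM2r ?(ltW t0) // QL ?ltW.
  by move=> /le_lt_trans/(_ ta); rewrite ltxx.
move=> [|i] //; rewrite ltnS => id; rewrite PE coefD coefMX coefC addr0 /=.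
apply: IH => // t t0 tr; have := PK t t0 tr.
rewrite {1}PE P00 addr0 hornerMX normrM (gtr0_norm t0) exprSr mulrA.
by rewrite ler_pM2r.
Qed.

Lemma mord_ge_vanish_order d p : vanish_order d (fun z => p.@[z 0]) -> mord_ge d p.
Proof.
move=> [K K0 /nbhs_norm0P[r /= r0 pK]]; apply: mord_ge_of_values => v k kd.
pose w : 'rV[C]_n := \row_i v i.
have w1 : 0 < 1 + `|w| by rewrite ltr_wpDr.
apply: (@poly_small_coef0 _ (K * `|w| ^+ d) (r / (1 + `|w|)) d) kd.
- by rewrite mulr_ge0 // exprn_ge0.
- by rewrite divr_gt0.
move=> t t0 tr; rewrite horner_graded.
have -> : mmap idfun (fun i => v i * t) p = p.@[(t *: w) 0].
  by apply: meval_eq => i; rewrite !mxE mulrC.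
have tw : `|t *: w| = t * `|w| by rewrite normrZ gtr0_norm.
have := pK (t *: w); rewrite tw exprMn [t ^+ d * _]mulrC mulrA; apply => /=.
rewrite tw; move: tr; rewrite ltr_pdivlMr // => /(le_lt_trans _); apply.
by rewrite ler_pM2l // lerDr.
Qed.

Lemma has_pseries_poly p : has_pseries (fun m => p@_m) 1 (fun z => p.@[z 0]).
Proof.
split => [||z _]; first exact: ltr01.
- exists (\sum_(m <- msupp p) `|p@_m|) => m; rewrite expr1n mulr1.
  have [mp|/memN_msupp_eq0->] := boolP (m \in msupp p).
    by rewrite (big_rem _ mp) /= lerDl sumr_ge0.
  by rewrite normr0 sumr_ge0.
- apply: cvg_near_cst; exists (msize p) => // d /= pd.
  by rewrite psum_poly.
Qed.

Lemma derive_poly p j z : `|z| < 1 / 2 / 4 ->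
  'D_(delta_mx 0 j) (fun z : 'rV[C]_n => p.@[z 0]) z = (p^`M(j)).@[z 0].
Proof.
move=> z1; have H := deriv_pseries (j := j) (has_pseries_poly p) z1.
apply: (@cvg_unique _ (@norm_hausdorff _ _) _ _ _ _ H).
apply: cvg_near_cst; exists (msize p^`M(j)) => // d /= pd; rewrite -(psum_poly z pd).
by apply: eq_bigr => m _; rewrite /dcoef mcoeff_deriv.
Qed.

Lemma analytic_of_bound c (r M : C) : 0 < r -> (forall m, `|c m| * r ^+ mdeg m <= M) ->
  exists f : F, has_pseries c (r / 4) f.
Proof.
move=> r0 cM; exists (fun z => lim (psum c d z @[d --> \oo])).
have M0 : 0 <= M by apply: le_trans (cM 0%MM); rewrite mulr_ge0 // exprn_ge0 // ltW.
have r4 : 0 < r / 4 by rewrite divr_gt0.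
split=> // [|z zr].
- exists M => m; apply: le_trans (cM m); rewrite ler_wpM2l // lerXn2r ?nnegrE ?(ltW r0) ?(ltW r4) //.
  by rewrite ler_pdivrMr // ler_peMr ?(ltW r0) // ler1n.
- have : cvg (psum c d z @[d --> \oo]).
    apply: (@cauchy_half _ _ (M * 2 ^+ n)) => [|d e de]; first by rewrite mulr_ge0 ?exprn_ge0.
    by apply: (psum_tail r0 cM _ de) => i; apply: le_trans (norm_entry z i) (ltW zr).
  by [].
Qed.

End VanishingOrder.

Section GermOrder.
Local Open Scope classical_set_scope.
Variables (R : realType) (n : nat).
Local Notation C := (Cplx R).
Implicit Types (x y : germ R n) (p q : {mpoly C[n]}) (c : 'X_{1..n} -> C).

Definition germ_ord d x := vanish_order d (repr x : afun R n).

Lemma germ_ordE d (f : afun R n) : germ_ord d (to_germ f) <-> vanish_order d f.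
Proof.
have : to_germ (repr (to_germ f)) = to_germ f by exact: reprK.
move=> /eq_to_germ fE; split; apply: vanish_order_near => //.
by apply: filterS fE => z ->.
Qed.

Lemma to_germD (f g : afun R n) : to_germ (f + g) = to_germ f + to_germ g.
Proof. exact: rmorphD. Qed.

Lemma to_germN (f : afun R n) : to_germ (- f) = - to_germ f.
Proof. exact: rmorphN. Qed.

Lemma to_germM (f g : afun R n) : to_germ (f * g) = to_germ f * to_germ g.
Proof. exact: rmorphM. Qed.

Lemma germP x : exists f, x = to_germ f.
Proof. by exists (repr x); rewrite /to_germ reprK. Qed.

Definition poly_afun p : afun R n := AFun (introT (asboolP _) (analytic_poly p)).
Definition poly_germ p : germ R n := to_germ (poly_afun p).

Lemma to_germ_ext (f g : afun R n) : (forall z, f z = g z) -> to_germ f = to_germ g.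
Proof.
move=> fg; apply/eq_to_germ; near=> z; exact: fg.
Unshelve. all: by end_near. Qed.

Fact poly_germ_zmod : zmod_morphism poly_germ.
Proof.
move=> p q; rewrite /poly_germ -to_germN -to_germD; apply: to_germ_ext => z.
by rewrite /= mevalB.
Qed.
Fact poly_germ_monoid : monoid_morphism poly_germ.
Proof.
split=> [|p q].
  rewrite /poly_germ -(rmorph1 (\pi_(germ R n)%qT)).
  by apply: to_germ_ext => z; rewrite /= meval1.
rewrite /poly_germ -to_germM; apply: to_germ_ext => z.
by rewrite /= mevalM.
Qed.
HB.instance Definition _ := GRing.isZmodMorphism.Build _ _ poly_germ poly_germ_zmod.
HB.instance Definition _ := GRing.isMonoidMorphism.Build _ _ poly_germ poly_germ_monoid.

Lemma germ_ordD d x y : germ_ord d x -> germ_ord d y -> germ_ord d (x + y).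
Proof.
have [f ->] := germP x; have [g ->] := germP y; rewrite -to_germD.
by move=> /germ_ordE fd /germ_ordE gd; apply/germ_ordE; apply: vanish_orderD.
Qed.

Lemma germ_ordN d x : germ_ord d x -> germ_ord d (- x).
Proof.
have [f ->] := germP x; rewrite -to_germN.
by move=> /germ_ordE fd; apply/germ_ordE; apply: vanish_orderN.
Qed.

Lemma germ_ordW d e x : (e <= d)%N -> germ_ord d x -> germ_ord e x.
Proof. exact: vanish_orderW. Qed.

Lemma germ_ordM d e x y : germ_ord d x -> germ_ord e y -> germ_ord (d + e) (x * y).
Proof.
have [f ->] := germP x; have [g ->] := germP y; rewrite -to_germM.
by move=> /germ_ordE fd /germ_ordE gd; apply/germ_ordE; apply: vanish_orderM.
Qed.

Lemma germ_ord_poly d p : germ_ord d (poly_germ p) <-> mord_ge d p.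
Proof.
split=> [/germ_ordE|pd]; first exact: mord_ge_vanish_order.
by apply/germ_ordE; apply: vanish_order_poly.
Qed.

Lemma germ_series x : exists c r M, [/\ 0 < r, forall m, `|c m| * r ^+ mdeg m <= M
  & forall d, germ_ord d (x - poly_germ (ptrunc c d))].
Proof.
have [f ->] := germP x; have [c [r cf]] := afunP f; have [r0 [M cM] _] := cf.
exists c, r, M; split=> // d; rewrite -to_germN -to_germD; apply/germ_ordE.
exact: vanish_order_psum cf.
Qed.

Lemma germ_of_series c (r M : C) : 0 < r -> (forall m, `|c m| * r ^+ mdeg m <= M) ->
  exists x, forall d, germ_ord d (x - poly_germ (ptrunc c d)).
Proof.
move=> r0 cM; have [f cf] := analytic_of_bound r0 cM.
have fan : analytic0 f by exists c, (r / 4).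
exists (to_germ (AFun (introT (asboolP _) fan))) => d.
rewrite -to_germN -to_germD; apply/germ_ordE.
exact: vanish_order_psum cf.
Qed.

(** All the truncations of the series vanish to their full order, so its coefficients are zero, and
    so is its sum on the polydisc of convergence. *)
Lemma germ_ord_eq0 x : (forall d, germ_ord d x) -> x = 0.
Proof.
move=> xd; have [f xE] := germP x; have [c [r cf]] := afunP f.
have c0 m : c m = 0.
  have : mord_ge (mdeg m).+1 (ptrunc c (mdeg m).+1).
    apply: mord_ge_vanish_order; move: (xd (mdeg m).+1); rewrite xE => /germ_ordE fd.
    have := vanish_orderD fd (vanish_orderN (vanish_order_psum (mdeg m).+1 cf)).
    by apply: vanish_order_near; near=> z; rewrite /= !fctE opprB addrC subrK.
  by move=> /(_ m (leqnn _)); rewrite mcoeff_ptrunc ltnSn.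
rewrite xE -[0](rmorph0 (\pi_(germ R n)%qT)); apply/eq_to_germ.
have [r0 _ cvgf] := cf; have nr := nbhs0_lt (V := 'rV[C]_n) r0; near=> z.
have zr : `|z| < r by near: z.
apply: (@cvg_unique _ (@norm_hausdorff _ _) _ _ _ _ (cvgf z zr)).
rewrite (_ : (fun d => psum c d z) = fun=> 0); first exact: cvg_cst.
by apply/funext => d; rewrite /psum big1 // => m _; rewrite c0 mul0r.
Unshelve. all: by end_near. Qed.

Lemma germ_deriv_poly j p : germ_deriv j (poly_germ p) = poly_germ p^`M(j).
Proof.
have r0 : 0 < 1 / 2 / 4 :> C by rewrite !divr_gt0.
rewrite germ_derivE; apply/eq_to_germ; have nr := nbhs0_lt (V := 'rV[C]_n) r0.
by near=> z; rewrite /= derive_poly //; near: z.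
Unshelve. all: by end_near. Qed.

End GermOrder.

(** * Logarithmic derivations of germs *)

Section GermApproximation.
Variables (R : realType) (n : nat).
Local Notation C := (Cplx R).
Local Notation P := {mpoly C[n]}.
Implicit Types (x y : germ R n) (p q g : P).

Lemma poly_approx x N : exists p : P, germ_ord N (x - poly_germ p).
Proof. by have [c [r [M [_ _ xc]]]] := germ_series x; exists (ptrunc c N). Qed.

Lemma germ_ord0 x : germ_ord 0 x.
Proof.
have [p xp] := poly_approx x 0; rewrite -[x](subrK (poly_germ p)).
by apply: germ_ordD xp _; apply/germ_ord_poly.
Qed.

Definition germ_eqmod N x y := germ_ord N (x - y).

Lemma germ_eqmod_refl N x : germ_eqmod N x x.
Proof.
rewrite /germ_eqmod subrr -(rmorph0 (@poly_germ R n)); apply/germ_ord_poly.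
exact: mord_ge_zero.
Qed.

Lemma germ_eqmod_sym N x y : germ_eqmod N x y -> germ_eqmod N y x.
Proof. by rewrite /germ_eqmod => /germ_ordN; rewrite opprB. Qed.

Lemma germ_eqmod_trans N y x z : germ_eqmod N x y -> germ_eqmod N y z -> germ_eqmod N x z.
Proof. by rewrite /germ_eqmod => xy yz; rewrite -(subrK y x) -addrA; apply: germ_ordD. Qed.

Lemma germ_eqmodD N x y x' y' :
  germ_eqmod N x x' -> germ_eqmod N y y' -> germ_eqmod N (x + y) (x' + y').
Proof.
by rewrite /germ_eqmod => xx yy; rewrite opprD addrACA; apply: germ_ordD.
Qed.

Lemma germ_eqmodM N x y x' y' :
  germ_eqmod N x x' -> germ_eqmod N y y' -> germ_eqmod N (x * y) (x' * y').
Proof.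
rewrite /germ_eqmod => xx yy.
have -> : x * y - x' * y' = (x - x') * y + x' * (y - y').
  by rewrite mulrBl mulrBr addrA subrK.
apply: germ_ordD; first by rewrite -[N]addn0; apply: germ_ordM (germ_ord0 _).
by rewrite -[N]add0n; apply: germ_ordM (germ_ord0 _) _.
Qed.

Lemma det_germ_eqmod N k (X Y : 'M[germ R n]_k) :
  (forall i j, germ_eqmod N (X i j) (Y i j)) -> germ_eqmod N (\det X) (\det Y).
Proof.
move=> XY; apply: (big_ind2 (germ_eqmod N)) => [|x x' y y' xx yy|s _].
- exact: germ_eqmod_refl.
- exact: germ_eqmodD.
apply: germ_eqmodM; first exact: germ_eqmod_refl.
apply: (big_ind2 (germ_eqmod N)) => // [|x x' y y' xx yy].
- exact: germ_eqmod_refl.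
- exact: germ_eqmodM.
Qed.

Lemma poly_germ_det k (X : 'M[P]_k) : \det (map_mx (@poly_germ R n) X) = poly_germ (\det X).
Proof. exact: det_map_mx. Qed.

Lemma germ_eqmod_poly N p q : germ_eqmod N (poly_germ p) (poly_germ q) <-> mord_ge N (p - q).
Proof. by rewrite /germ_eqmod -rmorphB; apply: germ_ord_poly. Qed.

(** Truncating the coefficients and the cofactor of [a] leaves an error of order [N + c] in the
    ideal of the partial derivatives and [g]. By Artin-Rees it is a combination of them with
    coefficients of order [N], which are subtracted from the truncations. *)
Lemma logder_approx g (a : 'rV[germ R n]_n) N :
  a \in logder_pred (@germ_deriv R n) (poly_germ g) ->
  exists2 a' : 'rV[P]_n, a' \in logder_pred (@mderiv n C) g
    & forall j, germ_eqmod N (a 0 j) (poly_germ (a' 0 j)).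
Proof.
move=> /asboolP[b ab].
pose G (i : 'I_n.+1) : P := if unlift ord_max i is Some j then g^`M(j) else - g.
have [c AR] := artin_rees G.
have [p pP] := choice (fun j => poly_approx (a 0 j) (N + c)).
have [q qP] := poly_approx b (N + c).
have GE (x : 'I_n.+1 -> P) :
    \sum_i x i * G i = \sum_j x (lift ord_max j) * g^`M(j) - x ord_max * g.
  rewrite big_ord_recr /= {2}/G unlift_none mulrN; congr (_ - _).
  apply: eq_bigr => j _; rewrite /G.
  have -> : widen_ord (leqnSn n) j = lift ord_max j.
    by apply: val_inj; rewrite /= /bump leqNgt ltn_ord.
  by rewrite liftK.
pose x0 (i : 'I_n.+1) : P := if unlift ord_max i is Some j then p j else q.
have sE : \sum_i x0 i * G i = \sum_j p j * g^`M(j) - q * g.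
  rewrite GE /x0 unlift_none; congr (_ - _).
  by apply: eq_bigr => j _; rewrite liftK.
have ordS : mord_ge (N + c) (\sum_i x0 i * G i).
  apply/germ_ord_poly; rewrite sE.
  have -> : poly_germ (\sum_j p j * g^`M(j) - q * g) =
      poly_germ (\sum_j p j * g^`M(j)) - poly_germ q * poly_germ g.
    by rewrite rmorphB rmorphM.
  have : germ_eqmod (N + c) (poly_germ (\sum_j p j * g^`M(j))) (poly_germ q * poly_germ g).
    apply: (@germ_eqmod_trans _ (b * poly_germ g)); last first.
      by apply: germ_eqmodM qP _; apply: germ_eqmod_refl.
    rewrite -ab rmorph_sum /=; apply: (big_ind2 (germ_eqmod (N + c))) => [|x x' y y' xx yy|j _].
    - exact: germ_eqmod_refl.
    - exact: germ_eqmodD.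
    rewrite germ_deriv_poly rmorphM /=; apply: germ_eqmodM; last exact: germ_eqmod_refl.
    by apply: germ_eqmod_sym; apply: pP.
  by [].
have [|y [yE yord]] := AR _ _ ordS; first by exists x0.
exists (\row_j (p j - y (lift ord_max j))).
  apply/asboolP; exists (q - y ord_max).
  move: yE; rewrite sE GE => /eqP yE.
  have -> : \sum_j (\row_j0 (p j0 - y (lift ord_max j0))) 0 j * g^`M(j) =
      \sum_j p j * g^`M(j) - \sum_j y (lift ord_max j) * g^`M(j).
    rewrite -sumrB; apply: eq_bigr => j _; rewrite mxE mulrBl //.
  move: yE; rewrite -subr_eq0 => /eqP yE; apply/eqP; rewrite -subr_eq0; apply/eqP.
  by rewrite -[RHS]yE; ring.
move=> j; rewrite mxE; apply: (@germ_eqmod_trans _ (poly_germ (p j))).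
  by apply: germ_ordW (pP j); rewrite leq_addr.
apply/germ_eqmod_poly; have := yord (lift ord_max j); rewrite addnK opprB addrC subrK.
by [].
Qed.

End GermApproximation.

(** The weights are [k ^ i], for a nonzero integer [k] at which finitely many polynomials, the
    differences of the [Pm m], do not vanish. They single out one monomial of least weight in a
    given polynomial. *)
Lemma separating_weights n (s : seq 'X_{1..n}) : exists w : 'I_n -> nat,
  (forall i, 0 < w i)%N /\ {in s &, injective (fun m : 'X_{1..n} => \sum_i (w i * m i)%N)}.
Proof.
pose Pm (m : 'X_{1..n}) : {poly rat} := \sum_(i < n) (m i)%:R *: 'X^i.
have coefPm m (j : 'I_n) : (Pm m)`_j = (m j)%:R.
  rewrite coef_sum (bigD1 j) //= coefZ coefXn eqxx mulr1 big1 ?addr0 // => i ij.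
  by rewrite coefZ coefXn eq_sym (negPf ij : ((i : nat) == j) = false) mulr0.
pose Q : {poly rat} := 'X * \prod_(m <- s) \prod_(m' <- s | m' != m) (Pm m' - Pm m).
have Q0 : Q != 0.
  rewrite mulf_neq0 ?polyX_eq0 // prodf_seq_neq0; apply/allP => m _ /=.
  rewrite prodf_seq_neq0; apply/allP => m' _; apply/implyP => /eqP mm.
  apply/eqP => /eqP; rewrite subr_eq0 => /eqP PE; apply: mm; apply/mnmP => j.
  by apply/eqP; rewrite -(eqr_nat rat) -!coefPm PE.
have [k] := poly_natr_nonroot Q0; rewrite rootM rootX negb_or => /andP[k0 kQ].
exists (fun i => k ^ i)%N; split=> [i|m m' ms ms' wE].
  by rewrite expn_gt0 lt0n; move: k0; rewrite pnatr_eq0 => ->.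
have hPm (m1 : 'X_{1..n}) : (Pm m1).[k%:R] = (\sum_(i < n) (k ^ i * m1 i)%N)%N%:R.
  rewrite horner_sum natr_sum; apply: eq_bigr => i _.
  by rewrite hornerZ hornerXn natrM natrX mulrC.
apply/eqP; apply: contraNT kQ => mm; apply/rootP; rewrite horner_prod.
apply/eqP; rewrite prodf_seq_eq0; apply/hasP; exists m' => //=.
rewrite horner_prod prodf_seq_eq0; apply/hasP; exists m => //=.
by rewrite mm hornerD hornerN !hPm wE subrr.
Qed.

Lemma mcoeff_mul_supp (A : comNzRingType) n (p g : {mpoly A[n]}) M :
  (p * g)@_M = \sum_(m <- msupp g | (m <= M)%MM) g@_m * p@_(M - m)%MM.
Proof.
rewrite {1}(mpolyE g) mulr_sumr raddf_sum [RHS]big_mkcond; apply: eq_bigr => m _ /=.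
rewrite -scalerAr mcoeffZ; case: ifPn => [mM|mM].
  by rewrite -{1}(submK mM) addmC mcoeffMX.
rewrite (mpolyE p) mulr_suml raddf_sum big1 ?mulr0 // => m' _ /=.
rewrite -scalerAl mcoeffZ -mpolyXD mcoeffX; case: eqP => [E|_]; last by rewrite mulr0.
by case/negP: mM; rewrite -E lem_addl.
Qed.

Section DivisionBound.
Variables (F : numFieldType) (n : nat) (g : {mpoly F[n]}).
Variables (a c : 'X_{1..n} -> F) (r A : F).
Hypotheses (g0 : g != 0) (r0 : 0 < r) (aA : forall m, `|a m| * r ^+ mdeg m <= A).
Hypothesis acg : forall M, a M = \sum_(m <- msupp g | (m <= M)%MM) g@_m * c (M - m)%MM.

(* With [e] small, the coefficients weighted by [e ^+ wt m] see only the
   monomial of [g] of least weight, by which one can divide. *)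
Lemma division_bound : exists rho B, 0 < rho /\ forall m, `|c m| * rho ^+ mdeg m <= B.
Proof.
have [w [w0 winj]] := separating_weights (msupp g).
pose wt (m : 'X_{1..n}) := (\sum_i (w i * m i))%N.
have wtD m m' : wt (m + m')%MM = (wt m + wt m')%N.
  by rewrite /wt -big_split; apply: eq_bigr => i _; rewrite mnmDE mulnDr.
have ex : exists k, has (fun m => wt m == k) (msupp g).
  by exists (wt (mlead g)); apply/hasP; exists (mlead g) => //; apply: mlead_supp.
case: (ex_minnP ex) => k0 /hasP[m0 m0g /eqP m0k] kmin.
have wmin m : m \in msupp g -> m != m0 -> (wt m0 < wt m)%N.
  move=> mg mm; rewrite ltn_neqAle m0k kmin; last by apply/hasP; exists m.
  by rewrite andbT -m0k; apply: contraNneq mm => /winj ->.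
pose G := \sum_(m <- msupp g) `|g@_m|; pose b := `|g@_m0|.
have b0 : 0 < b by rewrite normr_gt0 -mcoeff_msupp.
have bG : b <= G.
  by rewrite /G (big_rem m0) //= lerDl sumr_ge0.
have G0 := lt_le_trans b0 bG.
have r10 : 0 < 1 + r by rewrite addr_gt0.
(* The first factor makes [e] at most 1 and at most [r], the second makes [e * G] at most [b / 2]:
   the monomials of [g] other than [m0] contribute at most half. *)
pose e := r / (1 + r) * (b / (2 * G)).
have s1 : r / (1 + r) <= 1 by rewrite ler_pdivrMr // mul1r lerDr.
have s0 : 0 <= r / (1 + r) by rewrite divr_ge0 ?ltW.
have t0 : 0 <= b / (2 * G) by rewrite divr_ge0 ?mulr_ge0 ?ltW.
have t1 : b / (2 * G) <= 1.
  by rewrite ler_pdivrMr ?mulr_gt0 // mul1r mulr_natl mulr2n ler_wpDl ?(ltW G0).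
have e0 : 0 < e by rewrite mulr_gt0 // divr_gt0 // mulr_gt0.
have e1 : e <= 1 by rewrite mulr_ile1.
have er : e <= r.
  apply: (@le_trans _ _ (r / (1 + r))); first by rewrite ler_piMr.
  by rewrite ler_pdivrMr // ler_peMr ?(ltW r0) // lerDl ltW.
have eG : e * G <= b / 2.
  apply: (@le_trans _ _ (b / (2 * G) * G)).
    by rewrite ler_wpM2r ?(ltW G0) // ler_piMl.
  by rewrite invfM mulrA divfK ?gt_eqF.
move: e e0 e1 er eG => {s0 s1 t0 t1} e e0 e1 er eG.
have eX0 k : 0 < e ^+ k by rewrite exprn_gt0.
have A0 : 0 <= A by apply: le_trans (aA 0%MM); rewrite mulr_ge0 // exprn_ge0 // ltW.
have aB M : `|a M| * e ^+ wt M <= A.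
  apply: le_trans (aA M); rewrite ler_wpM2l //.
  apply: (@le_trans _ _ (e ^+ mdeg M)).
    apply: ler_wiXn2l; rewrite ?(ltW e0) //.
    by rewrite mdegE; apply: leq_sum => i _; rewrite leq_pmull.
  by rewrite lerXn2r // nnegrE ltW.
(* With [D = B * (b * e ^+ wt m0)], this is the solution of [A + D / 2 = D], so the bound reproduces
   itself in the induction on the weight. *)
pose B := 2 * A / (b * e ^+ wt m0).
have be0 : 0 < b * e ^+ wt m0 by rewrite mulr_gt0.
have B0 : 0 <= B by rewrite divr_ge0 ?mulr_ge0 // ltW.
have cB : forall m, `|c m| * e ^+ wt m <= B.
  suff H k : forall m, (wt m < k)%N -> `|c m| * e ^+ wt m <= B by move=> m; apply: (H (wt m).+1).
  elim: k => // k IH m; rewrite ltnS => mk.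
  set M := (m0 + m)%MM; have M0 : (m0 <= M)%MM by apply: lem_addr.
  have wM : wt M = (wt m0 + wt m)%N by rewrite wtD.
  have step : b * `|c m| <= `|a M| +
      \sum_(m' <- msupp g | (m' != m0) && (m' <= M)%MM) `|g@_m'| * `|c (M - m')%MM|.
    have -> : b * `|c m| = `|a M -
        \sum_(m' <- msupp g | (m' != m0) && (m' <= M)%MM) g@_m' * c (M - m')%MM|.
      rewrite acg big_mkcond (bigD1_seq m0) ?msupp_uniq //= M0 -big_mkcondr addrK normrM.
      by rewrite /M addmC addmK.
    apply: le_trans (ler_normB _ _) _; rewrite lerD2l.
    apply: le_trans (ler_norm_sum _ _ _) _.
    by apply: ler_sum => m' _; rewrite normrM.
  have tail : (\sum_(m' <- msupp g | (m' != m0) && (m' <= M)%MM)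
      `|g@_m'| * `|c (M - m')%MM|) * e ^+ wt M <= B * e ^+ wt m0 * (e * G).
    rewrite mulr_suml [leRHS]mulrA /G mulr_sumr big_mkcond /= big_seq [leRHS]big_seq.
    apply: ler_sum => m' m'g; case: ifP => [/andP[mm mM]|_]; last first.
      by rewrite mulr_ge0 // mulr_ge0 ?(ltW e0) // mulr_ge0 // ltW.
    rewrite -mulrA mulrC ler_wpM2r //.
    have wE : wt M = (wt (M - m')%MM + wt m')%N by rewrite -wtD submK.
    rewrite wE exprD mulrA -[leRHS]mulrA; apply: ler_pM; rewrite ?mulr_ge0 ?(ltW (eX0 _)) //.
      apply: IH; apply: leq_trans mk.
      by rewrite -(ltn_add2r (wt m')) -wE wM addnC ltn_add2l wmin.
    by rewrite -exprSr ler_wiXn2l ?(ltW e0) // wmin.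
  have : b * e ^+ wt m0 * (`|c m| * e ^+ wt m) <= A + A.
    have -> : b * e ^+ wt m0 * (`|c m| * e ^+ wt m) = b * `|c m| * e ^+ wt M.
      by rewrite wM exprD mulrACA mulrA.
    apply: (le_trans (ler_wpM2r (ltW (eX0 _)) step)); rewrite mulrDl lerD //.
    apply: (le_trans tail).
    apply: (@le_trans _ _ (B * e ^+ wt m0 * (b / 2))).
      by rewrite ler_wpM2l // mulr_ge0 // ltW.
    have -> : B * e ^+ wt m0 * (b / 2) = B * (b * e ^+ wt m0) / 2 by ring.
    by rewrite /B divfK ?gt_eqF // mulrC mulKf ?pnatr_eq0.
  by rewrite mulrC -ler_pdivlMr // -mulr2n -mulr_natl.
(* The weight of [m] is at most [mdeg m] times the sum of all weights, and [e] is at most 1. *)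
exists (e ^+ (\sum_i w i)), B; split=> // m; apply: le_trans (cB m).
rewrite ler_wpM2l // -exprM ler_wiXn2l ?(ltW e0) //.
rewrite mdegE big_distrl /=; apply: leq_sum => i _.
by rewrite leq_mul2l (bigD1 i) //= leq_addr orbT.
Qed.

End DivisionBound.

Section GermDivision.
Variables (R : realType) (n : nat).
Local Notation C := (Cplx R).
Local Notation P := {mpoly C[n]}.
Implicit Types (x y : germ R n) (p q g : P).

Lemma mord_ge_eq0 p : (forall d, mord_ge d p) -> p = 0.
Proof. by move=> pd; apply/mpolyP => m; rewrite mcoeff0 (pd (mdeg m).+1). Qed.

Lemma poly_germ_inj : injective (@poly_germ R n).
Proof.
move=> p q pq; apply/eqP; rewrite -subr_eq0; apply/eqP/mord_ge_eq0 => d.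
by apply/germ_eqmod_poly; rewrite pq; apply: germ_eqmod_refl.
Qed.

Lemma germ_mul_poly_eq0 x g : g != 0 -> x * poly_germ g = 0 -> x = 0.
Proof.
move=> g0 xg; have [e [ge pe]] := mord_exists g0; apply: germ_ord_eq0 => d.
have [p xp] := poly_approx x (d + e).
have : mord_ge (d + e) (p * g - 0).
  apply/germ_eqmod_poly; rewrite rmorph0 rmorphM -xg; apply: germ_eqmodM.
    exact: germ_eqmod_sym.
  exact: germ_eqmod_refl.
rewrite subr0 => /(mord_ge_mul_cancel ge pe); rewrite addnK => /germ_ord_poly pd.
rewrite -(subrK (poly_germ p) x); apply: germ_ordD pd.
by apply: germ_ordW xp; rewrite leq_addr.
Qed.

Lemma mord_ge_ptrunc c p d : (forall m, (mdeg m < d)%N -> c m = p@_m) -> mord_ge d (ptrunc c d - p).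
Proof. by move=> cp m md; rewrite mcoeffB mcoeff_ptrunc md cp ?subrr. Qed.

(* The quotients modulo the powers of the maximal ideal define a formal series,
   which converges by [division_bound]. *)
Lemma germ_divides_of_approx x g : g != 0 ->
  (forall N, exists c : P, germ_eqmod N x (poly_germ (c * g))) ->
  exists y, x = y * poly_germ g.
Proof.
move=> g0 /choice[q xq]; have [e [ge pe]] := mord_exists g0.
have [a [r [A [r0 aA xa]]]] := germ_series x.
(* Division by [g], of order [e], loses [e] orders of precision: the coefficient of [q N] at [m] no
   longer changes from [N = mdeg m + e + 1] on. *)
pose c m := (q (mdeg m + e).+1)@_m.
have aq N m : (mdeg m < N)%N -> a m = (q N * g)@_m.
  move=> mN; have : mord_ge N (ptrunc a N - q N * g).
    apply/germ_eqmod_poly; apply: germ_eqmod_trans (xq N).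
    by apply: germ_eqmod_sym; apply: xa.
  by move=> /(_ m mN); rewrite mcoeffB mcoeff_ptrunc mN => /eqP; rewrite subr_eq0 => /eqP.
have cq N m : (mdeg m + e < N)%N -> (q N)@_m = c m.
  move=> mN; have : mord_ge (mdeg m + e).+1 ((q N - q (mdeg m + e).+1) * g).
    rewrite mulrBl => m' m'd; rewrite mcoeffB -!aq ?subrr //.
    by apply: leq_trans mN.
  move=> /(mord_ge_mul_cancel ge pe); rewrite -addSn addnK => /(_ m (ltnSn _)).
  by rewrite mcoeffB => /eqP; rewrite subr_eq0 => /eqP.
have acg M : a M = \sum_(m <- msupp g | (m <= M)%MM) g@_m * c (M - m)%MM.
  rewrite (aq (mdeg M + e).+1) ?ltnS ?leq_addr // mcoeff_mul_supp.
  apply: eq_bigr => m mM; rewrite cq // ltnS leq_add2r.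
  by rewrite -{2}(submK mM) mdegD leq_addr.
have [rho [B [rho0 cB]]] := division_bound g0 r0 aA acg.
have [y yc] := germ_of_series rho0 cB; exists y.
apply/eqP; rewrite -subr_eq0; apply/eqP/germ_ord_eq0 => d.
apply: (@germ_eqmod_trans _ _ _ (poly_germ (q (d + e)%N * g))).
  by apply: germ_ordW (xq (d + e)%N); rewrite leq_addr.
rewrite rmorphM; apply: germ_eqmodM; last exact: germ_eqmod_refl.
apply: germ_eqmod_sym; apply: germ_eqmod_trans (yc d) _.
apply/germ_eqmod_poly; apply: mord_ge_ptrunc => m md.
by rewrite cq // ltn_add2r.
Qed.

Lemma logder_map_poly_germ g (a : 'rV[P]_n) : a \in logder_pred (@mderiv n C) g ->
  map_mx (@poly_germ R n) a \in logder_pred (@germ_deriv R n) (poly_germ g).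
Proof.
move=> /asboolP[b ab]; apply/asboolP; exists (poly_germ b).
rewrite -rmorphM -ab rmorph_sum; apply: eq_bigr => j _.
by rewrite mxE germ_deriv_poly /= rmorphM.
Qed.

(** The Cramer coordinates of a germ derivation are determinants with one row replaced. Approximated
    by polynomial ones, they are multiples of [g] to every order, hence multiples of [g]. *)
Lemma saito_free_of_det g (De : 'M[P]_n) c : g != 0 -> square_free g ->
  logder_rows (@mderiv n C) g De -> \det De = c%:MP * g -> c != 0 ->
  saito_free (poly_germ g).
Proof.
move=> g0 gsf Der detDe c0; pose De' := map_mx (@poly_germ R n) De.
have detDe' : \det De' = poly_germ c%:MP * poly_germ g.
  by rewrite poly_germ_det detDe rmorphM.
have Der' : logder_rows (@germ_deriv R n) (poly_germ g) De'.
  by move=> i; rewrite -map_row; apply: logder_map_poly_germ.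
have cV : poly_germ (c^-1)%:MP * poly_germ c%:MP = 1 :> germ R n.
  by rewrite -(rmorphM (@poly_germ R n)) -mpolyCM mulVf // mpolyC1 rmorph1.
have reg (x : 'rV[germ R n]_n) : poly_germ g *: x = 0 -> x = 0.
  move=> /rowP xg; apply/rowP => i; have := xg i; rewrite !mxE mulrC.
  exact: germ_mul_poly_eq0.
apply: (free_module_of_basis Der') => [x xD|x xDe].
- have /choice[y yE] i : exists y, (x *m \adj De') 0 i = y * poly_germ g.
    rewrite mul_adj_row; apply: germ_divides_of_approx => // N.
    have [x' x'D xx'] := logder_approx N xD.
    have [q qE] := det_logder_divides g0 gsf (logder_replace_row i Der x'D).
    exists q; rewrite -qE -poly_germ_det; apply: det_germ_eqmod => k l.
    rewrite !mxE; case: eqP => _; first exact: xx'.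
    exact: germ_eqmod_refl.
  exists (poly_germ (c^-1)%:MP *: (\row_i y i)).
  have : poly_germ g *: (poly_germ c%:MP *: x - \row_i y i *m De') = 0.
    rewrite scalerBr scalerA [_ * poly_germ c%:MP]mulrC -detDe' -mul_mx_scalar.
    rewrite -mul_adj_mx mulmxA scalemxAl -mulmxBl; apply/rowP => i.
    rewrite (_ : _ - _ = 0) ?mul0mx //; apply/rowP => j.
    by rewrite mxE yE !mxE mulrC subrr.
  move=> /reg/eqP; rewrite subr_eq0 => /eqP E.
  by rewrite -scalemxAl -E scalerA cV scale1r.
- have : poly_germ g *: (poly_germ c%:MP *: x) = 0.
    rewrite scalerA [_ * poly_germ c%:MP]mulrC -detDe' -mul_mx_scalar.
    by rewrite -mul_mx_adj mulmxA xDe mul0mx.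
  by move=> /reg E; rewrite -[x]scale1r -cV -scalerA E scaler0.
Qed.

End GermDivision.

(** * From the germs to the polynomials *)

(** Agreement of [p * q] with [r] up to degree [k] suffices to compare lowest coefficients, that of
    [r] being in degree [k]. *)
Lemma low_factor (S : idomainType) (p q r : {poly S}) k i :
  r`_k != 0 -> (forall m, (m < k)%N -> r`_m = 0) ->
  (forall m, (m <= k)%N -> (p * q)`_m = r`_m) ->
  q`_i != 0 -> (forall m, (m < i)%N -> q`_m = 0) ->
  exists j, k = (j + i)%N /\ r`_k = p`_j * q`_i.
Proof.
move=> rk rlow pqr qi qlow.
have [|j [pj plow]] := @low_coef_exists _ p.
  by apply: contraNneq rk => p0; rewrite -pqr // p0 mul0r coef0.
have [E low] := low_coefM plow qlow; exists j.
suff kE : k = (j + i)%N by split; rewrite // -E kE pqr // kE.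
apply/eqP; rewrite eqn_leq; apply/andP; split; rewrite leqNgt; apply/negP => lt.
  have := mulf_neq0 pj qi; rewrite -E pqr ?(ltnW lt) // rlow //.
  by rewrite eqxx.
by case/negP: rk; rewrite -pqr // low.
Qed.

Section MovingLine.
Variables (F : fieldType) (n : nat) (nu d : 'I_n -> F).
Implicit Types p : {mpoly F[n]}.

(** A direction depending on a parameter: in the values of [sigma] below, the outer variable is the
    parameter [t] of the line, the inner one the parameter [xi] of the direction. *)
Definition moving_line (j : 'I_n) : {poly F} := (nu j)%:P + (d j)%:P * 'X.

Notation sigma := (graded (@polyC F) moving_line).

(** Each variable brings one factor [t] and at most one factor [xi], so the degree in [xi] never
    exceeds that in [t]. *)
Lemma size_sigma p k : (size ((sigma p)`_k)%R <= k.+1)%N /\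
  ((sigma p)`_k)`_k = (pihomog mdeg k p).@[d].
Proof.
pose Q e (q : {poly F}) c := (size q <= e.+1)%N /\ q`_e = c.
have QM e1 e2 q1 q2 c1 c2 : Q e1 q1 c1 -> Q e2 q2 c2 -> Q (e1 + e2)%N (q1 * q2) (c1 * c2).
  move=> [s1 <-] [s2 <-]; split; last exact: coefM_top.
  apply: leq_trans (size_polyMleq _ _) _.
  by rewrite -subn1 leq_subLR (leq_trans (leq_add s1 s2)) // addSn addnS.
have QX j e : Q e (moving_line j ^+ e) (d j ^+ e).
  elim: e => [|e IH]; first by split; rewrite ?size_poly1 ?coef1.
  rewrite !exprS -add1n; apply: QM IH; split.
    rewrite (leq_trans (size_polyD _ _)) // geq_max (leq_trans (size_polyC_leq1 _)) //.
    by rewrite (leq_trans (size_polyMleq _ _)) // size_polyX addn2 /= ltnS size_polyC_leq1.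
  by rewrite coefD coefC coefMX coefC add0r.
rewrite coef_graded pihomogE raddf_sum /=.
apply: (big_ind2 (Q k)) => [|q1 c1 q2 c2 [s1 <-] [s2 <-]|m /eqP mk].
- by split; rewrite ?size_poly0 ?coef0.
- split; last by rewrite coefD.
  by rewrite (leq_trans (size_polyD _ _)) // geq_max s1.
rewrite mevalZ mevalX -[k]add0n; apply: (QM).
  by split; rewrite ?coefC ?size_polyC_leq1.
rewrite -mk mdegE; apply: (big_ind3 (fun e q c => Q e q c)) => //.
  by split; rewrite ?size_poly1 ?coef1.
by move=> ? ? ? ? ? ?; apply: QM.
Qed.

Lemma sigma_coef0 p : (sigma p)`_0 = (p@_0)%:P.
Proof.
have [s E] := size_sigma p 0; rewrite [LHS]size1_polyC // E; congr _%:P.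
rewrite pihomogE raddf_sum /=.
have [p0|p0] := boolP (0%MM \in msupp p).
  rewrite big_mkcond (bigD1_seq 0%MM) ?msupp_uniq //= mdeg0 eqxx mevalZ mpolyX0 meval1 mulr1.
  by rewrite big1 ?addr0 // => m m0; rewrite mdeg_eq0 (negPf m0).
rewrite (memN_msupp_eq0 p0) big_seq_cond big1 // => m /andP[mp].
by rewrite mdeg_eq0 => /eqP m0; rewrite -m0 mp in p0.
Qed.

Lemma unit_of_low_coefs N k l (Y Z c D G : {mpoly F[n]}) :
  mord_ge N (Y * c - D) -> mord_ge N (Z * c - G) -> (k < N)%N -> (l < N)%N ->
  (forall i, (i < k)%N -> (sigma D)`_i = 0) -> size (sigma D)`_k = 1%N ->
  (forall i, (i < l)%N -> (sigma G)`_i = 0) -> size (sigma G)`_l = l.+1 ->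
  c@_0 != 0.
Proof.
move=> YcD ZcG kN lN Dlow Dk Glow Gl.
have agree W E m : mord_ge N (W * c - E) -> (m < N)%N -> (sigma W * sigma c)`_m = (sigma E)`_m.
  move=> WE mN; apply/eqP; rewrite -subr_eq0 -coefB -gradedM -gradedB.
  by rewrite (coef_graded_mord _ _ WE).
have Dk0 : (sigma D)`_k != 0 by rewrite -size_poly_eq0 Dk.
have Gl0 : (sigma G)`_l != 0 by rewrite -size_poly_eq0 Gl.
have [|i [ci clow]] := @low_coef_exists _ (sigma c).
  apply: contraNneq Dk0 => c0; rewrite -(agree Y D k) // c0 mulr0 coef0 //.
have [j [kE DE]] := low_factor Dk0 Dlow (fun m mk => agree Y D m YcD (leq_ltn_trans mk kN)) ci clow.
have [j' [lE GE]] := low_factor Gl0 Glow (fun m ml => agree Z G m ZcG (leq_ltn_trans ml lN)) ci clow.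
have Yj0 : (sigma Y)`_j != 0 by apply: contraNneq Dk0 => E; rewrite DE E mul0r.
have Zj0 : (sigma Z)`_j' != 0 by apply: contraNneq Gl0 => E; rewrite GE E mul0r.
(* The lowest coefficient of [D] is a nonzero constant in [xi], and so are its factors. *)
have ci1 : size (sigma c)`_i = 1%N.
  have := Dk; rewrite DE size_mul //.
  move: ci Yj0; rewrite -!size_poly_gt0; case: (size _) => // a _; case: (size _) => // b _.
  by rewrite addSn addnS /= => -[] /eqP; rewrite addn_eq0 => /andP[_ /eqP ->].
(* The lowest coefficient of [G] has degree [l = j' + i] in [xi], but its factor from [c] is
   constant and the one from [Z] has degree at most [j']. *)
have i0 : i = 0%N.
  have := Gl; rewrite GE size_mul // ci1 addn1 /= => E.
  have := (size_sigma Z j').1; rewrite E ltnS lE.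
  by rewrite -[X in (_ <= X)%N]addn0 leq_add2l leqn0 => /eqP.
move: ci; rewrite i0 sigma_coef0 polyC_eq0.
by [].
Qed.

End MovingLine.

Lemma divides_exp_cancel (A : idomainType) (f b : A) : f != 0 ->
  (forall q, divides f (b * q) -> divides f q) ->
  forall k m q, divides (f ^+ k) (b ^+ m * q) -> divides (f ^+ k) q.
Proof.
move=> f0 fb k m; have fbm : forall q, divides f (b ^+ m * q) -> divides f q.
  elim: m => [|m IH] q; first by rewrite mul1r.
  by rewrite exprS -mulrA => /fb/IH.
elim: k => [|k IH] q; first by exists q; rewrite mulr1.
move=> [y E]; have [|x qE] := fbm q; first by exists (y * f ^+ k); rewrite E exprSr mulrA.
have : divides (f ^+ k) (b ^+ m * x).
  by exists y; apply: (mulIf f0); rewrite -mulrA -qE E exprSr mulrA.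
by move=> /IH[z xE]; exists z; rewrite qE xE exprSr mulrA.
Qed.

Lemma mpoly_mulrn_eq0 (F : numDomainType) n (p : {mpoly F[n]}) k : p *+ k.+1 = 0 -> p = 0.
Proof.
move=> /mpolyP pk; apply/mpolyP => m; have := pk m; rewrite mcoeffMn !mcoeff0.
by move=> /eqP; rewrite mulrn_eq0 => /eqP.
Qed.

(** * Elimination along a generic direction *)

Section ShearGradient.
Variables (F : numFieldType) (n : nat) (l : 'I_n -> F).
Local Notation P := {mpoly F[n.+1]}.
Implicit Types g : P.

Definition dir_deriv g : P := \sum_i (shear_dir l i)%:MP * g^`M(i).

Lemma divides_size (A : idomainType) (p q : {poly A}) :
  q != 0 -> divides p q -> (size p <= size q)%N.
Proof.
move=> q0 [y qE]; move: q0; rewrite qE mulf_eq0 negb_or => /andP[y0 p0].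
by rewrite size_mul //; have := y0; rewrite -size_poly_gt0; case: (size y) => // k _; rewrite addSn leq_addl.
Qed.

Lemma square_free_shear g : square_free g -> square_free (shear l g).
Proof.
move=> gsf q r E; have : unshear l q \is a GRing.unit.
  by apply: (gsf _ (unshear l r)); rewrite -[LHS](shearK l) E rmorphM rmorphXn.
by rewrite (unit_iso q (unshearK l)); exact.
Qed.

Lemma factorial_poly_mpoly : factorial_ring {poly {mpoly F[n]}}.
Proof. by apply: factorial_poly; apply: factorial_mpoly. Qed.

(** As the leading coefficient of [shear l g] is a unit, so is that of each prime factor [p]. Hence
    [p] has positive degree and a nonzero derivative of smaller degree, which it does not divide. *)
Lemma divides_deriv_shear g a q : a != 0 -> lead_coef (shear l g) = a%:MP -> square_free g ->
  divides (shear l g) ((shear l g)^`() * q) -> divides (shear l g) q.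
Proof.
move=> a0 lg /square_free_shear gsf; rewrite mulrC => gq.
apply: (@square_free_divides _ unit (fun _ => @deriv _)) => //.
- exact: factorial_poly_mpoly.
- by move=> _ p1 p2; rewrite derivM.
- by rewrite -lead_coef_eq0 lg mpolyC_eq0.
move=> p [p0 pu _] [h E]; exists tt => pd.
have lpu : lead_coef p \is a GRing.unit.
  have : lead_coef h * lead_coef p \is a GRing.unit.
    by rewrite -lead_coefM -E lg; apply: rmorph_unit; rewrite unitfE.
  by rewrite unitrM => /andP[].
have sp : (1 < size p)%N.
  rewrite ltnNge; apply: contra pu => p1.
  by move: lpu; rewrite (size1_polyC p1) lead_coefC; apply: rmorph_unit.
have dp0 : p^`() != 0.
  apply/eqP => /polyP/(_ (size p).-2); rewrite coef_deriv coef0.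
  case: (size p) (lead_coefE p) sp => // -[//|k] /= <- _ /eqP.
  by move=> /eqP/mpoly_mulrn_eq0 p0'; move: lpu; rewrite p0' unitr0.
by have := divides_size dp0 pd; rewrite leqNgt lt_size_deriv.
Qed.

Lemma shear_dir_deriv g : shear l (dir_deriv g) = (shear l g)^`().
Proof. by rewrite deriv_shear. Qed.

(** Being free of the variable of the shear, [D] becomes a polynomial in the [X_j - l_j X_max],
    constant along [(l, 1)]. Powers appear because only powers of [g] and of its derivative will be
    multiples of [c] to a high order. *)
Lemma eliminant_exists g a k : a != 0 -> lead_coef (shear l g) = a%:MP -> square_free g ->
  exists D u w, D != 0 /\ unshear_coef l D = u * g ^+ k + w * dir_deriv g ^+ k.
Proof.
move=> a0 lg gsf; set f := shear l g in lg.
have f0 : f != 0 by rewrite -lead_coef_eq0 lg mpolyC_eq0.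
pose f1 := (a^-1)%:MP%:P * f.
have aV : (a^-1)%:MP%:P * a%:MP%:P = 1 :> {poly {mpoly F[n]}}.
  by rewrite -polyCM -mpolyCM mulVf.
have f1m : f1 ^+ k \is monic.
  apply: monic_exp; rewrite monicE lead_coefM lead_coefC lg -mpolyCM mulVf //.
have ff1 q : divides (f ^+ k) q <-> divides (f1 ^+ k) q.
  have aVk : (a^-1)%:MP%:P ^+ k * a%:MP%:P ^+ k = 1 :> {poly {mpoly F[n]}}.
    by rewrite -exprMn aV expr1n.
  rewrite /f1 exprMn; split=> -[y ->].
    by exists (y * a%:MP%:P ^+ k); rewrite -mulrA [X in _ = _ * X]mulrA [_ * (a^-1)%:MP%:P ^+ k]mulrC aVk mul1r.
  by exists (y * (a^-1)%:MP%:P ^+ k); rewrite mulrA.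
have [D [u [w [D0 E]]]] := @elim_coprime _ (f1 ^+ k) (f^`() ^+ k) f1m (fun q fq =>
  (ff1 q).1 (divides_exp_cancel f0 (fun q' => @divides_deriv_shear g a q' a0 lg gsf) ((ff1 _).2 fq))).
exists D, (unshear l u * (a^-1)%:MP ^+ k), (unshear l w); split=> //.
have unD p q : unshear l (p + q) = unshear l p + unshear l q by exact: rmorphD.
have unM p q : unshear l (p * q) = unshear l p * unshear l q by exact: rmorphM.
have unX p m : unshear l (p ^+ m) = unshear l p ^+ m by exact: rmorphXn.
have := congr1 (unshear l) E; rewrite unshearC unD !unM !unX -shear_dir_deriv shearK.
by rewrite /f1 unM unshearC unshear_coefC shearK exprMn mulrA.
Qed.

End ShearGradient.

Section MovingLineShear.
Variables (F : fieldType) (n : nat) (l z : 'I_n -> F).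

Definition lift_pt (i : 'I_n.+1) : F := if unlift ord_max i is Some j then z j else 0.

Lemma gradedC (A S : comNzRingType) (f : {rmorphism A -> S}) m (v : 'I_m -> S) c :
  graded f v c%:MP = (f c)%:P.
Proof. by rewrite /graded mmapC. Qed.

Lemma gradedX (A S : comNzRingType) (f : {rmorphism A -> S}) m (v : 'I_m -> S) i :
  graded f v 'X_i = (v i)%:P * 'X.
Proof. by rewrite /graded mmapX mmap1U. Qed.

(** On the moving line [X_j - l_j X_max] is [(z_j + l_j xi - l_j xi) t]: the parameter [xi]
    cancels. *)
Lemma graded_unshear_coef D :
  graded (@polyC F) (moving_line lift_pt (shear_dir l)) (unshear_coef l D) =
  map_poly (@polyC F) (graded idfun z D).
Proof.
move: D; apply: mpoly_gen_ind => [c|j|p q Hp Hq|p q Hp Hq].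
- by rewrite unshear_coefC !gradedC map_polyC.
- rewrite unshear_coefX gradedB gradedM gradedC !gradedX /moving_line /lift_pt /shear_dir.
  rewrite liftK unlift_none rmorphM /= map_polyC map_polyX /= mulrA -mulrBl; congr (_ * _).
  by rewrite -polyCM -polyCB polyC0 add0r polyC1 mul1r addrK.
- by rewrite (rmorphD (unshear_coef l)) !gradedD Hp Hq rmorphD.
- by rewrite (rmorphM (unshear_coef l)) !gradedM Hp Hq rmorphM.
Qed.

End MovingLineShear.

(** * Polynomial local bases from bases of germs *)

Section LocalBasis.
Variables (R : realType) (n : nat).
Local Notation C := (Cplx R).
Local Notation P := {mpoly C[n.+1]}.
Implicit Types (g q : P).

(** The germ basis [B] satisfies [U *m B = g%:M] and [X *m B = K]. The determinants of these
    identities survive truncation, and [Y] and [Z] are those of the truncated [U] and [X]. *)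
Lemma approximate_basis g (K : 'M[P]_n.+1) q N : g != 0 -> square_free g ->
  saito_free (poly_germ g) -> logder_rows (@mderiv n.+1 C) g K -> \det K = q * g ->
  exists De c Y Z, [/\ logder_rows (@mderiv n.+1 C) g De, \det De = c * g,
    mord_ge N (Y * c - g ^+ n) & mord_ge N (Z * c - q)].
Proof.
move=> g0 gsf gfree Ker detK; have [e [ge pe]] := mord_exists g0.
have hchar m : poly_germ g *+ m = 0 -> m = 0%N.
  rewrite -(rmorphMn (@poly_germ R n.+1)) -(rmorph0 (@poly_germ R n.+1)).
  move=> /poly_germ_inj; case: m => // m /mpoly_mulrn_eq0 gE.
  by rewrite gE eqxx in g0.
have [B [U [Br UB Bspan _]]] := basis_of_free_module gfree hchar.
have Kr i : row i (map_mx (@poly_germ R n.+1) K) \in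
    logder_pred (@germ_deriv R n.+1) (poly_germ g).
  by rewrite -map_row; apply: logder_map_poly_germ.
have [x xE] := choice (fun i => Bspan _ (Kr i)).
pose X : 'M[germ R n.+1]_n.+1 := \matrix_(i, j) x i 0 j.
have XB : X *m B = map_mx (@poly_germ R n.+1) K.
  apply/row_matrixP => i; rewrite row_mul xE; congr (_ *m _).
  by apply/rowP => j; rewrite !mxE.
have apx M (T : 'M[germ R n.+1]_n.+1) : exists T' : 'M[P]_n.+1,
    germ_eqmod M (\det T) (poly_germ (\det T')).
  have [t tE] := choice (fun ij : 'I_n.+1 * 'I_n.+1 => poly_approx (T ij.1 ij.2) M).
  exists (\matrix_(i, j) t (i, j)); rewrite -poly_germ_det; apply: det_germ_eqmod => i j.
  by rewrite !mxE; exact: (tE (i, j)).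
(* The relations are afterwards divided by [g], which costs its order [e]. *)
pose M := (N + e)%N.
have [U' U'E] := apx M U; have [X' X'E] := apx M X.
have /choice[a aP] i : exists a : 'rV[P]_n.+1, a \in logder_pred (@mderiv n.+1 C) g /\
    forall j, germ_eqmod M (B i j) (poly_germ (a 0 j)).
  have [a aD aE] := logder_approx M (Br i); exists a; split=> // j.
  by have := aE j; rewrite mxE.
pose De : 'M[P]_n.+1 := \matrix_(i, j) a i 0 j.
have Der : logder_rows (@mderiv n.+1 C) g De.
  move=> i; rewrite (_ : row i De = a i); first exact: (aP i).1.
  by apply/rowP => j; rewrite !mxE.
have [c cE] := det_logder_divides g0 gsf Der.
have BE : germ_eqmod M (\det B) (poly_germ (c * g)).
  rewrite -cE -poly_germ_det; apply: det_germ_eqmod => i j; rewrite !mxE.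
  exact: (aP i).2.
exists De, c, (\det U'), (\det X').
have key y T (Y q' : P) : germ_eqmod M y (poly_germ Y) -> y * \det B = T ->
    T = poly_germ (q' * g) -> mord_ge N (Y * c - q').
  move=> yY yB TE; rewrite -[N](addnK e); apply: (mord_ge_mul_cancel ge pe).
  have -> : (Y * c - q') * g = Y * (c * g) - q' * g by ring.
  apply/germ_eqmod_poly; rewrite -TE -yB (rmorphM (@poly_germ R n.+1)).
  by apply: germ_eqmod_sym; apply: germ_eqmodM.
split=> //.
- apply: (key _ _ _ _ U'E erefl); rewrite -det_mulmx UB det_scalar.
  by rewrite -(rmorphXn (@poly_germ R n.+1)) exprSr.
- by apply: (key _ _ _ _ X'E erefl); rewrite -det_mulmx XB poly_germ_det detK.
Qed.

Lemma local_basis_of_saito_free g : (1 < msize g)%N -> square_free g ->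
  saito_free (poly_germ g) -> exists (De : 'M[P]_n.+1) c,
    [/\ logder_rows (@mderiv n.+1 C) g De, \det De = c * g & c@_0 != 0].
Proof.
move=> g1 gsf gfree.
have g0 : g != 0 by apply: contraTneq g1 => ->; rewrite msize0.
have G0 : g ^+ n != 0 by rewrite expf_neq0.
have [e [Ge pe]] := mord_exists G0.
(* The direction avoids the zeros of two forms: the lowest one of [g ^+ n], so that its degree in
   [xi] is full, and the top one of [g], for the elimination. *)
have [l] := dhomog_nonzero_dir (dhomogM (pihomogP mdeg e (g ^+ n)) (pihomogP mdeg (msize g).-1 g))
  (mulf_neq0 pe (pihomog_top_neq0 g0)).
rewrite mevalM mulf_eq0 negb_or => /andP[Gl gl].
have lg := lead_coef_shear gl; set a := (X in X%:MP) in lg.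
pose u : 'rV[P]_n.+1 := \row_i (shear_dir l i)%:MP.
pose w : 'cV[P]_n.+1 := delta_mx ord_max 0.
have ub : (u *m gradient (@mderiv n.+1 C) g) 0 0 = dir_deriv l g.
  by rewrite mxE; apply: eq_bigr => i _; rewrite !mxE.
have uw : (u *m w) 0 0 = 1.
  by rewrite -colE !mxE /shear_dir unlift_none.
(* Otherwise [shear l g], being coprime to its derivative, would divide 1, and [g] would be
   constant. *)
have b0 : dir_deriv l g != 0.
  apply: contraTneq g1 => b0; rewrite -leqNgt.
  have : divides (shear l g) 1.
    apply: (divides_deriv_shear gl lg gsf); rewrite -shear_dir_deriv b0.
    by rewrite (rmorph0 (shear l)) mul0r; exists 0; rewrite mul0r.
  move=> /(divides_unit (unitr1 _)); rewrite (unit_iso g (shearK l)).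
  by case/andP => /eqP -> _; rewrite msizeC; case: eqP.
have detK := det_koszul_mx uw (eq_ind_r (fun x => x != 0) b0 ub); rewrite ub in detK.
have [D [v [v' [D0 DE]]]] := eliminant_exists n gl lg gsf.
(* The base point [z] keeps [D] nonzero on its line; [k] is its order there, and [N] exceeds both
   [k] and [e]. *)
have [z Dz] := mpoly_nonzero_pt D0.
have [|k [kD klow]] := @low_coef_exists _ (graded idfun z D).
  apply: contraNneq Dz => E; have := horner_graded idfun z D 1.
  rewrite E horner0 => ->; apply/eqP; apply: meval_eq => i; rewrite mulr1 //.
pose N := (maxn k e).+1.
have [De [c [Y [Z [Der detDe Yc Zc]]]]] :=
  approximate_basis N g0 gsf gfree (koszul_mx_rows _ _ _ _) detK.
exists De, c; split=> //.
have DcE : mord_ge N ((v * Y + v' * Z) * c - unshear_coef l D).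
  have -> : (v * Y + v' * Z) * c - unshear_coef l D =
      v * (Y * c - g ^+ n) + v' * (Z * c - dir_deriv l g ^+ n) by rewrite DE; ring.
  exact: (mord_geD (mord_geMl _ Yc) (mord_geMl _ Zc)).
apply: (@unit_of_low_coefs _ _ (lift_pt z) (shear_dir l) N k e _ _ _ _ _ DcE Yc).
- by rewrite ltnS leq_maxl.
- by rewrite ltnS leq_maxr.
- by move=> i ik; rewrite graded_unshear_coef coef_map /= klow.
- by rewrite graded_unshear_coef coef_map size_polyC kD.
- exact: coef_graded_mord.
have [s sE] := size_sigma (lift_pt z) (shear_dir l) (g ^+ n) e.
apply/eqP; rewrite eqn_leq s ltnNge; apply: contra Gl => /leq_sizeP/(_ e (leqnn e)).
by rewrite sE => ->.
Qed.

End LocalBasis.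

(** * Translations to the origin *)

Section Translation.
Variables (A : comNzRingType) (n : nat) (a : 'I_n -> A).
Implicit Types p q : {mpoly A[n]}.

Definition translate := mmap (@mpolyC n A) (fun i => (a i)%:MP + 'X_i).
HB.instance Definition _ := GRing.RMorphism.copy translate translate.

Lemma translateD p q : translate (p + q) = translate p + translate q.
Proof. exact: rmorphD. Qed.

Lemma translateM p q : translate (p * q) = translate p * translate q.
Proof. exact: rmorphM. Qed.

Lemma translateC c : translate c%:MP = c%:MP.
Proof. by rewrite /translate mmapC. Qed.

Lemma translateX i : translate 'X_i = (a i)%:MP + 'X_i.
Proof. by rewrite /translate mmapX mmap1U. Qed.

Lemma translate_eval p v : (translate p).@[v] = p.@[fun i => a i + v i].
Proof.
move: p; apply: mpoly_gen_ind => [c|i|p q Hp Hq|p q Hp Hq].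
- by rewrite translateC !mevalC.
- by rewrite translateX mevalD mevalC !mevalXU.
- by rewrite translateD !mevalD Hp Hq.
- by rewrite translateM !mevalM Hp Hq.
Qed.

Lemma translate_deriv p j : (translate p)^`M(j) = translate p^`M(j).
Proof.
move: p; apply: mpoly_gen_ind => [c|i|p q Hp Hq|p q Hp Hq].
- by rewrite translateC !mderivC (rmorph0 translate).
- rewrite translateX mderivD mderivC add0r mderivX mnm1E.
  have [->|_] := eqVneq i j; last by rewrite scale0r (rmorph0 translate).
  by rewrite -{1 3}[U_(j)%MM]add0m !addmK mpolyX0 scale1r (rmorph1 translate).
- by rewrite translateD !mderivD Hp Hq translateD.
- by rewrite translateM !mderivM Hp Hq translateD !translateM.
Qed.

End Translation.
Global Opaque translate.

Lemma translateK (A : comNzRingType) n (a b : 'I_n -> A) : (forall i, a i + b i = 0) ->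
  cancel (translate a) (translate b).
Proof.
move=> ab; apply: mpoly_gen_ind => [c|i|p q Hp Hq|p q Hp Hq].
- by rewrite !translateC.
- by rewrite translateX translateD translateC translateX addrA -mpolyCD ab mpolyC0 add0r.
- by rewrite !translateD Hp Hq.
- by rewrite !translateM Hp Hq.
Qed.

Lemma meval_at0 (A : comNzRingType) n (p : {mpoly A[n]}) : p.@[fun=> 0] = p@_0.
Proof.
move: p; apply: mpoly_gen_ind => [c|i|p q Hp Hq|p q Hp Hq].
- by rewrite mevalC mcoeffC eqxx mulr1.
- by rewrite mevalXU mcoeffX mnm1_eq0.
- by rewrite mevalD mcoeffD Hp Hq.
- by rewrite mevalM rmorphM Hp Hq.
Qed.

Section TranslateDerivations.
Variables (F : fieldType) (n : nat) (a : 'I_n -> F).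
Implicit Types g : {mpoly F[n]}.

Let aN i : a i + - a i = 0. Proof. exact: subrr. Qed.
Let Na i : - a i + a i = 0. Proof. exact: addNr. Qed.

Lemma square_free_translate g : square_free g -> square_free (translate a g).
Proof.
move=> gsf q r E.
rewrite -(unit_iso q (translateK Na)); apply: (gsf _ (translate (fun i => - a i) r)).
by rewrite -[LHS](translateK aN) E expr2 !translateM -expr2.
Qed.

Lemma msize_translate g : (1 < msize g)%N -> (1 < msize (translate a g))%N.
Proof.
rewrite !ltnNge; apply: contra => /msize1_polyC E.
by rewrite -[g](translateK aN) E translateC msizeC; case: eqP.
Qed.

Lemma logder_rows_translate g m (De : 'M_(m, n)) : logder_rows (@mderiv n F) g De ->
  logder_rows (@mderiv n F) (translate a g) (map_mx (translate a) De).
Proof.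
move=> Der i; have /asboolP[b bE] := Der i; apply/asboolP; exists (translate a b).
rewrite -translateM -bE (rmorph_sum (translate a)); apply: eq_bigr => j _ /=.
by rewrite !mxE translate_deriv translateM.
Qed.

End TranslateDerivations.

(** * The two implications *)

Section FreeHypersurface.
Variables (R : realType) (n : nat).
Local Notation C := (Cplx R).
Local Notation P := {mpoly C[n.+1]}.
Local Notation D := (@mderiv n.+1 C).
Implicit Types (g : P) (a : 'I_n.+1 -> C).

Lemma germ_at_translate g (p : 'rV[C]_n.+1) : germ_at g p = poly_germ (translate (p 0) g).
Proof.
apply: to_germ_ext => z; rewrite /= translate_eval.
by apply: meval_eq => i; rewrite mxE.
Qed.

Lemma koszul_partial g j : g^`M(j) != 0 ->
  exists K : 'M[P]_n.+1, logder_rows D g K /\ \det K = g^`M(j) ^+ n * g.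
Proof.
move=> gj; pose u : 'rV[P]_n.+1 := delta_mx 0 j; pose w : 'cV[P]_n.+1 := delta_mx j 0.
have ub : (u *m gradient D g) 0 0 = g^`M(j) by rewrite -rowE !mxE.
have uw : (u *m w) 0 0 = 1 by rewrite -rowE !mxE !eqxx.
exists (koszul_mx D g u w); split; first exact: koszul_mx_rows.
have := det_koszul_mx uw (eq_ind_r (fun x => x != 0) gj ub); rewrite ub => detK.
exact: detK.
Qed.

Lemma basis_of_A_free g : g != 0 -> square_free g -> A_free g ->
  exists (De : 'M[P]_n.+1) c, [/\ logder_rows D g De, \det De = c%:MP * g & c != 0].
Proof.
move=> g0 gsf gfree; have hchar m : g *+ m = 0 -> m = 0%N.
  by case: m => // m /mpoly_mulrn_eq0 gE; rewrite gE eqxx in g0.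
have [De [U [Der UDe Dspan _]]] := basis_of_free_module gfree hchar.
have [c cE] := det_logder_divides g0 gsf Der.
have div_det (K : 'M[P]_n.+1) q : logder_rows D g K -> \det K = q * g -> divides c q.
  move=> Ker Kq; have [x xE] := choice (fun i => Dspan _ (Ker i)).
  pose X : 'M[P]_n.+1 := \matrix_(i, j) x i 0 j.
  have XE : X *m De = K.
    apply/row_matrixP => i; rewrite row_mul xE; congr (_ *m _).
    by apply/rowP => j; rewrite !mxE.
  by exists (\det X); apply: (mulIf g0); rewrite -Kq -XE det_mulmx cE mulrA.
have cg : divides c (g ^+ n).
  exists (\det U); apply: (mulIf g0).
  by rewrite -mulrA -cE -det_mulmx UDe det_scalar exprSr.
have c0 : c != 0.
  by apply: contra_neq (expf_neq0 n g0) => c0; have [x ->] := cg; rewrite c0 mulr0.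
have [cu|cnu] := boolP (c \is a GRing.unit).
  exists De, c@_0; case/andP: cu => /eqP cC; rewrite unitfE => c00.
  by split=> //; rewrite cE {1}cC.
have prime_exp (p q : P) m : prime_elt p -> divides p (q ^+ m) -> divides p q.
  move=> [_ pu pP]; elim: m => [|m IH]; last by rewrite exprS => /pP[].
  by move=> /(divides_unit (unitr1 _)) pu'; rewrite pu' in pu.
(* A prime factor of [c] would divide [g] and, through the matrices of [koszul_partial], every
   nonzero partial derivative of [g], which is impossible for a square-free [g]. *)
have [p pp pc] := factorial_prime_divisor (@factorial_mpoly C n.+1) c0 cnu.
have pg := prime_exp _ _ n pp (divides_trans pc cg).
have [j pj] := square_free_derivation (delta := D) (fun j p q => mderivM j p q) gsf
  (fun p pp _ => prime_not_divides_gradient pp) pp pg.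
have gj : g^`M(j) != 0 by apply: contra_notN pj => /eqP ->; exists 0; rewrite mul0r.
have [K [Ker detK]] := koszul_partial gj.
by case: pj; apply: (prime_exp _ _ n pp); apply: divides_trans pc (div_det _ _ Ker detK).
Qed.

Lemma saito_free_of_A_free g (p : 'rV[C]_n.+1) : g != 0 -> square_free g ->
  A_free g -> saito_free (germ_at g p).
Proof.
move=> g0 gsf /(basis_of_A_free g0 gsf)[De [c [Der detDe c0]]]; rewrite germ_at_translate.
have aN i : p 0 i + - p 0 i = 0 by exact: subrr.
apply: (saito_free_of_det _ (square_free_translate gsf) (logder_rows_translate _ Der) _ c0).
  by apply: contra_neq g0 => E; rewrite -[g](translateK aN) E (rmorph0 (translate _)).
by rewrite (det_map_mx (translate _)) detDe /= translateM translateC.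
Qed.

Lemma A_free_of_saito_free g : (1 < msize g)%N -> square_free g ->
  (forall p : 'rV[C]_n.+1, sing g p -> saito_free (germ_at g p)) -> A_free g.
Proof.
move=> g1 gsf gfree.
have g0 : g != 0 by apply: contraTneq g1 => ->; rewrite msize0.
apply: free_logder_of_local => // a.
(* Off the hypersurface, [g] times the coordinate derivations have determinant [g ^+ n * g]. *)
have [ga|ga] := eqVneq g.@[a] 0; last first.
  exists g%:M, (g ^+ n); split; last by rewrite (rmorphXn (meval a)) expf_neq0.
    move=> i; rewrite -scalemx1 linearZ /= row1; exact: logder_scalar_row.
  by rewrite det_scalar exprSr.
(* At a smooth point some partial derivative is nonzero and gives the local basis. *)
have [[j gj]|/forallNP gj] := pselect (exists j, (g^`M(j)).@[a] != 0).
  have [|K [Ker detK]] := @koszul_partial g j; first by apply: contraNneq gj => ->; rewrite meval0.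
  by exists K, (g^`M(j) ^+ n); split=> //; rewrite (rmorphXn (meval a)) expf_neq0.
pose p : 'rV[C]_n.+1 := \row_i a i; have pa : p 0 = a by apply/funext => i; rewrite mxE.
have psing : sing g p.
  by split=> [|j]; rewrite pa //; have /negP := gj j; rewrite negbK => /eqP.
have := gfree p psing; rewrite germ_at_translate pa.
move=> /(local_basis_of_saito_free (msize_translate a g1) (square_free_translate gsf)).
move=> [De [c [Der detDe c0]]].
have aN i : a i + - a i = 0 by exact: subrr.
exists (map_mx (translate (fun i => - a i)) De), (translate (fun i => - a i) c); split.
- by rewrite -{1}[g](translateK aN); apply: logder_rows_translate.
- by rewrite (det_map_mx (translate _)) detDe /= translateM (translateK aN).
- rewrite translate_eval (_ : (fun i => _) = fun=> 0) ?meval_at0 //.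
  by apply/funext => i; rewrite addNr.
Qed.

End FreeHypersurface.

Local Open Scope classical_set_scope.

Theorem theorem3p10 (R : realType) (n : nat) (g : {mpoly (Cplx R)[n]})
    (g_nonconstant : (1 < msize g)%N) (g_reduced : squarefree g) :
  (A_free g <-> forall p : 'rV[Cplx R]_n, sing g p -> saito_free (germ_at g p))
  /\ (sing g = set0 -> A_free g).
Proof.
case: n g g_nonconstant g_reduced => [|n] g g1 gsf.
  by move: g1; rewrite (nvar0_mpolyC g) msizeC; case: eqP.
have g0 : g != 0 by apply: contraTneq g1 => ->; rewrite msize0.
split; first split=> [gfree p _|]; [exact: saito_free_of_A_free | exact: A_free_of_saito_free |].
by move=> gs; apply: A_free_of_saito_free => // p; rewrite gs.
Qed.
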